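(* Let $\mathscr{F}_0$ denote the function $$\mathscr{F}_0=v^{\frac{2}{n}}\left(S+\mathrm{tr}\big((L^{(0)})^2\big)\right)$$ defined on the velocity phase space of the cohomogeneity one expanding gradient Ricci soliton equations, where $L^{(0)}$ is the trace-free part of $L$. Then along the trajectory of a complete smooth non-Einstein expanding gradient Ricci soliton of cohomogeneity one with a special orbit, $\mathscr{F}_0$ is non-increasing as a function of $t$ for sufficiently large $t$.
   Context: An expanding gradient Ricci soliton is $(M,\bar g,u)$, with $\bar g$ a smooth Riemannian metric and $u$ a smooth function, satisfying $\mathrm{Ric}(\bar g)+\mathrm{Hess}(u)+\frac{\epsilon}{2}\bar g=0$ for a constant $\epsilon>0$. It is complete if $\bar g$ is complete, and non-Einstein if $\bar g$ is not an Einstein metric. ''Cohomogeneity one with a special orbit'' refers to the following setting. $M$ is noncompact of dimension $n+1$. There is a compact submanifold of $M$ (the special orbit) such that, with $t\in[0,\infty)$ the distance from it, the complement is identified with $(0,\infty)\times P$ with $P$ a compact $n$-manifold, and $\bar g=dt^2+g_t$ there, where $g_t$ is a metric on the hypersurface $P_t=\{t\}\times P$. As $t\to0$ the hypersurfaces collapse smoothly onto the special orbit, which is placed at $t=0$, with collapsing spheres of dimension $k\ge1$ (so the special orbit has codimension $k+1$). The potential $u$ is a function of $t$ only. The scalar curvature $S$ of $g_t$ and the mean curvature $\mathrm{tr}\,L$ of $P_t$ with respect to $\partial/\partial t$ are constant on each $P_t$; here $L=L_t$ is the shape operator, defined by $\dot g_t=2g_tL_t$. This holds for instance if a compact Lie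 group acts isometrically with principal orbits $P_t$ and preserves $u$. The potential is normalized by $u(0)=0$. A dot denotes $d/dt$. The relative volume $v(t)$ is defined by $d\mu_{g_t}=v(t)\,d\mu_Q$, where $Q$ is a fixed background metric on $P$ (so $\mathrm{tr}\,L=\dot v/v$). The trace-free part of $L$ is $L^{(0)}=L-\frac{1}{n}(\mathrm{tr}\,L)\,\mathrm{Id}$. In this setting the soliton equations are the system $-\mathrm{tr}(\dot L)-\mathrm{tr}(L^2)+\ddot u+\frac{\epsilon}{2}=0$, $\; r_t-(\mathrm{tr}\,L)L-\dot L+\dot uL+\frac{\epsilon}{2}\mathrm{Id}=0$, $\; d(\mathrm{tr}\,L)+\delta^{\nabla}L=0$, where $r_t$ is the Ricci endomorphism of $g_t$ and $\delta^{\nabla}$ is the codifferential on $TP$-valued $1$-forms. The trajectory of a soliton is the curve $t\mapsto(g_t,L_t,u,\dot u)$, so that along it $\mathscr{F}_0$ is a function of $t$. *)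

(* Defs.v *)
From HB Require Import structures.
From mathcomp Require Export all_boot all_order all_algebra.
From mathcomp Require Export all_classical all_reals all_analysis.
Set Implicit Arguments.
Unset Strict Implicit.
Unset Printing Implicit Defensive.
Export Order.TTheory GRing.Theory Num.Theory numFieldNormedType.Exports.
Local Open Scope classical_set_scope.
Local Open Scope ring_scope.

Definition partial (R : realType) m (a : 'I_m) (f : 'rV[R]_m -> R) :
  'rV[R]_m -> R := fun x => 'D_(delta_mx 0 a) f x.

Definition partials (R : realType) m (s : seq 'I_m) (f : 'rV[R]_m -> R) :
  'rV[R]_m -> R := foldr (@partial R m) f s.

(* All iterated partial derivatives exist and are continuous; only meant for
   open A. *)
Definition smooth_on (R : realType) m (A : set 'rV[R]_m) (f : 'rV[R]_m -> R) :=
  forall (s : seq 'I_m) (x : 'rV[R]_m), A x ->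
    {for x, continuous (partials s f)} /\
    forall a : 'I_m, derivable (partials s f) x (delta_mx 0 a).

Definition smooth_map_on (R : realType) m p (A : set 'rV[R]_m)
    (F : 'rV[R]_m -> 'rV[R]_p) :=
  forall b : 'I_p, smooth_on A (fun x => F x 0 b).

(* Points are row vectors, so (jac F x) a b is the derivative of the b-th
   component in direction a and v *m jac F x is the image of v. *)
Definition jac (R : realType) m p (F : 'rV[R]_m -> 'rV[R]_p) (x : 'rV[R]_m) :
  'M[R]_(m, p) := \matrix_(a, b) partial a (fun y => F y 0 b) x.

(* The values of fwd off dom, and of bwd off the image of dom, are junk. *)
Record chart (R : realType) (T : topologicalType) (m : nat) := Chart {
  dom : set T;
  fwd : T -> 'rV[R]_m;
  bwd : 'rV[R]_m -> T;
  dom_open : open dom;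
  ran_open : open (fwd @` dom);
  fwdK : forall p, dom p -> bwd (fwd p) = p;
  fwd_continuous : {within dom, continuous fwd};
  bwd_continuous : {within fwd @` dom, continuous bwd} }.

Definition ran (R : realType) (T : topologicalType) m (c : chart R T m) :
  set 'rV[R]_m := fwd c @` dom c.

Definition transition (R : realType) (T : topologicalType) m
  (c c' : chart R T m) : 'rV[R]_m -> 'rV[R]_m := fun x => fwd c' (bwd c x).

Definition overlap (R : realType) (T : topologicalType) m
  (c c' : chart R T m) : set 'rV[R]_m := fwd c @` (dom c `&` dom c').

Definition compatible (R : realType) (T : topologicalType) m
    (c c' : chart R T m) :=
  smooth_map_on (overlap c c') (transition c c') /\
  smooth_map_on (overlap c' c) (transition c' c).

(* Not assumed connected.  The atlas is maximal: it contains every smooth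
   chart. *)
Record manifold (R : realType) (m : nat) := Manifold {
  carrier :> topologicalType;
  carrier_hausdorff : hausdorff_space carrier;
  carrier_second_countable : @second_countable carrier;
  atlas : set (chart R carrier m);
  atlas_cover : forall p, exists2 c, atlas c & dom c p;
  atlas_compatible : forall c c', atlas c -> atlas c' -> compatible c c';
  atlas_maximal : forall c,
    (forall c', atlas c' -> compatible c c') -> atlas c }.
Arguments atlas {R m} M : rename.

(* Slice charts for an embedded submanifold; q is the codimension. *)
Definition submanifold (R : realType) m (M : manifold R m) (q : nat)
    (N : set M) :=
  forall p, N p -> exists c, [/\ atlas M c, dom c p &
    forall x, dom c x ->
      (N x <-> forall a : 'I_m, (a < q)%N -> fwd c x 0 a = 0)].

Definition smooth_fun (R : realType) m (M : manifold R m) (f : M -> R) :=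
  forall c, atlas M c -> smooth_on (ran c) (f \o bwd c).

(* The matrix of components of a tensor in each chart, as a function of the
   coordinates. *)
Definition tensor2 (R : realType) m (M : manifold R m) :=
  chart R M m -> 'rV[R]_m -> 'M[R]_m.

Record riemannian_metric (R : realType) m (M : manifold R m)
    (g : tensor2 M) : Prop := RiemannianMetric {
  metric_smooth : forall c, atlas M c -> forall a b,
    smooth_on (ran c) (fun x => g c x a b);
  metric_sym : forall c, atlas M c -> forall x, ran c x -> (g c x)^T = g c x;
  metric_pos : forall c, atlas M c -> forall x, ran c x ->
    forall v : 'rV[R]_m, v != 0 -> 0 < (v *m g c x *m v^T) 0 0;
  metric_transform : forall c c', atlas M c -> atlas M c' ->
    forall x, overlap c c' x ->
      g c x = jac (transition c c') x *m g c' (transition c c' x)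
              *m (jac (transition c c') x)^T }.

(* Here h is the matrix of metric components in one chart, as a function of the
   coordinates. *)
Section LocalGeometry.
Variables (R : realType) (m : nat).
Implicit Type h : 'rV[R]_m -> 'M[R]_m.

(* christoffel h k i j is Gamma^k_ij. *)
Definition christoffel h (k i j : 'I_m) (x : 'rV[R]_m) : R :=
  2^-1 * \sum_l invmx (h x) k l *
    (partial i (fun y => h y j l) x + partial j (fun y => h y i l) x
     - partial l (fun y => h y i j) x).

(* R_ij = d_k Gamma^k_ij - d_j Gamma^k_ik
          + Gamma^k_kl Gamma^l_ij - Gamma^k_jl Gamma^l_ik,
   so that round spheres have positive Ricci curvature. *)
Definition ric h (x : 'rV[R]_m) : 'M[R]_m := \matrix_(i, j)
  (\sum_k (partial k (christoffel h k i j) x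
           - partial j (christoffel h k i k) x)
   + \sum_k \sum_l (christoffel h k k l x * christoffel h l i j x
                    - christoffel h k j l x * christoffel h l i k x)).

Definition scal h (x : 'rV[R]_m) : R := \tr (invmx (h x) *m ric h x).

Definition hess h (f : 'rV[R]_m -> R) (x : 'rV[R]_m) : 'M[R]_m :=
  \matrix_(i, j) (partial i (partial j f) x
                  - \sum_k christoffel h k i j x * partial k f x).

End LocalGeometry.

Definition einstein (R : realType) m (M : manifold R m) (g : tensor2 M) :=
  exists lam : R, forall c, atlas M c -> forall x, ran c x ->
    ric (g c) x = lam *: g c x.

Definition gradient_soliton (R : realType) m (M : manifold R m) (eps : R)
    (g : tensor2 M) (u : M -> R) :=
  [/\ riemannian_metric g, smooth_fun u &
      forall c, atlas M c -> forall x, ran c x ->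
        ric (g c) x + hess (g c) (u \o bwd c) x + (eps / 2) *: g c x = 0].

Definition C1_curve (R : realType) m (M : manifold R m) (gam : R -> M) :=
  continuous gam /\
  forall c, atlas M c -> forall s, dom c (gam s) ->
    derivable (fun r => fwd c (gam r)) s 1 /\
    {for s, continuous (derive1 (fun r => fwd c (gam r)))}.

Definition speed (R : realType) m (M : manifold R m) (g : tensor2 M)
    (gam : R -> M) (sp : R -> R) :=
  forall c, atlas M c -> forall s, dom c (gam s) ->
    let w := derive1 (fun r => fwd c (gam r)) s in
    sp s = Num.sqrt ((w *m g c (fwd c (gam s)) *m w^T) 0 0).

(* C^1 curves defined on all of R suffice: a piecewise C^1 curve can be
   reparametrized to have vanishing velocity at its corners and endpoints,
   with the same length.  The distance is +oo between different components. *)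
Definition rdist (R : realType) m (M : manifold R m) (g : tensor2 M)
    (p q : M) : \bar R :=
  ereal_inf [set l | exists (gam : R -> M) (sp : R -> R),
    [/\ C1_curve gam, speed g gam sp, gam 0 = p, gam 1 = q &
        l = (\int[lebesgue_measure]_(s in `[0%R, 1%R]) (sp s)%:E)%E]].

Definition rdist_to (R : realType) m (M : manifold R m) (g : tensor2 M)
    (N : set M) (p : M) : \bar R :=
  ereal_inf [set rdist g q p | q in N].

Definition complete_metric (R : realType) m (M : manifold R m)
    (g : tensor2 M) :=
  forall x : nat -> M,
    (forall e : R, 0 < e -> exists n0 : nat, forall i j,
       (n0 <= i)%N -> (n0 <= j)%N -> (rdist g (x i) (x j) < e%:E)%E) ->
    exists p : M, rdist g (x i) p @[i --> \oo] --> 0%E.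

(* N is the special orbit, Phi identifies (0,oo) x P with its complement,
   g_t is the metric and L_t the shape operator of the hypersurface P_t. *)
Record cohomogeneity_one (R : realType) n (k : nat) (M : manifold R n.+1)
    (P : manifold R n) (gbar : tensor2 M) (u : M -> R)
    (N : set M) (Phi : R -> P -> M)
    (g_ : R -> tensor2 P) (L_ : R -> tensor2 P) (U : R -> R) : Prop :=
  CohomogeneityOne {
  coh1_noncompact : ~ compact [set: M];
  coh1_principal_compact : compact [set: P];
  (* The collapsing spheres are the unit spheres S^k of the normal spaces of
     N; the smoothness of the collapse is that of gbar and u on all of M. *)
  coh1_orbit_compact : compact N;
  coh1_orbit_submanifold : submanifold k.+1 N;
  coh1_Phi_inj : forall s s' x x', 0 < s -> 0 < s' ->
    Phi s x = Phi s' x' -> s = s' /\ x = x';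
  coh1_Phi_image : forall p,
    ~ N p <-> exists s x, 0 < s /\ p = Phi s x;
  coh1_distance : forall s x, 0 < s -> rdist_to gbar N (Phi s x) = s%:E;
  coh1_metric : forall t, 0 < t -> riemannian_metric (g_ t);
  (* Phi carries the product charts of (0,oo) x P to charts of M (that is, it
     is a diffeomorphism onto its image), where gbar = dt^2 + g_t. *)
  coh1_chart : forall d, atlas P d -> exists c, [/\ atlas M c,
    dom c = [set p | exists s x, [/\ 0 < s, dom d x & p = Phi s x]],
    (forall s x, 0 < s -> dom d x ->
       fwd c (Phi s x) = row_mx (s%:M : 'M[R]_1) (fwd d x)) &
    (forall s y, 0 < s -> ran d y ->
       gbar c (row_mx (s%:M : 'M[R]_1) y)
       = block_mx (1%:M : 'M[R]_1) 0 0 (g_ s d y))];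
  (* gdot = 2 g L, where the matrix of L acts on columns of components. *)
  coh1_shape : forall t, 0 < t -> forall d, atlas P d -> forall x, ran d x ->
    (forall i j, derivable (fun s => g_ s d x i j) t 1) /\
    \matrix_(i, j) derive1 (fun s => g_ s d x i j) t
    = 2 *: (g_ t d x *m L_ t d x);
  coh1_potential : forall p, u p = U (fine (rdist_to gbar N p));
  coh1_potential0 : U 0 = 0;
  coh1_scal : forall t, 0 < t -> exists S : R,
    forall d, atlas P d -> forall x, ran d x -> scal (g_ t d) x = S;
  coh1_mean_curvature : forall t, 0 < t -> exists H : R,
    forall d, atlas P d -> forall x, ran d x -> \tr (L_ t d x) = H }.

(* The density of the Riemannian measure of g with respect to that of Q. *)
Definition volume_density (R : realType) n (P : manifold R n)
    (Q g : tensor2 P) (d : chart R P n) (x : 'rV[R]_n) : R :=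
  Num.sqrt (\det (g d x)) / Num.sqrt (\det (Q d x)).

Definition relative_volume (R : realType) n (P : manifold R n)
    (Q : tensor2 P) (g_ : R -> tensor2 P) (v : R -> R) :=
  forall t, 0 < t -> forall d, atlas P d -> forall x, ran d x ->
    volume_density Q (g_ t) d x = v t.

Record phase_point (R : realType) n (P : manifold R n) := PhasePoint {
  ph_metric : tensor2 P;
  ph_shape : tensor2 P;
  ph_potential : R;
  ph_potential_velocity : R }.

Definition trajectory (R : realType) n (P : manifold R n)
    (g_ L_ : R -> tensor2 P) (U : R -> R) (t : R) : phase_point P :=
  PhasePoint (g_ t) (L_ t) (U t) (derive1 U t).

Definition tracefree (R : realType) n (A : 'M[R]_n) : 'M[R]_n :=
  A - (\tr A / n%:R)%:M.

(* The value of F_0 at a phase point and at the point of P with coordinates x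
   in the chart d. *)
Definition F0 (R : realType) n (P : manifold R n) (Q : tensor2 P)
    (z : phase_point P) (d : chart R P n) (x : 'rV[R]_n) : R :=
  let L0 := tracefree (ph_shape z d x) in
  (volume_density Q (ph_metric z) d x) `^ (2 / n%:R)
  * (scal (ph_metric z d) x + \tr (L0 *m L0)).

(* Main.v *)
Require Import Defs.
From mathcomp Require Import perm ring lra.

(** Along the hypersurfaces write H for tr L, tau for tr (L^2), S for the scalar
curvature, Q = S + tau, y for the derivative of the potential u, and
xi = H - y.  The proof is a qualitative analysis of one system of ordinary
differential equations in t.

The system.  For the metric dt^2 + g_t the soliton equation gives a Riccati
equation H' = y' + eps/2 - tau ([mean_evolution]), a trace identity
S = H' + xi H - n eps/2 ([scal_equation]) and a Codazzi equation
([codazzi]).  The time derivative of S is the delicate point.  The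
Codazzi equation and the constancy of H on the hypersurfaces make both
traces of the time derivative of the Christoffel symbols vanish, so in the
variation of the Ricci tensor all second order terms cancel under the trace and
S' = - 2 tr (L r) remains ([trace_slice_ric_rate], [partial_scal]).  This
gives Q' = - 2 xi tau + eps H ([scal_shape_evolution]), which closes the
system together with v' = H v.

Monotonicity.  Up to the factor v^(2/n), the derivative of
F_0 = v^(2/n) (Q - H^2/n) is - 2 (tau - H^2/n) (xi - H/n).  The first factor
is nonnegative by Cauchy-Schwarz, so it suffices that eventually xi >= 0 and
y <= 0 ([xi_eventually_ge0]): then H <= xi and hence H/n <= xi.

Asymptotics.  The quantity C = Q - xi^2 + (n - 1) eps/2 - eps u is constant
([conservation]); put E = C + eps u, so that E' = eps y and y' = E - xi y.
For w = exp (- u) v one has (E y w)' = (eps y^2 + E^2) w >= 0.  Since u and y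
tend to 0 along a sequence of times t -> 0, while w stays bounded there, it
follows that E y >= 0.  If C = 0, Gronwall's inequality forces u = 0, and the
soliton is Einstein.  Otherwise E and y keep the sign of C, and comparison
with an explicit solution makes them grow without bound ([growth]).  For
C > 0 the function 2 y/n - xi satisfies G' >= k G^2 + 1 and would blow up in
finite time.  For C < 0 the same holds for - xi as soon as xi < 0 at one late
time, so xi >= 0 for all late times.

The special orbit.  What remains is that u and y come arbitrarily close to 0
at small times ([potential_start]).  Upper bounds for the distance to the
orbit along coordinate segments suffice to see that t -> 0 there.  The square
norm of the gradient of u is smooth on M and equals y^2 off the orbit.  If it
did not vanish at a point p of the orbit, y would have a constant sign for
small t, so u, which vanishes on the orbit, would have a local extremum at p,
and its gradient would vanish at p after all. *)

Set Implicit Arguments.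
Unset Strict Implicit.
Unset Printing Implicit Defensive.
Local Open Scope classical_set_scope.
Local Open Scope ring_scope.

(** * Derivation rules and comparison lemmas in one variable *)

Section Rules.
Variables (R : realType) (V : normedModType R).
Implicit Types (f g : V -> R) (x v : V).

(** These rules restate those for derivatives with pointwise expressions in
    place of operations on functions, so that they compose by unification. *)
Lemma dD f g x v df dg : is_derive x v f df -> is_derive x v g dg ->
  is_derive x v (fun z => f z + g z) (df + dg).
Proof. by move=> ? ?; apply: is_deriveD. Qed.
Lemma dB f g x v df dg : is_derive x v f df -> is_derive x v g dg ->
  is_derive x v (fun z => f z - g z) (df - dg).
Proof. by move=> ? ?; apply: is_deriveB. Qed.
Lemma dN f x v df : is_derive x v f df -> is_derive x v (fun z => - f z) (- df).
Proof. by move=> ?; apply: is_deriveN. Qed.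
Lemma dM f g x v df dg : is_derive x v f df -> is_derive x v g dg ->
  is_derive x v (fun z => f z * g z) (df * g x + f x * dg).
Proof.
move=> hf hg; have h : is_derive x v (f * g) (f x *: dg + g x *: df) by apply: is_deriveM.
by apply: (is_derive_eq h); rewrite addrC [g x *: _]mulrC.
Qed.

Lemma dC (a : R) x v : is_derive x v (fun=> a) 0.
Proof. exact: is_derive_cst. Qed.
Lemma dZ a f x v df : is_derive x v f df -> is_derive x v (fun z => a * f z) (a * df).
Proof. by move=> hf; have := dM (dC a x v) hf; rewrite mul0r add0r. Qed.
Lemma dV f x v df : f x != 0 -> is_derive x v f df ->
  is_derive x v (fun z => (f z)^-1) (- df / f x ^+ 2).
Proof.
move=> f0 hf; have [f1 f2] := hf.
apply: DeriveDef; first exact: derivableV.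
by rewrite deriveV // f2 scaleNr mulNr mulrC.
Qed.

Lemma dsum (I : Type) (r : seq I) (P : pred I) (F : I -> V -> R) (dF : I -> R) x v :
  (forall i, P i -> is_derive x v (F i) (dF i)) ->
  is_derive x v (fun z => \sum_(i <- r | P i) F i z) (\sum_(i <- r | P i) dF i).
Proof.
move=> h; elim: r => [|i r IH].
  rewrite big_nil (_ : (fun z => _) = fun=> 0); first exact: dC.
  by apply/funext => z; rewrite big_nil.
rewrite big_cons (_ : (fun z => _) = fun z => if P i then F i z + \sum_(j <- r | P j) F j z else \sum_(j <- r | P j) F j z); last first.
  by apply/funext => z; rewrite big_cons.
by case: ifP => // Pi; apply: dD => //; exact: h.
Qed.

End Rules.

Section OneVariable.
Variable R : realType.
Implicit Types (f df : R -> R) (a b s t x : R).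

Lemma derive_continuous f t d : is_derive t 1 f d -> {for t, continuous f}.
Proof. by case=> h _; apply/differentiable_continuous/derivable1_diffP. Qed.

Lemma mean_value f df a b : a < b ->
  (forall x, a <= x <= b -> is_derive x 1 f (df x)) ->
  exists c, a <= c <= b /\ f b - f a = df c * (b - a).
Proof.
move=> ab h; have [c cab ->] : exists2 c, c \in `[a, b] & f b - f a = df c * (b - a).
  apply: MVT_segment => [||]; first exact: ltW.
    by move=> x; rewrite in_itv /= => /andP[? ?]; apply: h; lra.
  apply: derivable_within_continuous => x; rewrite in_itv /= => xab.
  by have [] := h x xab.
by exists c.
Qed.

Lemma derive_nondecreasing f df a b : a <= b ->
  (forall x, a <= x <= b -> is_derive x 1 f (df x)) ->
  (forall x, a <= x <= b -> 0 <= df x) -> f a <= f b.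
Proof.
rewrite le_eqVlt => /orP[/eqP -> //|ab] h h0.
have [c [cab e]] := mean_value ab h; have := h0 c cab; nra.
Qed.

Lemma derive_nonincreasing f df a b : a <= b ->
  (forall x, a <= x <= b -> is_derive x 1 f (df x)) ->
  (forall x, a <= x <= b -> df x <= 0) -> f b <= f a.
Proof.
move=> ab h h0; rewrite -lerN2; apply: (@derive_nondecreasing (fun x => - f x) (fun x => - df x) a b ab) => x hx.
  by apply/dN/h.
by have := h0 x hx; lra.
Qed.

(** First G grows at least linearly, so it becomes at least 1; from then on
    1/G decreases at rate at least k, and would become negative. *)
Lemma riccati_blowup (G dG : R -> R) a k : 0 < k ->
  (forall t, a <= t -> is_derive t 1 G (dG t)) ->
  (forall t, a <= t -> k * G t ^+ 2 + 1 <= dG t) -> False.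
Proof.
move=> k0 hG hd.
have lin t : a <= t -> G a + (t - a) <= G t.
  move=> at_; suff : G a - a <= G t - t by lra.
  apply: (@derive_nondecreasing (fun t => G t - t) (fun t => dG t - 1) a t at_) => x hx.
    by apply: dB; apply: hG; lra.
  have ax : a <= x by lra.
  by have := hd x ax; have := sqr_ge0 (G x); nra.
set b := a + 1 + `|G a|.
have ab : a <= b by rewrite /b; have := normr_ge0 (G a); lra.
have Gge1 t : b <= t -> 1 <= G t.
  move=> bt; have := lin t (le_trans ab bt).
  by have := ler_norm (- G a); rewrite normrN /b in bt *; lra.
have K t : b <= t -> - (G b)^-1 - k * b <= - (G t)^-1 - k * t.
  move=> bt.
  apply: (@derive_nondecreasing (fun t => - (G t)^-1 - k * t) (fun t => - (- dG t / G t ^+ 2) - k * 1) b t bt) => x hx.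
    have Gx : 1 <= G x by apply: Gge1; lra.
    apply: dB.
    by apply: dN; apply: dV; [lra|apply: hG; lra].
  have Gx : 1 <= G x by apply: Gge1; lra.
  have := hd x; have ax : a <= x by lra.
  move=> /(_ ax) hdx.
  rewrite mulNr opprK mulr1 subr_ge0 ler_pdivlMr; last by nra.
  by lra.
have b1 := Gge1 b (lexx b).
have ib : (G b)^-1 <= 1 by rewrite invf_le1 //; lra.
set t := b + k^-1 + 1.
have ki : 0 < k^-1 by rewrite invr_gt0.
have bt : b <= t by rewrite /t; lra.
have := K t bt; have Gt := Gge1 t bt.
have : 0 < (G t)^-1 by rewrite invr_gt0; lra.
have : k * k^-1 = 1 by rewrite divff //; lra.
by rewrite /t; nra.
Qed.

(** The intermediate value theorem: a sign change would need a zero. *)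
Lemma stays_positive f df a b : a <= b ->
  (forall x, a <= x <= b -> is_derive x 1 f (df x)) ->
  (forall x, a <= x <= b -> f x != 0) -> 0 < f a -> 0 < f b.
Proof.
move=> ab hf nz fa; rewrite ltNge; apply/negP => fb.
have [||c cab fc] := @IVT R f a b 0 ab.
- apply: derivable_within_continuous => x; rewrite in_itv /= => xab.
  by have [] := hf x xab.
- by rewrite ge_min le_max fb (ltW fa) orbT.
by move: cab; rewrite in_itv /= => cab; have := nz c cab; rewrite fc eqxx.
Qed.

End OneVariable.

Section Chain.
Variable R : realType.
Implicit Types (f g : R -> R) (t : R).

Lemma dexp f t d : is_derive t 1 f d ->
  is_derive t 1 (fun s => expR (f s)) (d * expR (f t)).
Proof.
move=> hf; have := @is_derive1_comp R expR f t _ d (is_derive_expR (f t)) hf.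
by rewrite mulrC.
Qed.

(** The derivative is written with the logarithmic derivative of f, which is
    the form in which the relative volume enters. *)
Lemma dpowR f a t d : 0 < f t -> is_derive t 1 f d ->
  is_derive t 1 (fun s => f s `^ a) (a * (d / f t) * f t `^ a).
Proof.
move=> f0 hf; have h := @is_derive1_comp R (fun z => powR z a) f t _ d (is_derive1_powR a f0) hf.
apply: (is_derive_eq h).
rewrite powRD ?(gt_eqF f0) ?implybT // powR_inv1; last exact: ltW.
by field; lra.
Qed.

End Chain.

Section OneSided.
Variable R : realType.

Lemma near_positive (s : R) : 0 < s -> \forall r \near s, 0 < r.
Proof.
move=> s0; apply/nbhs_ballP; exists s => //= r.
by rewrite /ball /= ltr_distlC subrr => /andP[].
Qed.

Lemma is_derive_positive (f g : R -> R) (s d : R) : 0 < s -> (forall r, 0 < r -> f r = g r) ->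
  is_derive s 1 g d -> is_derive s 1 f d.
Proof.
move=> s0 fg; apply: near_eq_is_derive.
by apply: filterS (near_positive s0) => r r0; rewrite fg.
Qed.

End OneSided.

Section RateAlgebra.
Variable R : realType.

Lemma solve_mean_rate (Hd S q H y e : R) :
  S = Hd + (H - y) * H - e -> Hd = S + q - q - H * (H - y) + e.
Proof. by move=> ->; ring. Qed.

Lemma solve_potential_rate (p Hd S q H y N e : R) :
  Hd = p + e - q -> S = Hd + (H - y) * H - N * e ->
  p = S + q - H * (H - y) + (N - 1) * e.
Proof. by move=> -> ->; ring. Qed.

Lemma sqrt_rate (r l q : R) : r != 0 -> (2 * r)^-1 * (r ^+ 2 * (2 * l)) * q = l * (r * q).
Proof. by move=> r0; field. Qed.

End RateAlgebra.

(** * The system of ordinary differential equations *)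

(** The variables stand for the potential u, its derivative y, the mean
    curvature H, Q = S + tau, tau = tr (L^2) and the relative volume v. The
    hypothesis start is the trace left by the smooth closing at the special
    orbit, and u_neq0 excludes Einstein metrics. *)
Section SolitonODE.
Variables (R : realType) (n : nat) (eps : R).
Variables (u y H Q tau v : R -> R).
Hypothesis n_gt0 : (0 < n)%N.
Hypothesis eps_gt0 : 0 < eps.
Let xi t := H t - y t.
Hypothesis du : forall t : R, 0 < t -> is_derive t 1 u (y t).
Hypothesis dy0 : forall t : R, 0 < t ->
  is_derive t 1 y (Q t - H t * (H t - y t) + (n%:R - 1) * (eps / 2)).
Hypothesis dH : forall t : R, 0 < t ->
  is_derive t 1 H (Q t - tau t - H t * (H t - y t) + n%:R * (eps / 2)).
Hypothesis dQ : forall t : R, 0 < t ->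
  is_derive t 1 Q (- 2 * (H t - y t) * tau t + eps * H t).
Hypothesis dv : forall t : R, 0 < t -> is_derive t 1 v (H t * v t).
Hypothesis v_gt0 : forall t : R, 0 < t -> 0 < v t.
Hypothesis tau_ge : forall t : R, 0 < t -> H t ^+ 2 <= n%:R * tau t.
Hypothesis start : forall d : R, 0 < d ->
  exists t : R, [/\ 0 < t, t < d, `|u t| < d & `|y t| < d].
Hypothesis u_neq0 : exists2 t : R, 0 < t & u t != 0.

Let nR_gt0 : 0 < n%:R :> R. Proof. by rewrite ltr0n. Qed.

Lemma tau_ge0 (t : R) : 0 < t -> 0 <= tau t.
Proof. have e0_ := eps_gt0; by move=> t0; rewrite -(pmulr_rge0 _ nR_gt0) (le_trans _ (tau_ge t0)) ?sqr_ge0. Qed.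

Lemma dxi (t : R) : 0 < t -> is_derive t 1 xi (eps / 2 - tau t).
Proof.
have e0_ := eps_gt0; have n0_ := nR_gt0.
move=> t0; apply: (is_derive_eq (dB (dH t0) (dy0 t0))).
by ring.
Qed.

Let C := Q 1 - xi 1 ^+ 2 + (n%:R - 1) * (eps / 2) - eps * u 1.
Let E t := C + eps * u t.

(** The cohomogeneity one form of Hamilton's identity, which says that S +
    |grad u|^2 + eps u is constant on a soliton. *)
Lemma conservation (t : R) : 0 < t -> Q t - xi t * xi t + (n%:R - 1) * (eps / 2) = E t.
Proof.
have e0_ := eps_gt0; have n0_ := nR_gt0.
(* The other terms of C are constants. *)
move=> t0; pose K t := Q t - xi t * xi t - eps * u t.
have dK (s : R) : 0 < s -> is_derive s 1 K 0.
  move=> s0; apply: (is_derive_eq (dB (dB (dQ s0) (dM (dxi s0) (dxi s0))) (dZ eps (du s0)))).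
  by rewrite /xi; field.
suff : K t = K 1 by rewrite /E /C /K expr2; lra.
wlog: t t0 / t < 1 => [hw|t1]; last first.
  have [|c [_ ]] := @mean_value R K (fun=> 0) t 1 t1; last by lra.
  by move=> x hx; apply: dK; lra.
case: (ltgtP t 1) => [|t1|->] //; first exact: hw.
have [|c [_ ]] := @mean_value R K (fun=> 0) 1 t t1; last by lra.
by move=> x hx; apply: dK; lra.
Qed.

Lemma dy (t : R) : 0 < t -> is_derive t 1 y (E t - xi t * y t).
Proof.
have e0_ := eps_gt0; have n0_ := nR_gt0.
move=> t0; apply: (is_derive_eq (dy0 t0)).
by rewrite -conservation // /xi; ring.
Qed.

Lemma dE (t : R) : 0 < t -> is_derive t 1 E (eps * y t).
Proof.
have e0_ := eps_gt0; have n0_ := nR_gt0.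
by move=> t0; apply: (is_derive_eq (dD (dC C t 1) (dZ eps (du t0)))); rewrite add0r.
Qed.

(** Since xi' = eps/2 - tau and tau >= 0, xi grows at most linearly, and xi is
    bounded below on every interval (0, t]. *)
Lemma xi_upper (s t : R) : 0 < s -> s <= t -> xi t - eps / 2 * t <= xi s - eps / 2 * s.
Proof.
have e0_ := eps_gt0; have n0_ := nR_gt0.
move=> s0 st; apply: (@derive_nonincreasing R (fun x => xi x - eps / 2 * x)
  (fun x => eps / 2 - tau x - eps / 2 * 1) s t st) => x hx.
  by apply: dB; apply: dxi; lra.
have x0 : 0 < x by lra.
by have := tau_ge0 x0; lra.
Qed.

Let w t := expR (- u t) * v t.

Lemma dw (t : R) : 0 < t -> is_derive t 1 w (xi t * w t).
Proof.
have e0_ := eps_gt0; have n0_ := nR_gt0.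
move=> t0; apply: (is_derive_eq (dM (dexp (dN (du t0))) (dv t0))).
by rewrite /w /xi; ring.
Qed.

Lemma w_gt0 (t : R) : 0 < t -> 0 < w t.
Proof. have e0_ := eps_gt0; by move=> t0; rewrite /w mulr_gt0 ?expR_gt0 ?v_gt0. Qed.

(** As w' = xi w with xi bounded below near 0, w exp (c t) increases on (0,
    t]. *)
Lemma w_bounded (t : R) : 0 < t -> exists B, forall s : R, 0 < s -> s <= t -> w s <= B.
Proof.
have e0_ := eps_gt0; have n0_ := nR_gt0.
move=> t0; pose c : R := `|xi t| + eps / 2 * t.
exists (w t * expR (c * t)) => s s0 st.
have : w s * expR (c * s) <= w t * expR (c * t).
  apply: (@derive_nondecreasing R (fun x => w x * expR (c * x))
    (fun x => xi x * w x * expR (c * x) + w x * (c * 1 * expR (c * x))) s t st) => x hx.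
    by apply: dM; [apply: dw; lra|apply: dexp; apply: dZ].
  have x0 : 0 < x by lra.
  have xt : x <= t by lra.
  have -> : xi x * w x * expR (c * x) + w x * (c * 1 * expR (c * x)) =
    (xi x + c) * (w x * expR (c * x)) by ring.
  apply: mulr_ge0; last by apply: mulr_ge0; [exact/ltW/w_gt0|exact: expR_ge0].
  have := xi_upper x0 xt; have := ler_norm (- xi t); rewrite normrN /c.
  have : 0 <= eps / 2 * x by rewrite mulr_ge0 //; lra.
  by lra.
apply: le_trans; rewrite ler_peMr //; first exact/ltW/w_gt0.
rewrite -expR0 ler_expR mulr_ge0 //; last exact: ltW.
by rewrite /c addr_ge0 // mulr_ge0 //; lra.
Qed.

Let P t := E t * y t * w t.

(** This derivative is nonnegative, so P increases: it is the quantity that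
    carries the boundary condition at the special orbit to all later times. *)
Lemma dP (t : R) : 0 < t -> is_derive t 1 P ((eps * y t ^+ 2 + E t ^+ 2) * w t).
Proof.
have e0_ := eps_gt0; have n0_ := nR_gt0.
move=> t0; apply: (is_derive_eq (dM (dM (dE t0) (dy t0)) (dw t0))).
by ring.
Qed.

(** P is nondecreasing, and it takes values close to 0 at small times because
    y is small there while E and w stay bounded. *)
Lemma P_ge0 (t : R) : 0 < t -> 0 <= P t.
Proof.
have e0_ := eps_gt0; have n0_ := nR_gt0.
move=> t0; rewrite leNgt; apply/negP => Pt.
have [B hB] := w_bounded t0.
have B0 : 0 <= B by apply: le_trans (hB t t0 (lexx t)); exact/ltW/w_gt0.
pose k : R := (`|C| + eps) * B + 1.
have k0 : 1 <= k by rewrite /k lerDr mulr_ge0 // addr_ge0 // ltW.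
(* At the time s < d given below, |P s| <= (|C| + eps) B |y s| < k d <= - P t,
   which contradicts P s <= P t. *)
pose d : R := Num.min 1 (Num.min t (- P t / k)).
have d0 : 0 < d.
  by rewrite /d !lt_min ltr01 t0 divr_gt0 //; lra.
have [s [s0 sd us ys]] := start d0.
have [d1 dt dP'] : [/\ d <= 1, d <= t & d <= - P t / k].
  by rewrite /d !ge_min !lexx ?orbT.
have st : s <= t by lra.
have Ps : P s <= P t.
  apply: (@derive_nondecreasing R P (fun x => (eps * y x ^+ 2 + E x ^+ 2) * w x) s t st) => x hx.
    by apply: dP; lra.
  have x0 : 0 < x by lra.
  apply: mulr_ge0; last exact/ltW/w_gt0.
  by rewrite addr_ge0 ?sqr_ge0 // mulr_ge0 ?sqr_ge0 //; lra.
have hE : `|E s| <= `|C| + eps.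
  rewrite (le_trans (ler_normD _ _)) // lerD2l normrM gtr0_norm //.
  by rewrite ler_piMr //; lra.
have : `|P s| <= (`|C| + eps) * `|y s| * B.
  rewrite /P normrM (gtr0_norm (w_gt0 s0)) normrM.
  apply: ler_pM; [by rewrite mulr_ge0|exact/ltW/w_gt0|by rewrite ler_wpM2r|exact: hB].
have : (`|C| + eps) * `|y s| * B < - P t.
  have : (`|C| + eps) * B * `|y s| <= (k - 1) * d.
    by rewrite /k addrK ler_wpM2l ?mulr_ge0 ?addr_ge0 //; lra.
  have : d * k <= - P t by rewrite -ler_pdivlMr //; lra.
  by rewrite mulrAC; lra.
by have := ler_norm (- P s); rewrite normrN; lra.
Qed.

(** E^2 is nondecreasing because (E^2)' = 2 eps E y >= 0, and it is close to
    C^2 > 0 at small times; hence E never vanishes and P increases strictly.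
    *)
Lemma Ey_gt0 : C != 0 -> forall t : R, 0 < t -> 0 < E t * y t.
Proof.
have e0_ := eps_gt0; have n0_ := nR_gt0.
move=> C0 t t0.
have nz (s : R) : 0 < s -> 0 <= E s * y s.
  move=> s0; have := P_ge0 s0; rewrite /P; have := w_gt0 s0.
  by move=> w0; rewrite pmulr_lge0.
have E2 (s : R) : 0 < s -> 0 < E s ^+ 2.
  move=> s0; rewrite lt_neqAle sqr_ge0 andbT eq_sym; apply/negP => /eqP Es.
  pose d : R := Num.min s (`|C| / (eps + 1)).
  have d0 : 0 < d by rewrite /d lt_min s0 divr_gt0 ?normr_gt0 //; lra.
  have [r [r0 rd ur yr]] := start d0.
  have [ds dC'] : d <= s /\ d <= `|C| / (eps + 1) by rewrite /d !ge_min !lexx ?orbT.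
  have : E r * E r <= E s * E s.
    apply: (@derive_nondecreasing R (fun x => E x * E x) (fun x => eps * y x * E x + E x * (eps * y x))).
    - by lra.
    - by move=> x hx; apply: dM; apply: dE; lra.
    - move=> x hx; have x0 : 0 < x by lra.
      by have := nz x x0; nra.
  rewrite -[E s * _]expr2 Es => Er.
  have {}Er : E r = 0 by apply/eqP; rewrite -sqrf_eq0 expr2 eq_le Er -expr2 sqr_ge0.
  have : `|C| = eps * `|u r|.
    move: Er; rewrite /E => /eqP; rewrite addr_eq0 => /eqP ->.
    by rewrite normrN normrM gtr0_norm.
  move: dC'; rewrite ler_pdivlMr; last by lra.
  by have := normr_ge0 (u r); nra.
have t2 : t / 2 < t by lra.
have [|c [hc]] := @mean_value R P (fun x => (eps * y x ^+ 2 + E x ^+ 2) * w x) _ _ t2.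
  by move=> x hx; apply: dP; lra.
have c0 : 0 < c by lra.
have : 0 < (eps * y c ^+ 2 + E c ^+ 2) * w c.
  apply: mulr_gt0; last exact: w_gt0.
  rewrite ltr_wpDl ?E2 // mulr_ge0 ?sqr_ge0 //; lra.
have : 0 < t / 2 by lra.
move=> t20; have := P_ge0 t20; move=> P0 dc e.
have : 0 < P t by nra.
by rewrite /P pmulr_lgt0 // w_gt0.
Qed.

(** If C = 0 then (E, y) solves a linear system with coefficients bounded on
    one side near 0 and tends to 0 along small times, so Gronwall's inequality
    gives E = 0, that is u = 0. *)
Lemma conserved_neq0 : C != 0.
Proof.
have e0_ := eps_gt0; have n0_ := nR_gt0.
apply/negP => /eqP C0; have [t t0] := u_neq0; apply/negP/negPn.
pose c : R := `|xi t| + eps / 2 * t.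
(* The rate K absorbs the cross term 2 (eps + 1) E y and the term - 2 xi y^2,
   as xi >= - c. *)
pose K : R := eps + 1 + 2 * c.
have c0 : 0 <= c by rewrite /c addr_ge0 // mulr_ge0 //; lra.
have mon (s : R) : 0 < s -> s <= t -> (E t * E t + y t * y t) * expR (- K * t) <=
    (E s * E s + y s * y s) * expR (- K * s).
  move=> s0 st.
  apply: (@derive_nonincreasing R (fun x => (E x * E x + y x * y x) * expR (- K * x))
   (fun x => (eps * y x * E x + E x * (eps * y x) + ((E x - xi x * y x) * y x + y x * (E x - xi x * y x))) * expR (- K * x)
     + (E x * E x + y x * y x) * (- K * 1 * expR (- K * x))) s t st) => x hx.
    have x0 : 0 < x by lra.
    apply: dM; last by apply: dexp; apply: dZ.
    by apply: dD; apply: dM; (exact: dE || exact: dy).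
  have x0 : 0 < x by lra.
  have xt : x <= t by lra.
  have hxi : - c <= xi x.
    have := xi_upper x0 xt; have := ler_norm (- xi t); rewrite normrN /c.
    have : 0 <= eps / 2 * x by rewrite mulr_ge0 //; lra.
    by lra.
  set e := expR _; have e0 : 0 < e by exact: expR_gt0.
  rewrite [X in X <= _](_ : _ = (2 * (eps + 1) * (E x * y x) - 2 * xi x * y x ^+ 2 - K * (E x ^+ 2 + y x ^+ 2)) * e); last by ring.
  rewrite pmulr_lle0 // /K.
  have : 0 <= y x ^+ 2 * (xi x + c) by rewrite mulr_ge0 ?sqr_ge0 //; lra.
  have : 0 <= (eps + 1) * (E x - y x) ^+ 2 by rewrite mulr_ge0 ?sqr_ge0 //; lra.
  have : 0 <= c * E x ^+ 2 by rewrite mulr_ge0 ?sqr_ge0.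
  by nra.
set F := E t * E t + y t * y t in mon.
suff F0 : F <= 0.
  have /eqP : E t ^+ 2 == 0 by rewrite eq_le sqr_ge0 andbT expr2; have := sqr_ge0 (y t); rewrite /F in F0; lra.
  move/eqP; rewrite sqrf_eq0 /E C0 add0r mulf_eq0 => /orP[|//]; lra.
rewrite leNgt; apply/negP => F0.
set G := F * expR (- K * t) in mon.
have G0 : 0 < G by rewrite mulr_gt0 ?expR_gt0.
pose d : R := Num.min 1 (Num.min t (G / (eps ^+ 2 + 2))).
have k0 : 0 < eps ^+ 2 + 2 by have := sqr_ge0 eps; lra.
have d0 : 0 < d by rewrite /d !lt_min ltr01 t0 divr_gt0.
have [d1 dt dG] : [/\ d <= 1, d <= t & d <= G / (eps ^+ 2 + 2)].
  by rewrite /d !ge_min !lexx ?orbT.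
have [s [s0 sd us ys]] := start d0.
have := mon s s0; have st : s <= t by lra.
move=> /(_ st).
have : expR (- K * s) <= 1.
  rewrite -expR0 ler_expR mulNr oppr_le0 mulr_ge0 // /K; lra.
have := expR_gt0 (- K * s); set e := expR _ => e0 e1.
have Es : E s * E s <= eps ^+ 2 * d.
  rewrite /E C0 add0r mulrACA -expr2 ler_wpM2l ?sqr_ge0 //.
  rewrite -expr2 -real_normK ?num_real // expr2.
  by have := normr_ge0 (u s); nra.
have Ys : y s * y s <= d.
  by rewrite -expr2 -real_normK ?num_real // expr2; have := normr_ge0 (y s); nra.
have dG' : d * (eps ^+ 2 + 2) <= G by rewrite -ler_pdivlMr.
have : 0 <= E s * E s + y s * y s by rewrite -!expr2 addr_ge0 ?sqr_ge0.
by nra.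
Qed.

(** Comparison with the explicit solution E0 = (t + b)^2 + 2/eps, y0 = 2 (t +
    b)/eps of the same system with xi replaced by its linear upper bound eps
    (t + b)/2. The Wronskian p E0 - e y0 stays nonnegative, so e / E0 is
    nondecreasing. *)
Lemma growth (e p : R -> R) : (forall t : R, 0 < t -> is_derive t 1 e (eps * p t)) ->
  (forall t : R, 0 < t -> is_derive t 1 p (e t - xi t * p t)) ->
  (forall t : R, 0 < t -> 0 < e t) -> (forall t : R, 0 < t -> 0 < p t) ->
  forall B, exists2 T, 1 <= T & forall t, T <= t -> B <= e t /\ B <= p t.
Proof.
have e0_ := eps_gt0; have n0_ := nR_gt0.
move=> de dp e0 p0 B.
have e1 := e0 1 ltr01; have p1 := p0 1 ltr01.
(* The first summand puts xi below eps (t + b)/2 from time 1 on; the second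
   makes the Wronskian nonnegative at time 1. *)
pose b : R := 2 * `|xi 1| / eps + 2 * e 1 / (eps * p 1).
have b0 : 0 <= b by rewrite /b addr_ge0 // divr_ge0 ?mulr_ge0 // ltW.
have xib (t : R) : 1 <= t -> xi t <= eps / 2 * (t + b).
  move=> t1; have := xi_upper ltr01 t1; have := ler_norm (xi 1).
  have : `|xi 1| <= eps / 2 * b.
    rewrite /b mulrDr (_ : eps / 2 * _ = `|xi 1|); last by field; lra.
    by rewrite lerDl mulr_ge0 ?divr_ge0 ?mulr_ge0 ?ltW.
  by nra.
pose E0 t := (t + b) * (t + b) + 2 / eps.
pose y0 t := 2 / eps * (t + b).
have dsh (t : R) : is_derive t 1 (fun s => s + b) 1.
  by apply: (is_derive_eq (dD (is_derive_id t 1) (dC b t 1))); rewrite addr0.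
have dE0 (t : R) : is_derive t 1 E0 (eps * y0 t).
  apply: (is_derive_eq (dD (dM (dsh t) (dsh t)) (dC (2 / eps) t 1))).
  by rewrite /y0; field; lra.
have dy0' (t : R) : is_derive t 1 y0 (2 / eps).
  by apply: (is_derive_eq (dZ (2 / eps) (dsh t))); rewrite mulr1.
have E0_gt0 (t : R) : 0 < E0 t.
  by rewrite /E0 ltr_wpDl // ?divr_gt0 // -expr2 sqr_ge0.
pose Z t := p t * E0 t - e t * y0 t.
have dZ' (t : R) : 0 < t -> is_derive t 1 Z ((e t - xi t * p t) * E0 t - e t * (2 / eps)).
  move=> t0; apply: (is_derive_eq (dB (dM (dp t t0) (dE0 t)) (dM (de t t0) (dy0' t)))).
  by ring.
have Z1 : 0 <= Z 1.
  rewrite /Z /E0 /y0 subr_ge0.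
  have : 2 * e 1 / (eps * p 1) <= 1 + b.
    by rewrite /b addrA lerDr addr_ge0 // divr_ge0 ?mulr_ge0 // ltW.
  rewrite ler_pdivrMr ?mulr_gt0 // => h.
  have : e 1 * (2 / eps) * (1 + b) <= (1 + b) * p 1 * (1 + b).
    rewrite ler_wpM2r //; first by lra.
    by rewrite mulrA ler_pdivrMr //; lra.
  have : 0 <= p 1 * (2 / eps) by rewrite mulr_ge0 ?divr_ge0 // ltW.
  by lra.
(* An integrating factor: m' = eps (t + b)/2 m. *)
pose m t := expR (eps / 4 * ((t + b) * (t + b))).
have Zge0 (t : R) : 1 <= t -> 0 <= Z t.
  move=> t1; have : Z 1 * m 1 <= Z t * m t.
    apply: (@derive_nondecreasing R (fun x => Z x * m x) (fun x => ((e x - xi x * p x) * E0 x - e x * (2 / eps)) * m x + Z x * (eps / 4 * (1 * (x + b) + (x + b) * 1) * m x)) 1 t t1) => x hx.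
      apply: dM; first by apply: dZ'; lra.
      by apply: dexp; apply: dZ; apply: dM.
    rewrite [X in 0 <= X](_ : _ = ((eps / 2 * (x + b) - xi x) * p x * E0 x) * m x); last first.
      by rewrite /Z /y0 /E0; field; lra.
    have x0 : 0 < x by lra.
    apply: mulr_ge0; last exact: expR_ge0.
    apply: mulr_ge0; last exact: ltW.
    apply: mulr_ge0; last by rewrite ltW ?p0.
    have x1 : 1 <= x by lra.
    by have := xib x x1; lra.
  have : 0 <= Z 1 * m 1 by rewrite mulr_ge0 ?expR_ge0.
  by move=> h1 h2; have := le_trans h1 h2; rewrite pmulr_lge0 // expR_gt0.
pose k : R := e 1 / E0 1.
have k0 : 0 < k by rewrite divr_gt0.
have ek (t : R) : 1 <= t -> k * E0 t <= e t.
  move=> t1; rewrite -ler_pdivlMr //.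
  apply: (@derive_nondecreasing R (fun x => e x * (E0 x)^-1) (fun x => eps * p x * (E0 x)^-1 + e x * (- (eps * y0 x) / E0 x ^+ 2)) 1 t t1) => x hx.
    apply: dM; first by apply: de; lra.
    by apply: dV; rewrite ?gt_eqF.
  have E0x := E0_gt0 x.
  rewrite [X in 0 <= X](_ : _ = eps * Z x / E0 x ^+ 2); last by rewrite /Z; field; lra.
  rewrite divr_ge0 ?sqr_ge0 // mulr_ge0 ?Zge0 //; lra.
have pk (t : R) : 1 <= t -> k * y0 t <= p t.
  move=> t1; have := Zge0 t t1; rewrite /Z => h.
  have : k * E0 t * y0 t <= e t * y0 t.
    rewrite ler_wpM2r ?ek // /y0 mulr_ge0 ?divr_ge0 //; lra.
  have := E0_gt0 t => h0 h1.
  by rewrite -(ler_pM2r h0); lra.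
clearbody k.
have h1 : 0 <= `|B| / k by rewrite divr_ge0 // ltW.
have h2 : 0 <= `|B| * eps / (2 * k).
  by apply: divr_ge0; apply: mulr_ge0 => //; exact: ltW.
exists (1 + `|B| / k + `|B| * eps / (2 * k)).
  by rewrite -addrA lerDl addr_ge0.
move=> t ht.
have t1 : 1 <= t by lra.
have hB := ler_norm B; split; apply: (le_trans hB).
  apply: le_trans (ek t t1); rewrite mulrC -ler_pdivrMr // /E0.
  have : 0 < 2 / eps by rewrite divr_gt0.
  by nra.
apply: le_trans (pk t t1).
rewrite /y0 (_ : k * _ = (t + b) * (2 * k / eps)); last by ring.
rewrite -ler_pdivrMr ?divr_gt0 ?mulr_gt0 //.
by rewrite (_ : `|B| / _ = `|B| * eps / (2 * k)); [lra|field; lra].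
Qed.

Lemma E_sign (sg : R) : sg * sg = 1 -> 0 < sg * C -> forall t : R, 0 < t -> 0 < sg * E t.
Proof.
move=> sg1 sC t t0.
have C0 : C != 0 by apply/eqP => C0; rewrite C0 mulr0 ltxx in sC.
have e0_ := eps_gt0.
pose d : R := Num.min t (sg * C / (eps * (`|sg| + 1))).
have k0 : 0 < eps * (`|sg| + 1) by rewrite mulr_gt0 // ltr_wpDl.
have d0 : 0 < d by rewrite /d lt_min t0 divr_gt0.
have [s [s0 sd us _]] := start d0.
have [dt ds] : d <= t /\ d <= sg * C / (eps * (`|sg| + 1)) by rewrite /d !ge_min !lexx ?orbT.
have st : s <= t by lra.
apply: (@stays_positive R (fun x => sg * E x) (fun x => sg * (eps * y x)) s t st).
- by move=> x hx; apply: dZ; apply: dE; lra.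
- move=> x hx; have x0 : 0 < x by lra.
  have := Ey_gt0 C0 x0; case: (eqVneq (sg * E x) 0) => // h.
  have -> : E x = 0 by rewrite -[E x]mul1r -sg1 -mulrA h mulr0.
  by rewrite mul0r ltxx.
rewrite /E mulrDr mulrCA.
move: ds; rewrite ler_pdivlMr // => ds.
have h1 : - (sg * u s) <= `|sg| * `|u s| by rewrite -normrM -normrN ler_norm.
have h2 : `|sg| * `|u s| <= `|sg| * d by rewrite ler_wpM2l // ltW.
have h3 : eps * - (sg * u s) <= eps * (`|sg| * d) by rewrite ler_pM2l //; lra.
have h4 : 0 < d * eps by rewrite mulr_gt0.
by lra.
Qed.

(** The factor sg = 1 or -1 treats both signs of C at once. *)
Lemma linear_growth (sg : R) : sg * sg = 1 -> 0 < sg * C -> forall B : R, exists2 T : R, 1 <= T &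
  forall t : R, T <= t -> B <= sg * E t /\ B <= sg * y t.
Proof.
move=> sg1 sC.
have C0 : C != 0 by apply/eqP => C0; rewrite C0 mulr0 ltxx in sC.
apply: (@growth (fun t => sg * E t) (fun t => sg * y t)) => t t0.
- by apply: (is_derive_eq (dZ sg (dE t0))); rewrite mulrCA.
- by apply: (is_derive_eq (dZ sg (dy t0))); ring.
- exact: E_sign.
have := Ey_gt0 C0 t0; rewrite -[_ * _]mul1r -sg1 mulrACA.
by rewrite pmulr_rgt0 // E_sign.
Qed.

(** For C > 0 both E and y are large and positive, and then G = 2 y/n - xi
    satisfies G' >= (xi^2 + y^2)/n + (2/n) E - eps/2, which exceeds k G^2 + 1.
    *)
Lemma conserved_lt0 : C < 0.
Proof.
rewrite lt_neqAle conserved_neq0 leNgt; apply/negP => C_gt0.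
have e0_ := eps_gt0; have n0_ := nR_gt0.
have [||T T1 hT] := @linear_growth 1 _ _ (n%:R * (eps / 2 + 1) / 2); rewrite ?mul1r //.
have T0 : 0 < T by lra.
apply: (@riccati_blowup R (fun t => 2 / n%:R * y t - xi t)
  (* The constant 8 n comes from (2 y/n - xi)^2 <= 8 (xi^2 + y^2). *)
  (fun t => 2 / n%:R * (E t - xi t * y t) - (eps / 2 - tau t)) T (8 * n%:R)^-1).
- by rewrite invr_gt0 mulr_gt0.
- by move=> t Tt; apply: dB; [apply: dZ; apply: dy; lra|apply: dxi; lra].
move=> t Tt; have t0 : 0 < t by lra.
have [+ _] := hT t Tt; rewrite mul1r => hE.
have n1 : 1 <= n%:R :> R by rewrite ler1n.
have hEn : eps / 2 + 1 <= 2 / n%:R * E t.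
  rewrite mulrAC ler_pdivlMr //; lra.
have htau : H t ^+ 2 / n%:R <= tau t by rewrite ler_pdivrMr // mulrC tau_ge.
have : (8 * n%:R)^-1 * (2 / n%:R * y t - xi t) ^+ 2 <= (xi t ^+ 2 + y t ^+ 2) / n%:R.
  rewrite mulrC -ler_pdivlMr ?invr_gt0 ?mulr_gt0 // invrK.
  rewrite (_ : _ / n%:R * (8 * n%:R) = 8 * (xi t ^+ 2 + y t ^+ 2)); last by field; lra.
  have i1 : n%:R^-1 <= 1 :> R by rewrite invf_le1.
  have i0 : 0 <= n%:R^-1 :> R by rewrite invr_ge0 ltW.
  have : (2 / n%:R * y t) ^+ 2 <= 4 * y t ^+ 2.
    rewrite exprMn ler_wpM2r ?sqr_ge0 //.
    have -> : 4 = 2 ^+ 2 :> R by ring.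
    rewrite ler_sqr ?nnegrE; nra.
  have := sqr_ge0 (2 / n%:R * y t + xi t); have := sqr_ge0 (y t); have := sqr_ge0 (xi t); lra.
have : (xi t ^+ 2 + y t ^+ 2) / n%:R = H t ^+ 2 / n%:R - 2 / n%:R * (xi t * y t).
  by rewrite /xi; field; lra.
by lra.
Qed.

(** Now y is very negative. If xi < 0 at one such time, then xi exp (2u/n) is
    nonincreasing from there on, so xi stays negative, and - xi satisfies a
    Riccati inequality. *)
Lemma xi_eventually_ge0 : exists2 T : R, 0 < T & forall t : R, T <= t -> 0 <= xi t /\ y t <= 0.
Proof.
have e0_ := eps_gt0; have n0_ := nR_gt0.
have n1 : 1 <= n%:R :> R by rewrite ler1n.
have C0 := conserved_lt0.
have [||T T1 hT] := @linear_growth (-1) _ _ (n%:R * (eps / 2 + 1)); rewrite ?mulrNN ?mulN1r ?mulr1 ?oppr_gt0 //.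
have hY t : T <= t -> n%:R * (eps / 2 + 1) <= - y t.
  by move=> /hT[_]; rewrite mulN1r.
have yneg t : T <= t -> 1 <= - y t.
  by move=> /hY; nra.
exists T; first by lra.
move=> t Tt; split; last by have := yneg t Tt; lra.
rewrite leNgt; apply/negP => xit.
have T0 : 0 < T by lra.
(* This uses n tau >= H^2 with H = xi + y, and y^2/n >= eps/2 + 1, which holds
   because - y is large. *)
have key (s : R) : T <= s -> eps / 2 - tau s <= 2 * y s / n%:R * - xi s - (1 + xi s ^+ 2 / n%:R).
  move=> Ts; have s0 : 0 < s by lra.
  have htau : H s ^+ 2 / n%:R <= tau s by rewrite ler_pdivrMr // mulrC tau_ge.
  have : H s ^+ 2 / n%:R = xi s ^+ 2 / n%:R + 2 * y s / n%:R * xi s + y s ^+ 2 / n%:R.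
    by rewrite /xi; field; lra.
  have : eps / 2 + 1 <= y s ^+ 2 / n%:R.
    rewrite ler_pdivlMr //; have := hY s Ts; have := yneg s Ts => h1 h2.
    have : - y s <= y s ^+ 2 by nra.
    by lra.
  by lra.
have neg (s : R) : t <= s -> xi s < 0.
  move=> ts.
  have : xi s * expR (2 / n%:R * u s) <= xi t * expR (2 / n%:R * u t).
    apply: (@derive_nonincreasing R (fun x => xi x * expR (2 / n%:R * u x))
      (fun x => (eps / 2 - tau x) * expR (2 / n%:R * u x) + xi x * (2 / n%:R * y x * expR (2 / n%:R * u x))) t s ts) => x hx.
      have x0 : 0 < x by lra.
      by apply: dM; [exact: dxi|apply: dexp; apply: dZ; exact: du].
    rewrite [X in X <= _](_ : _ = ((eps / 2 - tau x) + 2 * y x / n%:R * xi x) * expR (2 / n%:R * u x)); last by ring.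
    rewrite mulr_le0_ge0 ?expR_ge0 //.
    have Tx : T <= x by lra.
    have := key x Tx.
    have : 0 <= xi x ^+ 2 / n%:R by rewrite divr_ge0 ?sqr_ge0 // ltW.
    by lra.
  have : xi t * expR (2 / n%:R * u t) < 0 by rewrite nmulr_rlt0 ?expR_gt0.
  move=> h1 h2; have := le_lt_trans h2 h1.
  by rewrite pmulr_llt0 // expR_gt0.
apply: (@riccati_blowup R (fun s => - xi s) (fun s => - (eps / 2 - tau s)) t (n%:R)^-1).
- by rewrite invr_gt0.
- by move=> s ts; apply: dN; apply: dxi; lra.
move=> s ts; have Ts : T <= s by lra.
have := key s Ts; have := neg s ts => xs.
have : 0 <= 2 * y s / n%:R * xi s.
  rewrite mulr_le0 //; last exact: ltW.
  rewrite ler_pdivrMr // mul0r; have := yneg s Ts; lra.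
by rewrite sqrrN; lra.
Qed.

Lemma F0_eventually_nonincreasing : exists2 T : R, 0 < T & forall s t : R, T <= s -> s <= t ->
  v t `^ (2 / n%:R) * (Q t - H t ^+ 2 / n%:R) <= v s `^ (2 / n%:R) * (Q s - H s ^+ 2 / n%:R).
Proof.
have [T T0 hT] := xi_eventually_ge0; exists T => // s t Ts st.
have n0_ := nR_gt0; have n1 : 1 <= n%:R :> R by rewrite ler1n.
pose dH' (x : R) := Q x - tau x - H x * (H x - y x) + n%:R * (eps / 2).
pose dQ' (x : R) := - 2 * (H x - y x) * tau x + eps * H x.
apply: (@derive_nonincreasing R (fun x => v x `^ (2 / n%:R) * (Q x - H x ^+ 2 / n%:R))
  (fun x => (2 / n%:R * (H x * v x / v x) * v x `^ (2 / n%:R)) * (Q x - H x ^+ 2 / n%:R) +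
     v x `^ (2 / n%:R) * (dQ' x - ((dH' x * H x + H x * dH' x) * (n%:R)^-1 + H x ^+ 2 * 0))) s t st) => x hx.
  have x0 : 0 < x by lra.
  apply: dM; first by apply: dpowR; [exact: v_gt0|exact: dv].
  apply: dB; first exact: dQ.
  have dHH : is_derive x 1 (fun z => H z ^+ 2) (dH' x * H x + H x * dH' x).
    rewrite (_ : (fun z => H z ^+ 2) = fun z => H z * H z); last by apply/funext => z; rewrite expr2.
    by apply: dM; exact: dH.
  by apply: dM.
have x0 : 0 < x by lra.
have Tx : T <= x by lra.
have [xi0 y0] := hT x Tx; have vx := v_gt0 x0.
(* The terms with eps cancel, and so do those with Q. *)
rewrite mulfK ?gt_eqF // [X in X <= _](_ : _ =
  - (2 * v x `^ (2 / n%:R) * (tau x - H x ^+ 2 / n%:R) * (xi x - H x / n%:R))); last first.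
  by rewrite /dQ' /dH' /xi; field; lra.
rewrite oppr_le0 mulr_ge0 //; last first.
  rewrite subr_ge0 ler_pdivrMr //; have : H x = xi x + y x by rewrite /xi; ring.
  nra.
rewrite mulr_ge0 ?mulr_ge0 ?powR_ge0 // subr_ge0 ler_pdivrMr // mulrC tau_ge //.
Qed.

End SolitonODE.

(** * Calculus of smooth functions *)

Section SmoothFunctions.
Variables (R : realType) (m : nat).
Local Notation V := 'rV[R]_m.
Implicit Types (A : set V) (f g : V -> R) (x : V) (a b : 'I_m).

Local Notation "''e_' a" := (delta_mx 0 a : V) (at level 8, a at level 2, format "''e_' a").

Lemma partial_local A f g a : open A -> (forall x, A x -> f x = g x) ->
  forall x, A x -> partial a f x = partial a g x.
Proof.
move=> oA fg x Ax; apply: near_eq_derive.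
by near=> y; apply: fg; near: y; exact: open_nbhs_nbhs.
Unshelve. all: by end_near. Qed.

Lemma continuous_local A f g x : open A -> (forall y, A y -> f y = g y) -> A x ->
  {for x, continuous g} -> {for x, continuous f}.
Proof.
move=> oA fg Ax cg; rewrite /prop_for /continuous_at (fg x Ax).
have near_gf : \forall y \near x, g y = f y.
  by apply: filterS (open_nbhs_nbhs (conj oA Ax)) => y Ay; rewrite fg.
exact: cvg_trans (near_eq_cvg near_gf) cg.
Qed.

Lemma derivable_local A f g x a : open A -> (forall y, A y -> f y = g y) -> A x ->
  derivable g x 'e_a -> derivable f x 'e_a.
Proof.
move=> oA fg Ax; apply: near_eq_derivable.
by near=> y; apply/esym/fg; near: y; exact: open_nbhs_nbhs.
Unshelve. all: by end_near. Qed.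

(** A class of functions whose members are continuous and partially
    differentiable, and which is closed under partial derivatives up to
    equality on the open set, consists of smooth functions. Equality on the
    set is enough because all the notions are local. *)
Lemma smooth_coinduction A (K : set (V -> R)) : open A ->
  (forall f, K f -> forall x, A x -> {for x, continuous f} /\ forall a, derivable f x 'e_a) ->
  (forall f a, K f -> exists2 g, K g & forall x, A x -> partial a f x = g x) ->
  forall f, K f -> smooth_on A f.
Proof.
move=> oA hK hd f Kf s x Ax.
have [g Kg fg] : exists2 g, K g & forall y, A y -> partials s f y = g y.
  elim: s => [|a s [g Kg fg]] /=; first by exists f.
  have [g' Kg' gg'] := hd g a Kg; exists g' => // y Ay.
  by rewrite -gg' //; apply: partial_local Ay.
have [cg dg] := hK g Kg x Ax; split.
  exact: (continuous_local oA fg Ax cg).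
by move=> a; exact: (derivable_local oA fg Ax (dg a)).
Qed.

Lemma smooth_continuous A f x : smooth_on A f -> A x -> {for x, continuous f}.
Proof. by move=> /(_ [::] x) h /h[]. Qed.

Lemma smooth_is_derive A f x a : smooth_on A f -> A x -> is_derive x 'e_a f (partial a f x).
Proof. by move=> /(_ [::] x) h /h[_ /(_ a)] /derivableP. Qed.

Lemma smooth_partial A f a : smooth_on A f -> smooth_on A (partial a f).
Proof.
move=> h s x Ax; have := h (rcons s a) x Ax.
by rewrite /partials foldr_rcons.
Qed.

Lemma smooth_local A f g : open A -> (forall x, A x -> f x = g x) ->
  smooth_on A g -> smooth_on A f.
Proof.
move=> oA fg sg.
apply: (@smooth_coinduction A (fun f => exists2 g, smooth_on A g & forall x, A x -> f x = g x)) => //; last by exists g.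
- move=> k [k' sk kk'] x Ax; split.
    exact: (continuous_local oA kk' Ax (smooth_continuous sk Ax)).
  move=> a; apply: (derivable_local oA kk' Ax).
  by case: (smooth_is_derive a sk Ax).
- move=> k a [k' sk kk']; exists (partial a k'); last exact: partial_local.
  by exists (partial a k'); [exact: (smooth_partial a sk)|move=> x _].
Qed.

(** Expressions in smooth functions. The class is closed under partial
    derivatives, which a single sum, product or inverse is not; this makes the
    coinduction apply to all of them at once. *)
Inductive smooth_expr A : (V -> R) -> Prop :=
| SmoothAtom f of smooth_on A f : smooth_expr A f
| SmoothCst (c : R) : smooth_expr A (fun=> c)
| SmoothAdd f g of smooth_expr A f & smooth_expr A g : smooth_expr A (fun x => f x + g x)
| SmoothMul f g of smooth_expr A f & smooth_expr A g : smooth_expr A (fun x => f x * g x)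
| SmoothInv f of smooth_expr A f & (forall x, A x -> f x != 0) : smooth_expr A (fun x => (f x)^-1).

Lemma smooth_expr_derive A f : smooth_expr A f -> forall a, exists2 g, smooth_expr A g &
  forall x, A x -> is_derive x 'e_a f (g x).
Proof.
move=> sf a; elim: sf => {f} [f sf|c|f g sf [f' sf' ff'] sg [g' sg' gg']|f g sf [f' sf' ff'] sg [g' sg' gg']|f sf [f' sf' ff'] f0].
- by exists (partial a f) => [|x Ax]; [exact/SmoothAtom/smooth_partial|exact: smooth_is_derive Ax].
- by exists (fun=> 0) => [|x Ax]; [exact: SmoothCst|exact: dC].
- by exists (fun x => f' x + g' x) => [|x Ax]; [exact: SmoothAdd|apply: dD; [exact: ff'|exact: gg']].
- exists (fun x => f' x * g x + f x * g' x) => [|x Ax]; last by apply: dM; [exact: ff'|exact: gg'].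
  by apply: SmoothAdd; apply: SmoothMul.
- exists (fun x => (-1) * f' x * ((f x)^-1 * (f x)^-1)) => [|x Ax].
    apply: SmoothMul; last by apply: SmoothMul; exact: SmoothInv.
    by apply: SmoothMul => //; exact: SmoothCst.
  apply: (is_derive_eq (dV (f0 x Ax) (ff' x Ax))).
  by rewrite mulN1r expr2 invfM.
Qed.

Lemma smooth_expr_continuous A f : smooth_expr A f -> forall x, A x -> {for x, continuous f}.
Proof.
move=> sf x Ax; elim: sf => {f} [f sf|c|f g _ cf _ cg|f g _ cf _ cg|f _ cf f0].
- exact: smooth_continuous Ax.
- exact: cst_continuous.
- exact: continuousD.
- exact: continuousM.
- by apply: continuousV => //; exact: f0.
Qed.

Lemma smooth_of_expr A f : open A -> smooth_expr A f -> smooth_on A f.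
Proof.
move=> oA; apply: (@smooth_coinduction A (smooth_expr A)) => //.
- move=> g sg x Ax; split; first exact: smooth_expr_continuous Ax.
  by move=> a; have [g' _ /(_ x Ax)[]] := smooth_expr_derive sg a.
- move=> g a sg; have [g' sg' gg'] := smooth_expr_derive sg a.
  by exists g' => // x Ax; have [_] := gg' x Ax.
Qed.

Lemma smooth_cst A c : open A -> smooth_on A (fun=> c).
Proof. by move=> oA; apply: smooth_of_expr => //; exact: SmoothCst. Qed.

Lemma smooth_add A f g : open A -> smooth_on A f -> smooth_on A g ->
  smooth_on A (fun x => f x + g x).
Proof. by move=> oA sf sg; apply: smooth_of_expr => //; apply: SmoothAdd; exact: SmoothAtom. Qed.

Lemma smooth_mul A f g : open A -> smooth_on A f -> smooth_on A g ->
  smooth_on A (fun x => f x * g x).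
Proof. by move=> oA sf sg; apply: smooth_of_expr => //; apply: SmoothMul; exact: SmoothAtom. Qed.

Lemma smooth_inv A f : open A -> smooth_on A f -> (forall x, A x -> f x != 0) ->
  smooth_on A (fun x => (f x)^-1).
Proof. by move=> oA sf f0; apply: smooth_of_expr => //; apply: SmoothInv => //; exact: SmoothAtom. Qed.

Lemma smooth_opp A f : open A -> smooth_on A f -> smooth_on A (fun x => - f x).
Proof.
move=> oA sf; rewrite (_ : (fun x => _) = fun x => (-1) * f x); last by apply/funext => x; rewrite mulN1r.
by apply: smooth_mul => //; exact: smooth_cst.
Qed.

Lemma smooth_sum A (I : Type) (r : seq I) (P : pred I) (F : I -> V -> R) : open A ->
  (forall i, P i -> smooth_on A (F i)) -> smooth_on A (fun x => \sum_(i <- r | P i) F i x).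
Proof.
move=> oA h; elim: r => [|i r IH].
  by under eq_fun do rewrite big_nil; exact: smooth_cst.
under eq_fun do rewrite big_cons.
case Pi: (P i); last exact: IH.
by apply: (smooth_add oA); [exact: (h i Pi)|exact: IH].
Qed.

Lemma smooth_prod A (I : Type) (r : seq I) (P : pred I) (F : I -> V -> R) : open A ->
  (forall i, P i -> smooth_on A (F i)) -> smooth_on A (fun x => \prod_(i <- r | P i) F i x).
Proof.
move=> oA h; elim: r => [|i r IH].
  by under eq_fun do rewrite big_nil; exact: smooth_cst.
under eq_fun do rewrite big_cons.
case Pi: (P i); last exact: IH.
by apply: (smooth_mul oA); [exact: (h i Pi)|exact: IH].
Qed.

Lemma smooth_det A p (M : V -> 'M[R]_p) : open A ->
  (forall i j, smooth_on A (fun x => M x i j)) -> smooth_on A (fun x => \det (M x)).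
Proof.
move=> oA h; apply: (smooth_sum _ oA) => s _.
apply: (smooth_mul oA); first exact: (smooth_cst _ oA).
by apply: (smooth_prod _ oA) => i _; exact: h.
Qed.

(** Cramer's rule. *)
Lemma smooth_invmx A p (M : V -> 'M[R]_p) : open A ->
  (forall i j, smooth_on A (fun x => M x i j)) -> (forall x, A x -> M x \in unitmx) ->
  forall i j, smooth_on A (fun x => invmx (M x) i j).
Proof.
move=> oA h hu i j.
apply: (@smooth_local A _ (fun x => (\det (M x))^-1 * ((-1) ^+ (j + i) * \det (row' j (col' i (M x)))))) => //.
  by move=> x Ax; rewrite /invmx hu // !mxE.
apply: (smooth_mul oA).
  apply: (smooth_inv oA); first exact: smooth_det.
  by move=> x /hu; rewrite unitmxE unitfE.
apply: (smooth_mul oA); first exact: (smooth_cst _ oA).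
apply: (smooth_det oA) => k l.
by under eq_fun do rewrite !mxE; exact: h.
Qed.

Lemma line_derive f x v (s : R) : derivable f (x + s *: v) v ->
  is_derive s 1 (fun r : R => f (x + r *: v)) ('D_v f (x + s *: v)).
Proof.
move=> df.
have E : (fun h : R => h^-1 *: (((fun r : R => f (x + r *: v)) \o shift s) (h *: (1:R)) - f (x + s *: v)))
   = (fun h : R => h^-1 *: ((f \o shift (x + s *: v)) (h *: v) - f (x + s *: v))).
  apply/funext => h /=; congr (_ *: (f _ - _)).
  by rewrite [h *: 1]mulr1 scalerDl addrCA.
by apply: DeriveDef; rewrite ?/derivable ?/derive E.
Qed.

(** Two applications of the mean value theorem to a second difference. *)
Lemma mixed_difference A f x a b (h : R) : smooth_on A f -> 0 < h ->
  (forall s r : R, 0 <= s <= h -> 0 <= r <= h -> A (x + s *: 'e_a + r *: 'e_b)) ->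
  exists s r : R, [/\ 0 <= s <= h, 0 <= r <= h &
    f (x + h *: 'e_a + h *: 'e_b) - f (x + h *: 'e_a) - (f (x + h *: 'e_b) - f x) =
    partial b (partial a f) (x + s *: 'e_a + r *: 'e_b) * h * h].
Proof.
move=> sf h0 hA.
have dl (p : V -> R) (y : V) (c : 'I_m) (s : R) : smooth_on A p -> A (y + s *: 'e_c) ->
    is_derive s 1 (fun r : R => p (y + r *: 'e_c)) (partial c p (y + s *: 'e_c)).
  by move=> sp Ay; apply: line_derive; case: (smooth_is_derive c sp Ay).
have h00 : 0 <= h <= h by rewrite lexx ltW.
have h01 : 0 <= (0 : R) <= h by rewrite lexx ltW.
have [s [hs es]] := @mean_value R (fun s => f (x + h *: 'e_b + s *: 'e_a) - f (x + s *: 'e_a))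
  (fun s => partial a f (x + h *: 'e_b + s *: 'e_a) - partial a f (x + s *: 'e_a)) 0 h h0
  (fun s hs => dB (dl f _ a s sf (eq_ind _ A (hA s h hs h00) _ (addrAC _ _ _)))
                  (dl f _ a s sf (eq_ind _ A (hA s 0 hs h01) _ (etrans (congr1 _ (scale0r _)) (addr0 _))))).
have [r [hr er]] := @mean_value R (fun r => partial a f (x + s *: 'e_a + r *: 'e_b))
  (fun r => partial b (partial a f) (x + s *: 'e_a + r *: 'e_b)) 0 h h0
  (fun r hr => dl _ _ b r (smooth_partial a sf) (hA s r hs hr)).
exists s, r; split => //.
move: es er; rewrite !scale0r !addr0 !subr0 => es er.
by rewrite -er [x + s *: _ + _]addrAC -es [x + h *: 'e_b + _]addrAC.
Qed.

Lemma norm_delta_le1 a : `|'e_a| <= 1 :> R.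
Proof.
change (mx_norm ('e_a : V) <= 1).
have [->|] := eqVneq (mx_norm ('e_a : V)) 0; first exact: ler01.
move=> /mx_norm_neq0[i ->].
by rewrite mxE; case: (_ && _); rewrite ?normr1 ?normr0 ?ler01.
Qed.

Lemma cancel_square (h p q d1 d2 : R) : 0 < h ->
  d1 = p * h * h -> d2 = q * h * h -> d1 = d2 -> p = q.
Proof.
move=> h0 -> ->; have hn : h != 0 by rewrite gt_eqF.
by move=> /(mulIf hn) /(mulIf hn).
Qed.

Lemma close_to_common (p q r e : R) :
  `|p - r| < e / 2 -> `|q - r| < e / 2 -> `|p - q| <= e.
Proof.
move=> h1 h2; rewrite (_ : p - q = (p - r) - (q - r)); last by ring.
by apply: le_trans (ler_normB _ _) _; lra.
Qed.

(** Schwarz's theorem: the second difference over a small square is symmetric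
    in the two directions, and it is h^2 times either mixed derivative at some
    point of the square. *)
Lemma partialC A f x a b : open A -> smooth_on A f -> A x ->
  partial a (partial b f) x = partial b (partial a f) x.
Proof.
move=> oA sf Ax; apply/eqP; rewrite -subr_eq0 -normr_le0; apply/ler_addgt0Pl => /= e e0.
rewrite addr0.
have cab c d : {for x, continuous (partial c (partial d f))}.
  by apply: smooth_continuous Ax; do 2 apply: smooth_partial.
have e2 : 0 < e / 2 by lra.
have near_e (c d : 'I_m) : \forall y \near x, `|partial c (partial d f) x - partial c (partial d f) y| < e / 2.
  by have /cvgrPdist_lt := cab c d; exact.
have [d /= d0 hd] := (nbhs_ballP _ _).1 (filterI (open_nbhs_nbhs (conj oA Ax)) (filterI (near_e a b) (near_e b a))).
(* The square of side h stays inside the ball of radius d. *)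
pose h : R := d / 4.
have h0 : 0 < h by rewrite /h; lra.
have near_x (s r : R) (i j : 'I_m) : 0 <= s <= h -> 0 <= r <= h -> ball x d (x + s *: 'e_i + r *: 'e_j).
  move=> hs hr; rewrite -ball_normE /ball_ /= !opprD !addrA subrr add0r -opprD normrN.
  apply: le_lt_trans (ler_normD _ _) _; rewrite !normrZ.
  have [ni nj] := (norm_delta_le1 i, norm_delta_le1 j).
  rewrite !ger0_norm; [|lra|lra].
  have : s * `|'e_i| <= h * 1 by apply: ler_pM => //; lra.
  have : r * `|'e_j| <= h * 1 by apply: ler_pM => //; lra.
  by rewrite /h in h0 *; lra.
have [s [r [hs hr E1]]] := @mixed_difference A f x a b h sf h0 (fun s r hs hr => (hd _ (near_x s r a b hs hr)).1).
have [s' [r' [hs' hr' E2]]] := @mixed_difference A f x b a h sf h0 (fun s r hs hr => (hd _ (near_x s r b a hs hr)).1).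
have [_ [_ B1]] := hd _ (near_x s r a b hs hr).
have [_ [B2 _]] := hd _ (near_x s' r' b a hs' hr').
have EE : partial b (partial a f) (x + s *: 'e_a + r *: 'e_b) = partial a (partial b f) (x + s' *: 'e_b + r' *: 'e_a).
  by apply: (cancel_square h0 E1 E2); rewrite [x + h *: 'e_b + _]addrAC; ring.
rewrite EE in B1.
exact: close_to_common B2 B1.
Qed.

End SmoothFunctions.

(** * Curvature depends only on the germ of the metric *)

Section Congruence.
Variables (R : realType) (m : nat).
Local Notation V := 'rV[R]_m.

Lemma partial_eq (f : V -> R) x a d : is_derive x (delta_mx 0 a : V) f d -> partial a f x = d.
Proof. by case. Qed.

Lemma partial_cst (c : R) a (x : V) : partial a (fun=> c) x = 0.
Proof. exact: partial_eq (dC c x _). Qed.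

Local Opaque partial invmx smooth_on.

(** Congruence for addition, subtraction and scaling, stated apart so that
    iterated partial derivatives are compared only through the given
    equalities. *)
Lemma cgD (a b c d : R) : a = b -> c = d -> a + c = b + d. Proof. by move=> -> ->. Qed.
Lemma cgB (a b c d : R) : a = b -> c = d -> a - c = b - d. Proof. by move=> -> ->. Qed.
Lemma cgM (a b c : R) : a = b -> c * a = c * b. Proof. by move=> ->. Qed.

Lemma christoffel_local (A : set V) (h h' : V -> 'M[R]_m) k i j : open A ->
  (forall x, A x -> h x = h' x) ->
  forall x, A x -> christoffel h k i j x = christoffel h' k i j x.
Proof.
move=> oA hh' x Ax; rewrite /christoffel hh' //; apply: cgM.
apply: eq_bigr => l _; apply: cgM.
by apply: cgB; [apply: cgD|]; apply: (partial_local _ oA _ Ax) => y Ay; rewrite hh'.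
Qed.

Lemma ric_local (A : set V) (h h' : V -> 'M[R]_m) : open A ->
  (forall x, A x -> h x = h' x) -> forall x, A x -> ric h x = ric h' x.
Proof.
move=> oA hh' x Ax; apply/matrixP => i j; rewrite !mxE.
have E k i' j' := christoffel_local k i' j' oA hh'.
apply: cgD.
  by apply: eq_bigr => k _; apply: cgB; apply: (partial_local _ oA (E _ _ _) Ax).
by apply: eq_bigr => k _; apply: eq_bigr => l _; rewrite !(E _ _ _ x Ax).
Qed.

Lemma hess_local (A : set V) (h h' : V -> 'M[R]_m) (f f' : V -> R) : open A ->
  (forall x, A x -> h x = h' x) -> (forall x, A x -> f x = f' x) ->
  forall x, A x -> hess h f x = hess h' f' x.
Proof.
move=> oA hh' ff' x Ax; apply/matrixP => i j; rewrite !mxE.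
have E k i' j' := christoffel_local k i' j' oA hh'.
have F a := partial_local a oA ff'.
apply: cgB; first exact: (partial_local _ oA (F j) Ax).
by apply: eq_bigr => k _; rewrite (E _ _ _ x Ax) F.
Qed.

End Congruence.

Section SumExchange.
Variables (R : realType) (I : finType).
Implicit Types (a : I -> R) (c p : I -> I -> R) (d t q : I -> I -> I -> R).

(** These four exchanges of finite sums contract an array c, in practice the
    inverse metric, with terms of a curvature expression. *)
Lemma contract_vector a c t : \sum_m a m * (\sum_i \sum_j c i j * t m i j) =
  \sum_i \sum_j c i j * (\sum_m a m * t m i j).
Proof.
under eq_bigr => m _ do rewrite mulr_sumr.
rewrite exchange_big; apply: eq_bigr => i _ /=.
under eq_bigr => m _ do rewrite mulr_sumr.
rewrite exchange_big; apply: eq_bigr => j _ /=; rewrite mulr_sumr.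
by apply: eq_bigr => m _; rewrite mulrCA.
Qed.

Lemma contract_sum c d : \sum_i \sum_j c i j * (\sum_k d k i j) =
  \sum_k \sum_i \sum_j c i j * d k i j.
Proof.
rewrite [RHS]exchange_big; apply: eq_bigr => i _; rewrite [RHS]exchange_big.
by apply: eq_bigr => j _ /=; rewrite mulr_sumr.
Qed.

Lemma contract_trace c p t : \sum_i \sum_j c i j * (\sum_k \sum_l p k l * t l i j) =
  \sum_l (\sum_k p k l) * (\sum_i \sum_j c i j * t l i j).
Proof.
rewrite contract_vector; apply: eq_bigr => i _; apply: eq_bigr => j _; congr (_ * _).
by rewrite exchange_big; apply: eq_bigr => l _ /=; rewrite mulr_suml.
Qed.

Lemma contract_product c q t : \sum_i \sum_j c i j * (\sum_k \sum_l t k i l * q l j k) =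
  \sum_k \sum_i \sum_l \sum_j c i j * (t k i l * q l j k).
Proof.
rewrite contract_sum; apply: eq_bigr => k _; apply: eq_bigr => i _.
rewrite [RHS]exchange_big; apply: eq_bigr => j _ /=; exact: mulr_sumr.
Qed.

End SumExchange.

(** * The geometry of a metric dt^2 + g_t *)

(** The coordinates are (t, x), and g is the matrix of g_t at x as a function
    of both. The geometry of the slices is written with partial derivatives on
    the product, so that these commute with the time derivative by Schwarz's
    theorem. *)
Section ProductMetric.
Variables (R : realType) (n : nat).
Local Notation V := 'rV[R]_(1 + n).
Variables (A : set V) (g : V -> 'M[R]_n) (f : V -> R).
Hypothesis oA : open A.
Hypothesis g_smooth : forall i j, smooth_on A (fun z => g z i j).
Hypothesis g_sym : forall z, A z -> (g z)^T = g z.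
Hypothesis g_unit : forall z, A z -> g z \in unitmx.

Definition time_dir : 'I_(1 + n) := lshift n ord0.
Definition space_dir (i : 'I_n) : 'I_(1 + n) := rshift 1 i.
Local Notation o := time_dir.
Local Notation sp := space_dir.

Definition slice_christoffel (k i j : 'I_n) (z : V) : R :=
  2^-1 * \sum_l invmx (g z) k l *
    (partial (sp i) (fun z => g z j l) z + partial (sp j) (fun z => g z i l) z
     - partial (sp l) (fun z => g z i j) z).
Local Notation Gam := slice_christoffel.

Definition slice_ric (i j : 'I_n) (z : V) : R :=
  \sum_k (partial (sp k) (Gam k i j) z - partial (sp j) (Gam k i k) z)
   + \sum_k \sum_l (Gam k k l z * Gam l i j z - Gam k j l z * Gam l i k z).

Definition time_derivative (i j : 'I_n) (z : V) : R := partial o (fun z => g z i j) z.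
Local Notation K := time_derivative.

(** The shape operator L, solved from g' = 2 g L. *)
Definition slice_shape (i j : 'I_n) (z : V) : R := 2^-1 * \sum_l invmx (g z) i l * K l j z.
Local Notation L := slice_shape.

Definition slice_mean (z : V) : R := \sum_i L i i z.
Local Notation H := slice_mean.

Definition product_metric (z : V) : 'M[R]_(1 + n) := block_mx (1%:M : 'M[R]_1) 0 0 (g z).
Local Notation h := product_metric.

Lemma metric_entry_sym i j z : A z -> g z i j = g z j i.
Proof. by move=> Az; rewrite -[in LHS]g_sym // mxE. Qed.

Lemma inverse_metric_smooth i j : smooth_on A (fun z => invmx (g z) i j).
Proof. exact: smooth_invmx. Qed.

Lemma inverse_metric_sym i j z : A z -> invmx (g z) i j = invmx (g z) j i.
Proof. by move=> Az; rewrite -[in LHS](g_sym Az) -trmx_inv mxE. Qed.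

Lemma metric_mul_inverse i j z : A z -> \sum_l g z i l * invmx (g z) l j = (i == j)%:R.
Proof. by move=> Az; have := mulmxV (g_unit Az) => /matrixP /(_ i j); rewrite !mxE. Qed.

Lemma time_derivative_smooth i j : smooth_on A (K i j).
Proof. exact: (smooth_partial o (g_smooth i j)). Qed.

Lemma time_derivative_sym i j z : A z -> K i j z = K j i z.
Proof. by move=> Az; apply: (partial_local _ oA _ Az) => y Ay; exact: metric_entry_sym. Qed.

Lemma slice_christoffel_smooth k i j : smooth_on A (Gam k i j).
Proof.
apply: (smooth_mul oA); first exact: (smooth_cst _ oA).
apply: smooth_sum => [|l _]; first exact: oA.
apply: (smooth_mul oA); first exact: inverse_metric_smooth.
apply: (smooth_add oA); first by apply: (smooth_add oA); exact: (smooth_partial _ (g_smooth _ _)).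
by apply: (smooth_opp oA); exact: (smooth_partial _ (g_smooth _ _)).
Qed.

Lemma slice_christoffel_sym k i j z : A z -> Gam k i j z = Gam k j i z.
Proof.
move=> Az; apply: cgM; apply: eq_bigr => l _; apply: cgM.
rewrite [X in X - _]addrC; apply: cgB; first by [].
by apply: (partial_local _ oA _ Az) => y Ay; exact: metric_entry_sym.
Qed.

Lemma slice_shape_smooth i j : smooth_on A (L i j).
Proof.
apply: (smooth_mul oA); first exact: (smooth_cst _ oA).
apply: smooth_sum => [|l _]; first exact: oA.
apply: (smooth_mul oA); [exact: inverse_metric_smooth|exact: time_derivative_smooth].
Qed.

Lemma slice_mean_smooth : smooth_on A H.
Proof. by apply: smooth_sum => [|i _]; [exact: oA|exact: slice_shape_smooth]. Qed.

Lemma invmx_product z : A z -> invmx (h z) = block_mx (1%:M : 'M[R]_1) 0 0 (invmx (g z)).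
Proof.
move=> Az; set B := block_mx _ _ _ _.
have hB : h z *m B = 1%:M.
  by rewrite mulmx_block !mulmx0 !mul0mx !mulmx1 mulmxV ?g_unit // !addr0 !add0r -scalar_mx_block.
have hu : h z \in unitmx by case/mulmx1_unit: hB.
by rewrite -[RHS](mulKmx hu) hB mulmx1.
Qed.

Lemma product_oo z : h z o o = 1.
Proof. by rewrite block_mxEul mxE eqxx. Qed.
Lemma product_os z j : h z o (sp j) = 0.
Proof. by rewrite block_mxEur mxE. Qed.
Lemma product_so z i : h z (sp i) o = 0.
Proof. by rewrite block_mxEdl mxE. Qed.
Lemma product_ss z i j : h z (sp i) (sp j) = g z i j.
Proof. by rewrite block_mxEdr. Qed.

Lemma partial_product_oo a z : partial a (fun z => h z o o) z = 0.
Proof. by under eq_fun do rewrite product_oo; exact: partial_cst. Qed.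
Lemma partial_product_os a j z : partial a (fun z => h z o (sp j)) z = 0.
Proof. by under eq_fun do rewrite product_os; exact: partial_cst. Qed.
Lemma partial_product_so a i z : partial a (fun z => h z (sp i) o) z = 0.
Proof. by under eq_fun do rewrite product_so; exact: partial_cst. Qed.
Lemma partial_product_ss a i j z :
  partial a (fun z => h z (sp i) (sp j)) z = partial a (fun z => g z i j) z.
Proof. by under eq_fun do rewrite product_ss. Qed.

Let partial_product := (partial_product_oo, partial_product_os, partial_product_so, partial_product_ss).

Lemma sum_split (F : 'I_(1 + n) -> R) : \sum_i F i = F o + \sum_i F (sp i).
Proof. by rewrite big_split_ord big_ord1. Qed.

Lemma christoffel_o i j z : A z -> christoffel h o i j z =
  2^-1 * (partial i (fun z => h z j o) z + partial j (fun z => h z i o) z - partial o (fun z => h z i j) z).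
Proof.
move=> Az; rewrite /christoffel invmx_product // sum_split block_mxEul mxE eqxx mul1r.
by rewrite big1 ?addr0 // => l _; rewrite block_mxEur mxE mul0r.
Qed.

Lemma christoffel_s k i j z : A z -> christoffel h (sp k) i j z =
  2^-1 * \sum_l invmx (g z) k l * (partial i (fun z => h z j (sp l)) z
    + partial j (fun z => h z i (sp l)) z - partial (sp l) (fun z => h z i j) z).
Proof.
move=> Az; rewrite /christoffel invmx_product // sum_split block_mxEdl mxE mul0r add0r.
by apply: cgM; apply: eq_bigr => l _; rewrite block_mxEdr.
Qed.

Lemma christoffel_ooo z : A z -> christoffel h o o o z = 0.
Proof. by move=> Az; rewrite christoffel_o // !partial_product !addr0 subr0 mulr0. Qed.
Lemma christoffel_oos i z : A z -> christoffel h o o (sp i) z = 0.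
Proof. by move=> Az; rewrite christoffel_o // !partial_product !addr0 subr0 mulr0. Qed.
Lemma christoffel_oso i z : A z -> christoffel h o (sp i) o z = 0.
Proof. by move=> Az; rewrite christoffel_o // !partial_product !addr0 subr0 mulr0. Qed.
Lemma christoffel_oss i j z : A z -> christoffel h o (sp i) (sp j) z = - (2^-1 * K i j z).
Proof. by move=> Az; rewrite christoffel_o // !partial_product !addr0 sub0r mulrN. Qed.
Lemma christoffel_soo k z : A z -> christoffel h (sp k) o o z = 0.
Proof.
move=> Az; rewrite christoffel_s // big1 ?mulr0 // => l _.
by rewrite !partial_product !addr0 subr0 mulr0.
Qed.

Lemma christoffel_sos k i z : A z -> christoffel h (sp k) o (sp i) z = L k i z.
Proof.
move=> Az; rewrite christoffel_s //; apply: cgM; apply: eq_bigr => l _.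
by rewrite !partial_product addr0 subr0 -/(K i l z) time_derivative_sym.
Qed.

Lemma christoffel_sso k i z : A z -> christoffel h (sp k) (sp i) o z = L k i z.
Proof.
move=> Az; rewrite christoffel_s //; apply: cgM; apply: eq_bigr => l _.
by rewrite !partial_product add0r subr0 -/(K i l z) time_derivative_sym.
Qed.

Lemma christoffel_sss k i j z : A z -> christoffel h (sp k) (sp i) (sp j) z = Gam k i j z.
Proof.
move=> Az; rewrite christoffel_s //; apply: cgM; apply: eq_bigr => l _.
by rewrite !partial_product.
Qed.

Definition product_christoffelE := (christoffel_ooo, christoffel_oos, christoffel_oso, christoffel_oss, christoffel_soo, christoffel_sos, christoffel_sso, christoffel_sss).

Lemma partial_zero a (F : V -> R) z : (forall y, A y -> F y = 0) -> A z -> partial a F z = 0.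
Proof. by move=> F0 Az; rewrite (partial_local a oA F0 Az) partial_cst. Qed.

Lemma partial_sum a (I : Type) (r : seq I) (F : I -> V -> R) z : (forall i, smooth_on A (F i)) -> A z ->
  partial a (fun y => \sum_(i <- r) F i y) z = \sum_(i <- r) partial a (F i) z.
Proof.
by move=> sF Az; apply: partial_eq; apply: dsum => i _; exact: (smooth_is_derive a (sF i) Az).
Qed.

(** The Riccati equation of the normal direction, before the soliton equation
    is used. *)
Lemma ric_oo z : A z -> ric h z o o = - partial o H z - \sum_k \sum_l L k l z * L l k z.
Proof.
move=> Az; rewrite mxE sum_split (partial_zero _ christoffel_ooo Az) subrr add0r.
apply: cgD.
  rewrite /H (partial_sum _ _ (fun i => slice_shape_smooth i i) Az).
  rewrite -sumrN; apply: eq_bigr => k _.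
  by rewrite (partial_zero _ (christoffel_soo k) Az) sub0r (partial_local o oA (christoffel_sos k k) Az).
rewrite sum_split [X in X + _]big1 ?add0r; last first.
  by move=> l _; exact: subrr.
rewrite -sumrN; apply: eq_bigr => k _.
rewrite sum_split !product_christoffelE // !mul0r mulr0 subr0 add0r -sumrN; apply: eq_bigr => l _.
by rewrite !product_christoffelE // mulr0 sub0r.
Qed.

(** The contracted Codazzi equation: the divergence of L minus the
    differential of its trace. *)
Lemma ric_os j z : A z -> ric h z o (sp j) =
  \sum_k partial (sp k) (L k j) z - partial (sp j) H z
  + \sum_k \sum_l (Gam k k l z * L l j z - Gam k j l z * L l k z).
Proof.
move=> Az; rewrite mxE sum_split (partial_zero _ (christoffel_oos j) Az) (partial_zero _ christoffel_ooo Az) subrr add0r.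
apply: cgD.
  rewrite sumrB; apply: cgB.
    by apply: eq_bigr => k _; exact: (partial_local _ oA (christoffel_sos k j) Az).
  rewrite (partial_sum _ _ (fun i => slice_shape_smooth i i) Az).
  by apply: eq_bigr => k _; exact: (partial_local _ oA (christoffel_sos k k) Az).
rewrite sum_split [X in X + _]big1 ?add0r; last first.
  move=> l _; case: (split_ordP l) => l' ->.
    by rewrite (ord1 l') !product_christoffelE // !mul0r subr0.
  by rewrite !product_christoffelE // mul0r mulr0 subr0.
apply: eq_bigr => k _; rewrite sum_split !product_christoffelE // !mulr0 subr0 add0r.
by apply: eq_bigr => l _; rewrite !product_christoffelE.
Qed.

Lemma ric_ss_reorder (a b c d e k q : R) :
  - k + (a + b) + (c + (- e + d + q)) = a + b + q - k - e + c + d.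
Proof. by ring. Qed.

(** The contracted Gauss equation combined with the time derivative of the
    second fundamental form. *)
Lemma ric_ss i j z : A z -> ric h z (sp i) (sp j) = slice_ric i j z
  - 2^-1 * partial o (K i j) z - 2^-1 * (H z * K i j z)
  + 2^-1 * \sum_l K j l z * L l i z + 2^-1 * \sum_l L l j z * K i l z.
Proof.
move=> Az; rewrite mxE sum_split.
rewrite (partial_zero _ (christoffel_oso i) Az) subr0.
rewrite (partial_local _ oA (christoffel_oss i j) Az).
rewrite (partial_eq (dN (dZ _ (smooth_is_derive o (time_derivative_smooth i j) Az)))).
under eq_bigr => k _.
  rewrite (partial_local _ oA (christoffel_sss k i j) Az) (partial_local _ oA (christoffel_sss k i k) Az).
  over.
rewrite sum_split.
rewrite sum_split !product_christoffelE // mul0r mulr0 subr0 add0r.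
under [X in _ + (X + _) = _]eq_bigr => l _ do rewrite !product_christoffelE // mul0r mulNr sub0r opprK -mulrA.
under [X in _ + (_ + X) = _]eq_bigr => k _.
  rewrite sum_split !product_christoffelE // mulrN mulrN opprK mulrCA.
  under eq_bigr => l _ do rewrite !product_christoffelE //.
  rewrite [L k j z * _]mulrCA.
  over.
rewrite /= /slice_ric !big_split /= !sumrN -!mulr_sumr [H z * _]mulr_suml.
exact: ric_ss_reorder.
Qed.

Hypothesis f_space : forall i z, A z -> partial (sp i) f z = 0.

Lemma hess_oo z : A z -> hess h f z o o = partial o (partial o f) z.
Proof.
move=> Az; rewrite mxE sum_split product_christoffelE // mul0r add0r big1 ?subr0 // => k _.
by rewrite product_christoffelE // mul0r.
Qed.

Lemma hess_os j z : A z -> hess h f z o (sp j) = 0.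
Proof.
move=> Az; rewrite mxE sum_split (partial_zero _ (f_space j) Az) product_christoffelE // mul0r add0r big1 ?addr0 ?oppr0 // => k _.
by rewrite f_space // mulr0.
Qed.

Lemma hess_ss i j z : A z -> hess h f z (sp i) (sp j) = 2^-1 * (K i j z * partial o f z).
Proof.
move=> Az; rewrite mxE sum_split (partial_zero _ (f_space j) Az) product_christoffelE // big1.
  by rewrite addr0 sub0r mulNr opprK mulrA.
by move=> k _; rewrite f_space // mulr0.
Qed.

Lemma partialM a (F G : V -> R) z : smooth_on A F -> smooth_on A G -> A z ->
  partial a (fun y => F y * G y) z = partial a F z * G z + F z * partial a G z.
Proof.
move=> sF sG Az; apply: partial_eq; apply: dM; [exact: (smooth_is_derive a sF Az)|exact: (smooth_is_derive a sG Az)].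
Qed.

Lemma partialZ a c (F : V -> R) z : smooth_on A F -> A z ->
  partial a (fun y => c * F y) z = c * partial a F z.
Proof. by move=> sF Az; apply: partial_eq; apply: dZ; exact: (smooth_is_derive a sF Az). Qed.

Lemma partialD a (F G : V -> R) z : smooth_on A F -> smooth_on A G -> A z ->
  partial a (fun y => F y + G y) z = partial a F z + partial a G z.
Proof.
move=> sF sG Az; apply: partial_eq; apply: dD; [exact: (smooth_is_derive a sF Az)|exact: (smooth_is_derive a sG Az)].
Qed.

Lemma partialB a (F G : V -> R) z : smooth_on A F -> smooth_on A G -> A z ->
  partial a (fun y => F y - G y) z = partial a F z - partial a G z.
Proof.
move=> sF sG Az; apply: partial_eq; apply: dB; [exact: (smooth_is_derive a sF Az)|exact: (smooth_is_derive a sG Az)].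
Qed.

Lemma partial_sumM a (F G : 'I_n -> V -> R) z : (forall i, smooth_on A (F i)) ->
  (forall i, smooth_on A (G i)) -> A z ->
  partial a (fun y => \sum_i F i y * G i y) z =
  \sum_i (partial a (F i) z * G i z + F i z * partial a (G i) z).
Proof.
move=> sF sG Az; rewrite (partial_sum _ _ (fun i => smooth_mul oA (sF i) (sG i)) Az).
by apply: eq_bigr => i _; exact: (partialM a (sF i) (sG i) Az).
Qed.

Definition partial_metric a z := \matrix_(i, j) partial a (fun y => g y i j) z.
Definition partial_inverse a z := \matrix_(i, j) partial a (fun y => invmx (g y) i j) z.

Lemma partial_inverseE a z : A z ->
  partial_inverse a z = - (invmx (g z) *m partial_metric a z *m invmx (g z)).
Proof.
move=> Az.
have E : partial_metric a z *m invmx (g z) + g z *m partial_inverse a z = 0.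
  apply/matrixP => p q; rewrite !mxE.
  have := partial_local a oA (fun y (Ay : A y) => metric_mul_inverse p q Ay) Az.
  rewrite partial_cst (partial_sumM _ (fun l => g_smooth p l) (fun l => inverse_metric_smooth l q) Az).
  rewrite big_split /= => e0; apply: etrans e0.
  by apply: cgD; apply: eq_bigr => l _; rewrite !mxE.
have := congr1 (mulmx (invmx (g z))) E.
rewrite mulmx0 mulmxDr mulmxA mulKmx ?g_unit // => /eqP.
by rewrite addr_eq0 eq_sym eqr_oppLR => /eqP.
Qed.

Definition connection_matrix (k : 'I_n) z := \matrix_(i, j) Gam i k j z.
Local Notation Gm := connection_matrix.

Lemma christoffel_lower l i j z : A z -> \sum_k g z l k * Gam k i j z =
  2^-1 * (partial (sp i) (fun y => g y j l) z + partial (sp j) (fun y => g y i l) z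
          - partial (sp l) (fun y => g y i j) z).
Proof.
move=> Az; rewrite /Gam.
set X := fun m => partial (sp i) (fun y => g y j m) z + partial (sp j) (fun y => g y i m) z
          - partial (sp m) (fun y => g y i j) z.
transitivity (2^-1 * \sum_m (\sum_k g z l k * invmx (g z) k m) * X m).
  under eq_bigr => k _ do rewrite mulrCA.
  rewrite -mulr_sumr; apply: cgM.
  under eq_bigr => k _ do rewrite mulr_sumr.
  rewrite exchange_big; apply: eq_bigr => m _ /=; rewrite mulr_suml.
  by apply: eq_bigr => k _; rewrite mulrA.
apply: cgM.
rewrite (bigD1 l) //= metric_mul_inverse // eqxx mul1r big1 ?addr0 // => m ml.
by rewrite metric_mul_inverse // eq_sym (negbTE ml) mul0r.
Qed.

(** The connection is metric: lowering an index of Gamma_k and symmetrizing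
    gives the derivative of g in direction k. *)
Lemma connection_compat k z : A z ->
  g z *m Gm k z + (g z *m Gm k z)^T = partial_metric (sp k) z.
Proof.
move=> Az; apply/matrixP => l j; rewrite !mxE.
have E l' j' : \sum_j0 g z l' j0 * Gm k z j0 j' = \sum_m g z l' m * Gam m k j' z.
  by apply: eq_bigr => m _; rewrite mxE.
rewrite !E !christoffel_lower //.
have sy a p q : partial a (fun y => g y p q) z = partial a (fun y => g y q p) z.
  by apply: (partial_local a oA _ Az) => y Ay; exact: metric_entry_sym.
rewrite (sy _ j l) (sy _ k l).
by set a := partial _ _ _; set b := partial _ _ _; set c := partial _ _ _; field.
Qed.

Lemma partial_inverse_connection k z : A z ->
  partial_inverse (sp k) z = - (Gm k z *m invmx (g z) + (Gm k z *m invmx (g z))^T).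
Proof.
move=> Az; rewrite partial_inverseE // -connection_compat // mulmxDr mulmxDl.
rewrite mulKmx ?g_unit // trmx_mul g_sym // -!mulmxA mulmxV ?g_unit // mulmx1.
by rewrite trmx_mul trmx_inv g_sym.
Qed.

Definition partial_time_metric a z := \matrix_(i, j) partial a (K i j) z.
Definition time_metric z := \matrix_(i, j) K i j z.
Definition shape_matrix z := \matrix_(i, j) L i j z.

Lemma shape_matrixE z : shape_matrix z = 2^-1 *: (invmx (g z) *m time_metric z).
Proof.
apply/matrixP => i j; rewrite !mxE; apply: cgM; apply: eq_bigr => l _.
by rewrite mxE.
Qed.

Lemma time_metricE z : time_metric z = partial_metric o z. Proof. by []. Qed.

Lemma time_metric_sym z : A z -> (time_metric z)^T = time_metric z.
Proof. by move=> Az; apply/matrixP => i j; rewrite !mxE time_derivative_sym. Qed.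

Lemma mean_trace z : H z = \tr (shape_matrix z).
Proof. by apply: eq_bigr => i _; rewrite mxE. Qed.

Lemma partial_time_sp k i j z : A z ->
  partial (sp k) (K i j) z = partial o (partial (sp k) (fun y => g y i j)) z.
Proof. by move=> Az; exact: (partialC (sp k) o oA (g_smooth i j) Az). Qed.

(** Differentiating 2 H = tr (g^-1 K), with K the time derivative of g. *)
Lemma partial_mean a z : A z -> 2 * partial a H z =
  \tr (partial_inverse a z *m time_metric z) + \tr (invmx (g z) *m partial_time_metric a z).
Proof.
move=> Az; rewrite /H (partial_sum _ _ (fun i => slice_shape_smooth i i) Az) mulr_sumr.
rewrite -big_split; apply: eq_bigr => i _.
have sGK : smooth_on A (fun y => \sum_l invmx (g y) i l * K l i y).
  apply: smooth_sum => [|l _]; first exact: oA.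
  by apply: (smooth_mul oA); [exact: inverse_metric_smooth|exact: time_derivative_smooth].
rewrite /L (partialZ _ _ sGK Az).
rewrite mulVKf ?pnatr_eq0 //.
rewrite (partial_sumM _ (fun l => inverse_metric_smooth i l) (fun l => time_derivative_smooth l i) Az) big_split !mxE.
by apply: cgD; apply: eq_bigr => l _; rewrite !mxE.
Qed.

Local Opaque partial_metric partial_inverse time_metric shape_matrix partial_time_metric connection_matrix.
Hypothesis H_space : forall i z, A z -> partial (sp i) H z = 0.

(** The time derivative of the Levi-Civita connection of the slices, a tensor.
    *)
Definition christoffel_rate (k i j : 'I_n) (z : V) : R := partial o (Gam k i j) z.
Local Notation T := christoffel_rate.

Lemma christoffel_rate_smooth k i j : smooth_on A (T k i j).
Proof. exact: (smooth_partial o (slice_christoffel_smooth k i j)). Qed.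

Lemma christoffel_rate_sym k i j z : A z -> T k i j z = T k j i z.
Proof. by move=> Az; apply: (partial_local o oA _ Az) => y Ay; exact: slice_christoffel_sym. Qed.

Lemma christoffel_trace l z : A z ->
  \sum_k Gam k l k z = 2^-1 * \sum_k \sum_m invmx (g z) k m * partial (sp l) (fun y => g y m k) z.
Proof.
move=> Az; rewrite /Gam -mulr_sumr; apply: cgM.
set D := fun k m => partial (sp k) (fun y => g y l m) z.
transitivity (\sum_k \sum_m (invmx (g z) k m * partial (sp l) (fun y => g y m k) z
     + (invmx (g z) k m * D k m - invmx (g z) k m * D m k))).
  apply: eq_bigr => k _; apply: eq_bigr => m _; rewrite -mulrBr -mulrDr addrA.
  apply: cgM; apply: cgB; last by [].
  apply: cgD; last by [].
  by apply: (partial_local _ oA _ Az) => y Ay; exact: metric_entry_sym.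
under eq_bigr => k _ do rewrite big_split sumrB.
rewrite big_split sumrB /=.
have -> : \sum_k \sum_m invmx (g z) k m * D m k = \sum_k \sum_m invmx (g z) k m * D k m.
  rewrite exchange_big; apply: eq_bigr => k _; apply: eq_bigr => m _ /=.
  by rewrite inverse_metric_sym.
by rewrite subrr addr0.
Qed.

Lemma mxtrace_swap (X Y Z : 'M[R]_n) : \tr (- (X *m Y *m X) *m Z) = \tr (- (X *m Z *m X) *m Y).
Proof. by rewrite !mulNmx !raddfN /= -(mulmxA (X *m Y) X Z) mxtrace_mulC -!mulmxA. Qed.

(** Gamma^k_lk is the logarithmic derivative of the volume density in
    direction l, so its time derivative is the derivative of H in direction l,
    which vanishes. *)
Lemma christoffel_rate_trace l z : A z -> \sum_k T k l k z = 0.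
Proof.
move=> Az; rewrite /T -(partial_sum _ _ (fun k => slice_christoffel_smooth k l k) Az).
have sF k m : smooth_on A (fun y => partial (sp l) (fun y => g y m k) y).
  exact: (smooth_partial _ (g_smooth m k)).
rewrite (partial_local o oA (christoffel_trace l) Az).
have s1 k : smooth_on A (fun y => \sum_m invmx (g y) k m * partial (sp l) (fun y => g y m k) y).
  by apply: smooth_sum => [|m _]; [exact: oA|apply: (smooth_mul oA); [exact: inverse_metric_smooth|exact: sF]].
have s2 : smooth_on A (fun y => \sum_k \sum_m invmx (g y) k m * partial (sp l) (fun y => g y m k) y).
  by apply: smooth_sum => [|k _]; [exact: oA|exact: s1].
rewrite (partialZ _ _ s2 Az).
suff -> : partial o (fun y => \sum_k \sum_m invmx (g y) k m * partial (sp l) (fun y => g y m k) y) z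
   = 2 * partial (sp l) H z by rewrite (H_space _ Az) !mulr0.
rewrite partial_mean // (partial_sum _ _ s1 Az).
transitivity (\tr (partial_inverse o z *m partial_metric (sp l) z) + \tr (invmx (g z) *m partial_time_metric (sp l) z)).
  rewrite -big_split; apply: eq_bigr => k _.
  rewrite (partial_sumM _ (fun m => inverse_metric_smooth k m) (fun m => sF k m) Az) big_split !mxE /=.
  apply: cgD; apply: eq_bigr => m _; rewrite mxE; first by rewrite mxE.
  by rewrite (partial_time_sp _ _ _ Az).
apply: cgD; last by [].
rewrite (partial_inverseE o Az) (partial_inverseE (sp l) Az) time_metricE.
exact: mxtrace_swap.
Qed.

Lemma mxtrace3 (X Y Z : 'M[R]_n) : \tr (X *m Y *m Z) = \sum_i \sum_j \sum_k X i j * Y j k * Z k i.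
Proof.
apply: eq_bigr => i _; rewrite mxE.
under eq_bigr => k _ do rewrite mxE mulr_suml.
by rewrite exchange_big.
Qed.

Lemma christoffel_rate_lower l i j z : A z ->
  \sum_k (K l k z * Gam k i j z + g z l k * T k i j z) =
  2^-1 * (partial (sp i) (K j l) z + partial (sp j) (K i l) z - partial (sp l) (K i j) z).
Proof.
move=> Az.
have sp' p i' j' : smooth_on A (partial (sp p) (fun y => g y i' j')) by exact: (smooth_partial _ (g_smooth _ _)).
have := partial_local o oA (christoffel_lower l i j) Az.
rewrite (partial_sumM _ (fun k => g_smooth l k) (fun k => slice_christoffel_smooth k i j) Az) => ->.
rewrite (partialZ _ _ (smooth_add oA (smooth_add oA (sp' i j l) (sp' j i l)) (smooth_opp oA (sp' l i j))) Az).
apply: cgM.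
rewrite (partialB _ (smooth_add oA (sp' i j l) (sp' j i l)) (sp' l i j) Az).
rewrite (partialD _ (sp' i j l) (sp' j i l) Az).
by rewrite !(partial_time_sp _ _ _ Az).
Qed.

Lemma mxtrace_sym_part (X S : 'M[R]_n) : S^T = S -> \tr ((X + X^T) *m S) = 2 * \tr (X *m S).
Proof.
move=> sS; rewrite mulmxDl raddfD /= -(mxtrace_tr (X^T *m S)) trmx_mul trmxK sS.
by rewrite (mxtrace_mulC S X); ring.
Qed.

Lemma time_metric_shape z : invmx (g z) *m time_metric z = 2 *: shape_matrix z.
Proof. by rewrite shape_matrixE scalerA divff ?scale1r // pnatr_eq0. Qed.

(** The derivative of 2 H = tr (g^-1 K) along the slice vanishes, which moves
    the derivative from K to g^-1. *)
Lemma trace_partial_time l z : A z ->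
  \sum_i \sum_j invmx (g z) i j * partial (sp l) (K i j) z = 4 * \tr (Gm l z *m shape_matrix z).
Proof.
move=> Az; have := partial_mean (sp l) Az.
rewrite (H_space _ Az) mulr0 (partial_inverse_connection _ Az) mulNmx raddfN /=.
rewrite (mxtrace_sym_part _ (time_metric_sym Az)) -mulmxA time_metric_shape -scalemxAr mxtraceZ.
move=> /esym/eqP; rewrite addrC subr_eq0 => /eqP e.
transitivity (\tr (invmx (g z) *m partial_time_metric (sp l) z)); last by rewrite e; ring.
apply: eq_bigr => i _; rewrite mxE; apply: eq_bigr => j _; rewrite mxE.
apply: cgM; apply: (partial_local (sp l) oA _ Az) => y Ay; exact: time_derivative_sym.
Qed.

Variable eps : R.
Hypothesis soliton : forall z, A z -> ric h z + hess h f z + (eps / 2) *: h z = 0.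

Lemma soliton_entry a b z : A z ->
  ric h z a b + hess h f z a b + eps / 2 * h z a b = 0.
Proof.
move=> Az; have /matrixP /(_ a b) := soliton Az.
move: (ric h z) (hess h f z) (h z) => r s t.
by rewrite !mxE.
Qed.

(** The mixed components of the soliton equation: the divergence of L
    vanishes. The right-hand side is the connection term of the divergence
    with the lower index of L. *)
Lemma codazzi j z : A z ->
  \sum_k partial (sp k) (L k j) z + \sum_k \sum_l Gam k k l z * L l j z
  = \tr (Gm j z *m shape_matrix z).
Proof.
move=> Az; have := soliton_entry o (sp j) Az.
rewrite (ric_os j Az) (hess_os j Az) product_os (H_space j Az) mulr0 !addr0 subr0.
under [X in _ + X]eq_bigr => k _ do rewrite sumrB.
rewrite sumrB addrA => /eqP; rewrite subr_eq0 => /eqP ->.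
apply: eq_bigr => k _; rewrite mxE; apply: eq_bigr => l _.
by rewrite !mxE.
Qed.

(** The Codazzi equation for the lowered tensor K = 2 g L. *)
Lemma divergence_time_metric l z : A z ->
  \sum_i \sum_j invmx (g z) i j * partial (sp i) (K j l) z =
  2 * \tr (Gm l z *m shape_matrix z)
  + \sum_i \sum_j invmx (g z) i j * (\sum_k K l k z * Gam k i j z).
Proof.
move=> Az; rewrite -codazzi //.
have sGK k : smooth_on A (fun y => \sum_j invmx (g y) k j * K j l y).
  apply: smooth_sum => [|j _]; first exact: oA.
  by apply: (smooth_mul oA); [exact: inverse_metric_smooth|exact: time_derivative_smooth].
have E1 : 2 * \sum_k partial (sp k) (L k l) z =
    \sum_k \sum_j (partial (sp k) (fun y => invmx (g y) k j) z * K j l z)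
    + \sum_k \sum_j invmx (g z) k j * partial (sp k) (K j l) z.
  rewrite mulr_sumr -big_split; apply: eq_bigr => k _ /=.
  rewrite /L (partialZ _ _ (sGK k) Az) mulVKf ?pnatr_eq0 // -big_split.
  by rewrite (partial_sumM _ (fun j => inverse_metric_smooth k j) (fun j => time_derivative_smooth j l) Az).
have E2 k j : partial (sp k) (fun y => invmx (g y) k j) z =
    - (\sum_m Gam k k m z * invmx (g z) m j + \sum_m Gam j k m z * invmx (g z) m k).
  have := partial_inverse_connection k Az => /matrixP /(_ k j); rewrite !mxE => ->.
  by apply: (congr1 -%R); apply: cgD; apply: eq_bigr => m _; rewrite mxE.
have E3 : \sum_k \sum_j (\sum_m Gam k k m z * invmx (g z) m j) * K j l z =
    2 * \sum_k \sum_m Gam k k m z * L m l z.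
  rewrite mulr_sumr; apply: eq_bigr => k _.
  under eq_bigr => j _ do rewrite mulr_suml.
  rewrite exchange_big /= mulr_sumr; apply: eq_bigr => m _.
  rewrite /L mulrCA mulVKf ?pnatr_eq0 // mulr_sumr.
  by apply: eq_bigr => j _; rewrite mulrA.
have E4 : \sum_k \sum_j (\sum_m Gam j k m z * invmx (g z) m k) * K j l z =
    \sum_i \sum_j invmx (g z) i j * (\sum_k K l k z * Gam k i j z).
  apply: eq_bigr => i _.
  under eq_bigr => j _ do rewrite mulr_suml.
  rewrite exchange_big /=; apply: eq_bigr => m _; rewrite mulr_sumr.
  by apply: eq_bigr => j _; rewrite (inverse_metric_sym m i Az) (time_derivative_sym j l Az); ring.
have {}E2 : \sum_k \sum_j (partial (sp k) (fun y => invmx (g y) k j) z * K j l z) =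
   - (2 * \sum_k \sum_m Gam k k m z * L m l z + \sum_i \sum_j invmx (g z) i j * (\sum_k K l k z * Gam k i j z)).
  rewrite -E3 -E4 -big_split -sumrN; apply: eq_bigr => k _ /=.
  rewrite -big_split -sumrN; apply: eq_bigr => j _ /=.
  by rewrite E2 mulNr mulrDl.
move: E1; rewrite E2 => /eqP; rewrite addrC -subr_eq opprK => /eqP <-.
by rewrite mulrDr addrA.
Qed.

Lemma rate_cancellation (a a' b c p : R) : a' = a -> a = 2 * p + c -> b = 4 * p ->
  2^-1 * (a + a' - b) - c = 0.
Proof. by move=> -> -> ->; field. Qed.

(** Lowering the index, this trace is the divergence of K minus half the
    differential of its trace, up to connection terms that cancel. Both
    vanish, by the Codazzi equation and because H is constant on slices. *)
Lemma trace_christoffel_rate k z : A z -> \sum_i \sum_j invmx (g z) i j * T k i j z = 0.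
Proof.
move=> Az; pose W := \col_k (\sum_i \sum_j invmx (g z) i j * T k i j z).
suff : W = 0 by move=> /colP /(_ k); rewrite !mxE.
(* The index is lowered first. *)
suff gW : g z *m W = 0 by rewrite -(mulKmx (g_unit Az) W) gW mulmx0.
apply/colP => l; rewrite !mxE.
transitivity (\sum_i \sum_j invmx (g z) i j * (\sum_m g z l m * T m i j z)).
  under eq_bigr => m _ do rewrite mxE.
  exact: contract_vector.
pose a i j := invmx (g z) i j * partial (sp i) (K j l) z.
pose b i j := invmx (g z) i j * partial (sp l) (K i j) z.
pose c i j := invmx (g z) i j * (\sum_k K l k z * Gam k i j z).
transitivity (\sum_i \sum_j (2^-1 * (a i j + a j i - b i j) - c i j)).
  apply: eq_bigr => i _; apply: eq_bigr => j _.
  have := christoffel_rate_lower l i j Az; rewrite big_split /= => e.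
  rewrite /a /b /c (inverse_metric_sym j i Az) -mulrDr -mulrBr mulrCA -mulrBr; apply: cgM.
  by rewrite -e addrC addrK.
have Ea : \sum_i \sum_j a i j = 2 * \tr (Gm l z *m shape_matrix z) + \sum_i \sum_j c i j.
  exact: divergence_time_metric.
have Eb : \sum_i \sum_j b i j = 4 * \tr (Gm l z *m shape_matrix z).
  exact: trace_partial_time.
have Ea' : \sum_i \sum_j a j i = \sum_i \sum_j a i j by exact: exchange_big.
transitivity (2^-1 * (\sum_i \sum_j a i j + \sum_i \sum_j a j i - \sum_i \sum_j b i j) - \sum_i \sum_j c i j).
  rewrite -big_split -sumrB mulr_sumr -sumrB; apply: eq_bigr => i _ /=.
  by rewrite -big_split -sumrB mulr_sumr -sumrB.
exact: (rate_cancellation Ea' Ea Eb).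
Qed.

Definition slice_scal z := \sum_i \sum_j invmx (g z) i j * slice_ric j i z.
Definition slice_ric_matrix z := \matrix_(i, j) slice_ric i j z.

Lemma slice_ric_smooth i j : smooth_on A (slice_ric i j).
Proof.
have sT k i' j' p : smooth_on A (partial p (Gam k i' j')) by exact: (smooth_partial _ (slice_christoffel_smooth _ _ _)).
have sO (F : V -> R) : smooth_on A F -> smooth_on A (fun y => - F y) by move=> sF; exact: (smooth_opp oA sF).
apply: (smooth_add oA).
  apply: smooth_sum => [|k _]; first exact: oA.
  by apply: (smooth_add oA); [exact: sT|apply: sO; exact: sT].
apply: smooth_sum => [|k _]; first exact: oA.
apply: smooth_sum => [|l _]; first exact: oA.
apply: (smooth_add oA); last apply: sO; apply: (smooth_mul oA); exact: slice_christoffel_smooth.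
Qed.

Lemma drop_zero_terms (p q r s t : R) : q = 0 -> r = 0 -> p - q + (r + s - t) = p + s - t.
Proof. by move=> -> ->; rewrite subr0 add0r addrA. Qed.

(** Palatini's formula; the terms that contain the trace of the time
    derivative of the connection have been dropped because they vanish. *)
Lemma slice_ric_rate i j z : A z -> partial o (slice_ric i j) z =
  \sum_k partial (sp k) (T k i j) z + \sum_k \sum_l Gam k k l z * T l i j z
  - (\sum_k \sum_l T k j l z * Gam l i k z + \sum_k \sum_l Gam k j l z * T l i k z).
Proof.
move=> Az.
have sD k i' j' p : smooth_on A (partial p (Gam k i' j')) by exact: (smooth_partial _ (slice_christoffel_smooth _ _ _)).
have sG := slice_christoffel_smooth.
have sP k l i' j' k' l' : smooth_on A (fun y => Gam k i' j' y * Gam l k' l' y) by exact: (smooth_mul oA (sG _ _ _) (sG _ _ _)).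
have sB (F G : V -> R) : smooth_on A F -> smooth_on A G -> smooth_on A (fun y => F y - G y).
  by move=> sF sG'; exact: (smooth_add oA sF (smooth_opp oA sG')).
have sI k : smooth_on A (fun y => \sum_l (Gam k k l y * Gam l i j y - Gam k j l y * Gam l i k y)).
  by apply: smooth_sum => [|l _]; [exact: oA|exact: (sB _ _ (sP _ _ _ _ _ _) (sP _ _ _ _ _ _))].
have s1 : smooth_on A (fun y => \sum_k (partial (sp k) (Gam k i j) y - partial (sp j) (Gam k i k) y)).
  by apply: smooth_sum => [|k _]; [exact: oA|exact: (sB _ _ (sD _ _ _ _) (sD _ _ _ _))].
have s2 : smooth_on A (fun y => \sum_k \sum_l (Gam k k l y * Gam l i j y - Gam k j l y * Gam l i k y)).
  by apply: smooth_sum => [|k _]; [exact: oA|exact: sI].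
rewrite /slice_ric (partialD _ s1 s2 Az).
rewrite (partial_sum _ _ (fun k => sB _ _ (sD k i j (sp k)) (sD k i k (sp j))) Az).
rewrite (partial_sum _ _ sI Az).
have Z : \sum_k partial (sp j) (T k i k) z = 0.
  rewrite -(partial_sum _ _ (fun k => christoffel_rate_smooth k i k) Az).
  exact: (partial_zero _ (christoffel_rate_trace i) Az).
have Z' : \sum_k \sum_l T k k l z * Gam l i j z = 0.
  rewrite exchange_big big1 // => l _ /=; rewrite -mulr_suml.
  under eq_bigr => k _ do rewrite (christoffel_rate_sym _ _ _ Az).
  by rewrite (christoffel_rate_trace _ Az) mul0r.
transitivity ((\sum_k partial (sp k) (T k i j) z - \sum_k partial (sp j) (T k i k) z)
  + (\sum_k \sum_l T k k l z * Gam l i j z + \sum_k \sum_l Gam k k l z * T l i j z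
  - (\sum_k \sum_l T k j l z * Gam l i k z + \sum_k \sum_l Gam k j l z * T l i k z))).
  apply: cgD.
    rewrite -sumrB; apply: eq_bigr => k _.
    rewrite (partialB _ (sD k i j (sp k)) (sD k i k (sp j)) Az).
    exact: cgB (partialC o (sp k) oA (slice_christoffel_smooth k i j) Az) (partialC o (sp j) oA (slice_christoffel_smooth k i k) Az).
  rewrite -!big_split -sumrB; apply: eq_bigr => k _ /=.
  rewrite (partial_sum _ _ (fun l => sB _ _ (sP k l k l i j) (sP k l j l i k)) Az).
  rewrite -!big_split -sumrB; apply: eq_bigr => l _ /=.
  rewrite (partialB _ (sP k l k l i j) (sP k l j l i k) Az).
  by rewrite (partialM _ (sG _ _ _) (sG _ _ _) Az) (partialM _ (sG _ _ _) (sG _ _ _) Az).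
exact: (drop_zero_terms _ _ _ Z Z').
Qed.

Definition rate_matrix k z := \matrix_(i, j) T k i j z.

Lemma rate_matrix_sym k z : A z -> (rate_matrix k z)^T = rate_matrix k z.
Proof. by move=> Az; apply/matrixP => i j; rewrite !mxE christoffel_rate_sym. Qed.

(** By Palatini's formula the trace is the divergence of the other trace of
    the time derivative of the connection, which vanishes identically. In
    coordinates, the connection terms 2 X and X + X cancel. *)
Lemma trace_slice_ric_rate z : A z ->
  \sum_i \sum_j invmx (g z) i j * partial o (slice_ric j i) z = 0.
Proof.
move=> Az.
pose X := \sum_k \tr (Gm k z *m invmx (g z) *m rate_matrix k z).
have E1 : \sum_i \sum_j invmx (g z) i j * (\sum_k partial (sp k) (T k j i) z) = 2 * X.
  rewrite contract_sum /X mulr_sumr; apply: eq_bigr => k _.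
  have s0 i j : smooth_on A (fun y => invmx (g y) i j * T k i j y).
    by apply: (smooth_mul oA); [exact: inverse_metric_smooth|exact: christoffel_rate_smooth].
  have s1 i : smooth_on A (fun y => \sum_j invmx (g y) i j * T k i j y).
    by apply: smooth_sum => [|j _]; [exact: oA|exact: s0].
  have := partial_zero (sp k) (trace_christoffel_rate k) Az.
  rewrite (partial_sum _ _ s1 Az).
  under eq_bigr => i _ do rewrite (partial_sumM _ (fun j => inverse_metric_smooth i j) (fun j => christoffel_rate_smooth k i j) Az) big_split.
  rewrite big_split /= => /eqP; rewrite addrC addr_eq0 => /eqP e.
  transitivity (\sum_i \sum_j invmx (g z) i j * partial (sp k) (T k i j) z).
    apply: eq_bigr => i _; apply: eq_bigr => j _; apply: cgM.
    by apply: (partial_local _ oA _ Az) => y Ay; exact: christoffel_rate_sym.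
  rewrite e -(mxtrace_sym_part _ (rate_matrix_sym k Az)) -[X in \tr (X *m _)]opprK -partial_inverse_connection //.
  rewrite mulNmx raddfN /=; apply: (congr1 -%R).
  apply: eq_bigr => i _; rewrite mxE; apply: eq_bigr => j _; rewrite !mxE.
  by rewrite (christoffel_rate_sym _ _ _ Az).
have E2 : \sum_i \sum_j invmx (g z) i j * (\sum_k \sum_l Gam k k l z * T l j i z) = 0.
  rewrite contract_trace big1 // => l _.
  have -> : \sum_i \sum_j invmx (g z) i j * T l j i z = 0; last exact: mulr0.
  apply: etrans (trace_christoffel_rate l Az); apply: eq_bigr => i _; apply: eq_bigr => j _.
  by apply: cgM; exact: christoffel_rate_sym.
have E3 : \sum_i \sum_j invmx (g z) i j * (\sum_k \sum_l T k i l z * Gam l j k z) = X.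
  rewrite contract_product; apply: eq_bigr => k _; rewrite mxtrace_mulC mulmxA mxtrace3.
  apply: eq_bigr => i _; apply: eq_bigr => l _; apply: eq_bigr => j _ /=.
  by rewrite mulrC !mxE (inverse_metric_sym i j Az) (slice_christoffel_sym l j k Az).
have E4 : \sum_i \sum_j invmx (g z) i j * (\sum_k \sum_l Gam k i l z * T l j k z) = X.
  apply: etrans E3; rewrite exchange_big; apply: eq_bigr => i _; apply: eq_bigr => j _ /=.
  rewrite (inverse_metric_sym j i Az) exchange_big; apply: cgM.
  by apply: eq_bigr => k _; apply: eq_bigr => l _; rewrite mulrC.
transitivity (2 * X + 0 - (X + X)); last by ring.
apply: etrans (cgB (cgD E1 E2) (cgD E3 E4)).
rewrite -!big_split -sumrB; apply: eq_bigr => i _ /=.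
rewrite -!big_split -sumrB; apply: eq_bigr => j _ /=.
by rewrite (slice_ric_rate _ _ Az) -!mulrDr -mulrBr.
Qed.

Definition shape_square z := \sum_k \sum_l L k l z * L l k z.
Local Notation tau := shape_square.

Lemma shape_squareE z : tau z = \tr (shape_matrix z *m shape_matrix z).
Proof. by apply: eq_bigr => k _; rewrite mxE; apply: eq_bigr => l _; rewrite !mxE. Qed.

Lemma solve_mean (a b c e : R) : - a - c + b + e = 0 -> a = b + e - c.
Proof. by move=> h; rewrite -[LHS]addr0 -h; ring. Qed.

(** The time-time component of the soliton equation. *)
Lemma mean_evolution z : A z ->
  partial o H z = partial o (partial o f) z + eps / 2 - tau z.
Proof.
move=> Az; have := soliton_entry o o Az.
rewrite (ric_oo Az) (hess_oo Az) product_oo mulr1 -/(tau z).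
exact: solve_mean.
Qed.

Lemma partial_mean_shape z :
  A z -> partial o H z = \tr (\matrix_(i, j) partial o (L i j) z).
Proof.
move=> Az; rewrite /H (partial_sum _ _ (fun i => slice_shape_smooth i i) Az).
by apply: eq_bigr => i _; rewrite mxE.
Qed.

Definition shape_rate z := \matrix_(i, j) partial o (L i j) z.

Lemma shape_rateE z : A z -> shape_rate z =
  2^-1 *: (invmx (g z) *m partial_time_metric o z) - 2 *: (shape_matrix z *m shape_matrix z).
Proof.
move=> Az.
have -> : shape_rate z = 2^-1 *: (partial_inverse o z *m time_metric z + invmx (g z) *m partial_time_metric o z).
  apply/matrixP => i j; rewrite !mxE.
  have sGK : smooth_on A (fun y => \sum_l invmx (g y) i l * K l j y).
    apply: smooth_sum => [|l _]; first exact: oA.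
    by apply: (smooth_mul oA); [exact: inverse_metric_smooth|exact: time_derivative_smooth].
  rewrite /L (partialZ _ _ sGK Az); apply: cgM.
  rewrite (partial_sumM _ (fun l => inverse_metric_smooth i l) (fun l => time_derivative_smooth l j) Az) big_split.
  by apply: cgD; apply: eq_bigr => l _; rewrite !mxE.
rewrite (partial_inverseE o Az) -time_metricE time_metric_shape mulNmx -!scalemxAl -mulmxA time_metric_shape.
rewrite -!scalemxAr scalerDr addrC; congr (_ + _).
by rewrite scalerN !scalerA; congr (- (_ *: _)); field.
Qed.

Lemma shape_evolution_entry (r k H0 y K0 kl e G : R) :
  r - 2^-1 * k - 2^-1 * (H0 - y) * K0 + kl + e * G =
  r - 2^-1 * k - 2^-1 * (H0 * K0) + 2^-1 * kl + 2^-1 * kl + 2^-1 * (K0 * y) + e * G.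
Proof. by field. Qed.

Lemma solve_shape_rate (r k s l : 'M[R]_n) (c e : R) :
  r - k - (2^-1 * c * 2) *: l + 2 *: s + e%:M = 0 -> r = k - 2 *: s + c *: l - e%:M.
Proof.
move=> h; apply/eqP; rewrite -subr_eq0 -h; apply/eqP/matrixP => i j; rewrite !mxE.
by case: (i == j) => /=; field.
Qed.

(** The spatial components of the soliton equation with one index raised. *)
Lemma shape_evolution z : A z -> invmx (g z) *m slice_ric_matrix z =
  shape_rate z + (H z - partial o f z) *: shape_matrix z - (eps / 2)%:M.
Proof.
move=> Az; set y := partial o f z.
have KL : (time_metric z *m shape_matrix z)^T = time_metric z *m shape_matrix z.
  rewrite shape_matrixE -scalemxAr linearZ /=; congr (_ *: _).
  by rewrite !trmx_mul trmx_inv (g_sym Az) (time_metric_sym Az) mulmxA.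
have E : slice_ric_matrix z - 2^-1 *: partial_time_metric o z - (2^-1 * (H z - y)) *: time_metric z
   + time_metric z *m shape_matrix z + (eps / 2) *: g z = 0.
  apply/matrixP => i j; have := soliton_entry (sp i) (sp j) Az.
  rewrite (ric_ss i j Az) (hess_ss i j Az) product_ss -/y !mxE.
  have e1 : \sum_l K j l z * L l i z = (time_metric z *m shape_matrix z) i j.
    by rewrite -[in RHS]KL !mxE; apply: eq_bigr => l _; rewrite !mxE.
  have e2 : \sum_l L l j z * K i l z = (time_metric z *m shape_matrix z) i j.
    by rewrite !mxE; apply: eq_bigr => l _; rewrite !mxE mulrC.
  rewrite e1 e2.
  have e3 : \sum_j0 time_metric z i j0 * shape_matrix z j0 j = (time_metric z *m shape_matrix z) i j.
    by rewrite mxE.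
  rewrite e3 => <-; exact: shape_evolution_entry.
have := congr1 (mulmx (invmx (g z))) E.
rewrite mulmx0 !mulmxDr !mulmxN -!scalemxAr time_metric_shape mulmxA time_metric_shape mulVmx ?g_unit //.
rewrite -scalemxAl scalerA (shape_rateE Az) scalemx1.
exact: solve_shape_rate.
Qed.

Lemma slice_scalE z : slice_scal z = \tr (invmx (g z) *m slice_ric_matrix z).
Proof.
by apply: eq_bigr => i _; rewrite mxE; apply: eq_bigr => j _; rewrite mxE.
Qed.

Lemma scal_equation z : A z ->
  slice_scal z = partial o H z + (H z - partial o f z) * H z - n%:R * (eps / 2).
Proof.
move=> Az; rewrite slice_scalE (shape_evolution Az) !raddfD raddfN /= mxtraceZ mxtrace_scalar.
by rewrite (partial_mean_shape Az) -/(shape_rate z) -mean_trace mulr_natl.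
Qed.

Lemma slice_scal_smooth : smooth_on A slice_scal.
Proof.
apply: smooth_sum => [|i _]; first exact: oA.
apply: smooth_sum => [|j _]; first exact: oA.
by apply: (smooth_mul oA); [exact: inverse_metric_smooth|exact: slice_ric_smooth].
Qed.

Lemma shape_square_smooth : smooth_on A tau.
Proof.
apply: smooth_sum => [|i _]; first exact: oA.
apply: smooth_sum => [|j _]; first exact: oA.
by apply: (smooth_mul oA); exact: slice_shape_smooth.
Qed.

(** The trace of the time derivative of the Ricci tensor vanishes, so only the
    derivative of the inverse metric contributes. *)
Lemma partial_scal z : A z ->
  partial o slice_scal z = - 2 * \tr (shape_matrix z *m (invmx (g z) *m slice_ric_matrix z)).
Proof.
move=> Az.
have s0 i j : smooth_on A (fun y => invmx (g y) i j * slice_ric j i y).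
  by apply: (smooth_mul oA); [exact: inverse_metric_smooth|exact: slice_ric_smooth].
have s1 i : smooth_on A (fun y => \sum_j invmx (g y) i j * slice_ric j i y).
  by apply: smooth_sum => [|j _]; [exact: oA|exact: s0].
rewrite /slice_scal (partial_sum _ _ s1 Az).
transitivity (\tr (partial_inverse o z *m slice_ric_matrix z)
   + \sum_i \sum_j invmx (g z) i j * partial o (slice_ric j i) z).
  rewrite -big_split; apply: eq_bigr => i _ /=.
  rewrite (partial_sumM _ (fun j => inverse_metric_smooth i j) (fun j => slice_ric_smooth j i) Az) big_split mxE.
  by apply: cgD; apply: eq_bigr => j _; rewrite ?mxE.
rewrite (trace_slice_ric_rate Az) addr0 (partial_inverseE o Az) -time_metricE time_metric_shape.
by rewrite !mulNmx raddfN /= -!scalemxAl mxtraceZ mulNr mulmxA.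
Qed.

Lemma partial_shape_square z : A z ->
  partial o tau z = 2 * \tr (shape_matrix z *m shape_rate z).
Proof.
move=> Az.
have s1 i : smooth_on A (fun y => \sum_j L i j y * L j i y).
  by apply: smooth_sum => [|j _]; [exact: oA|apply: (smooth_mul oA); exact: slice_shape_smooth].
rewrite /tau (partial_sum _ _ s1 Az).
transitivity (\tr (shape_rate z *m shape_matrix z) + \tr (shape_matrix z *m shape_rate z)).
  rewrite -big_split; apply: eq_bigr => i _ /=.
  rewrite (partial_sumM _ (fun j => slice_shape_smooth i j) (fun j => slice_shape_smooth j i) Az) big_split !mxE.
  by apply: cgD; apply: eq_bigr => j _; rewrite !mxE.
by rewrite mxtrace_mulC; ring.
Qed.

Lemma mxtrace_linear (X Y Z : 'M[R]_n) (c e : R) :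
  \tr (X + c *: Y - e *: Z) = \tr X + c * \tr Y - e * \tr Z.
Proof. by rewrite raddfB raddfD /= !mxtraceZ. Qed.

Lemma scal_shape_cancellation (a b t H0 e : R) :
  - 2 * (a + b * t - e / 2 * H0) + 2 * a = - 2 * b * t + e * H0.
Proof. by field. Qed.

(** Substituting the evolution of L into S' = - 2 tr (L r) and tau' = 2 tr (L
    L') cancels tr (L L'). *)
Lemma scal_shape_evolution z : A z ->
  partial o (fun y => slice_scal y + tau y) z =
  - 2 * (H z - partial o f z) * tau z + eps * H z.
Proof.
move=> Az; rewrite (partialD _ slice_scal_smooth shape_square_smooth Az).
rewrite (partial_scal Az) (partial_shape_square Az) (shape_evolution Az).
rewrite !mulmxDr mulmxN mul_mx_scalar -scalemxAr mxtrace_linear -shape_squareE -mean_trace.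
exact: scal_shape_cancellation.
Qed.

End ProductMetric.

(** * Positive definite forms and self-adjoint endomorphisms *)

Section LinearAlgebra.
Variable R : realType.

Definition posdef n (G : 'M[R]_n) := forall v : 'rV[R]_n, v != 0 -> 0 < (v *m G *m v^T) 0 0.

(** Induction on the dimension by Schur complements, as in the Cholesky
    decomposition. *)
Lemma posdef_factor n (G : 'M[R]_n) : G^T = G -> posdef G ->
  exists2 X : 'M[R]_n, X \in unitmx & G = X *m X^T.
Proof.
elim: n G => [|n IH] G; first by exists 1%:M; [exact: unitmx1|rewrite [LHS]flatmx0 [RHS]flatmx0].
rewrite -[n.+1]/(1 + n)%N in G *; move=> sG pG.
pose a := G (lshift n 0) (lshift n 0); pose b : 'rV[R]_n := ursubmx G; pose D : 'M[R]_n := drsubmx G.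
have EG : G = block_mx a%:M b b^T D.
  rewrite -[LHS]submxK; congr block_mx.
    by apply/matrixP => i j; rewrite !mxE (ord1 i) (ord1 j) eqxx.
  by rewrite /b trmx_ursub sG.
have sD : D^T = D by rewrite /D trmx_drsub sG.
have a0 : 0 < a.
  have := pG (row_mx 1%:M 0); rewrite EG mul_row_block mul1mx mul0mx addr0 mul1mx mul0mx addr0.
  rewrite tr_row_mx mul_row_col trmx0 mulmx0 addr0 trmx1 mulmx1 !mxE eqxx; apply.
  apply/eqP => /matrixP /(_ 0 (lshift n 0)); rewrite row_mxEl !mxE eqxx => /eqP.
  by rewrite oner_eq0.
pose r := Num.sqrt a.
have r0 : 0 < r by rewrite sqrtr_gt0.
have rr : r * r = a by rewrite -expr2 sqr_sqrtr // ltW.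
have sS : (D - a^-1 *: (b^T *m b))^T = D - a^-1 *: (b^T *m b).
  by rewrite linearB linearZ /= trmx_mul trmxK sD.
have pS : posdef (D - a^-1 *: (b^T *m b)).
  move=> v v0; pose w : 'rV[R]_(1 + n) := row_mx (- a^-1 *: (v *m b^T)) v.
  have w0 : w != 0.
    apply: contraNneq v0 => /(congr1 rsubmx); rewrite row_mxKr => ->.
    by rewrite linear0.
  have := pG w w0; rewrite EG /w mul_row_block tr_row_mx mul_row_col.
  set x := v *m b^T.
  have xt : b *m v^T = x^T by rewrite /x trmx_mul trmxK.
  (* The vector w is v completed so that it is orthogonal, for G, to the first
     basis vector. *)
  have -> : (- a^-1 *: x *m a%:M + v *m b^T) = 0.
    by rewrite mul_mx_scalar scalerA mulrN mulfV ?gt_eqF // scaleN1r addNr.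
  rewrite mul0mx add0r mulmxDl -scalemxAl -scalemxAl -mulmxA xt.
  by rewrite mulmxBr -scalemxAr mulmxBl -scalemxAl mulmxA -/x -(mulmxA x) xt scaleNr addrC.
have [X uX EX] := IH _ sS pS.
exists (block_mx r%:M 0 (r^-1 *: b^T) X).
  by rewrite unitmxE det_lblock det_scalar1 unitrM unitfE gt_eqF //= -unitmxE.
rewrite tr_block_mx mulmx_block !trmx0 !mulmx0 !mul0mx !addr0 linearZ /= trmxK tr_scalar_mx.
rewrite {1}EG; congr block_mx.
- by rewrite -scalar_mxM rr.
- by rewrite mul_scalar_mx scalerA mulfV ?scale1r // gt_eqF.
- by rewrite mul_mx_scalar scalerA mulfV ?scale1r // gt_eqF.
by rewrite -EX -scalemxAl -scalemxAr scalerA -invfM rr addrC subrK.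
Qed.

Lemma posdef_det n (G : 'M[R]_n) : G^T = G -> posdef G -> 0 < \det G.
Proof.
move=> sG pG; have [X uX ->] := posdef_factor sG pG.
rewrite det_mulmx det_tr -expr2 lt_neqAle sqr_ge0 andbT eq_sym sqrf_eq0.
by rewrite -unitfE -unitmxE.
Qed.

Lemma posdef_unit n (G : 'M[R]_n) : G^T = G -> posdef G -> G \in unitmx.
Proof. by move=> sG pG; rewrite unitmxE unitfE gt_eqF // posdef_det. Qed.

(** With G = X X^T, conjugation by X^T makes L symmetric, and the trace of the
    square of a symmetric matrix is a sum of squares. *)
Lemma selfadjoint_square n (G L : 'M[R]_n) : G^T = G -> posdef G ->
  (G *m L)^T = G *m L -> 0 <= \tr (L *m L).
Proof.
move=> sG pG sL; have [X uX EX] := posdef_factor sG pG.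
(* The matrix of L in an orthonormal frame. *)
pose S := X^T *m L *m invmx X^T.
have uXt : X^T \in unitmx by rewrite unitmx_tr.
have sS : S^T = S.
  rewrite /S trmx_mul trmx_inv trmxK trmx_mul trmxK.
  apply: (can_inj (mulKmx uX)); rewrite mulKVmx //.
  apply: (can_inj (mulmxK uXt)); rewrite -!mulmxA mulVmx // mulmx1.
  by rewrite [RHS]mulmxA -EX -sL trmx_mul sG EX.
have -> : \tr (L *m L) = \tr (S *m S^T).
  rewrite sS /S.
  by rewrite -!mulmxA mulKmx // [RHS]mxtrace_mulC -!mulmxA mulVmx // mulmx1.
by apply: sumr_ge0 => i _; rewrite mxE; apply: sumr_ge0 => j _; rewrite [S^T j i]mxE -expr2 sqr_ge0.
Qed.

Lemma tracefree_square n (L : 'M[R]_n) : (0 < n)%N ->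
  \tr (tracefree L *m tracefree L) = \tr (L *m L) - (\tr L) ^+ 2 / n%:R.
Proof.
move=> n0; have nR : n%:R != 0 :> R by rewrite pnatr_eq0 -lt0n.
rewrite /tracefree; set c := \tr L / n%:R.
rewrite mulmxBl !mulmxBr mul_scalar_mx mul_mx_scalar -scalar_mxM.
rewrite !raddfB /= mxtraceZ mxtrace_scalar.
by rewrite -mulr_natl /c; field.
Qed.

(** The square of the trace-free part of L has nonnegative trace. *)
Lemma trace_square_ge n (G L : 'M[R]_n) : (0 < n)%N -> G^T = G -> posdef G ->
  (G *m L)^T = G *m L -> (\tr L) ^+ 2 <= n%:R * \tr (L *m L).
Proof.
move=> n0 sG pG sL; have nR : 0 < n%:R :> R by rewrite ltr0n.
have : 0 <= \tr (tracefree L *m tracefree L).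
  apply: (selfadjoint_square sG pG).
  by rewrite /tracefree mulmxBr mul_mx_scalar linearB linearZ /= sL sG.
by rewrite tracefree_square // subr_ge0 ler_pdivrMr // mulrC.
Qed.

End LinearAlgebra.

(** * The derivative of a determinant *)

Section DeterminantDerivative.
Variables (R : realType) (V : normedModType R).

Lemma dprod (I : eqType) (r : seq I) (F : I -> V -> R) (dF : I -> R) x w : uniq r ->
  (forall i, is_derive x w (F i) (dF i)) ->
  is_derive x w (fun z => \prod_(i <- r) F i z)
    (\sum_(i <- r) \prod_(j <- r) (if j == i then dF j else F j x)).
Proof.
move=> + hF; elim: r => [_|i r IH /= /andP[ir ur]].
  rewrite big_nil (_ : (fun z => _) = fun=> 1); first exact: dC.
  by apply/funext => z; rewrite big_nil.
rewrite (_ : (fun z => _) = fun z => F i z * \prod_(j <- r) F j z); last first.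
  by apply/funext => z; rewrite big_cons.
apply: (is_derive_eq (dM (hF i) (IH ur))).
rewrite big_cons big_cons eqxx; congr (_ * _ + _).
  rewrite !big_seq; apply: eq_bigr => j jr; case: eqP => // ji.
  by rewrite -ji jr in ir.
rewrite mulr_sumr !big_seq; apply: eq_bigr => j jr; rewrite big_cons.
by case: eqP => // ij; rewrite ij jr in ir.
Qed.

Lemma ddet n (M : V -> 'M[R]_n) (dM0 : 'M[R]_n) x w :
  (forall i j, is_derive x w (fun z => M z i j) (dM0 i j)) ->
  is_derive x w (fun z => \det (M z)) (\tr (\adj (M x) *m dM0)).
Proof.
move=> hM.
pose Mi i := \matrix_(k, l) (if k == i then dM0 k l else M x k l).
have h : is_derive x w (fun z => \det (M z)) (\sum_(s : 'S_n) (-1) ^+ s * \sum_i \prod_j Mi i j (s j)).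
  apply: dsum => s _; apply: dZ.
  have := @dprod 'I_n (index_enum _) (fun i z => M z i (s i)) (fun i => dM0 i (s i)) x w (index_enum_uniq _).
  move=> /(_ (fun i => hM i (s i))) h; apply: (is_derive_eq h).
  by apply: eq_bigr => i _; apply: eq_bigr => j _; rewrite mxE.
apply: (is_derive_eq h).
under eq_bigr => s _ do rewrite mulr_sumr.
rewrite exchange_big /= mxtrace_mulC; apply: eq_bigr => i _.
rewrite -/(\det (Mi i)) (expand_det_row _ i) mxE; apply: eq_bigr => j _.
rewrite !mxE eqxx; congr (_ * (_ * \det _)).
by apply/matrixP => k l; rewrite !mxE eq_sym (negbTE (neq_lift _ _)).
Qed.

(** Jacobi's formula. *)
Lemma ddet_unit n (M : V -> 'M[R]_n) (dM0 : 'M[R]_n) x w : M x \in unitmx ->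
  (forall i j, is_derive x w (fun z => M z i j) (dM0 i j)) ->
  is_derive x w (fun z => \det (M z)) (\det (M x) * \tr (invmx (M x) *m dM0)).
Proof.
move=> uM hM; apply: (is_derive_eq (ddet hM)).
rewrite -mxtraceZ scalemxAl /invmx uM scalerA mulfV ?scale1r //.
by rewrite -unitfE -unitmxE.
Qed.

End DeterminantDerivative.

(** * Restriction to the hypersurfaces of constant time *)

Section Slices.
Variables (R : realType) (n : nat).
Local Notation V := 'rV[R]_(1 + n).

Definition slice_point (s : R) (y : 'rV[R]_n) : V := row_mx (s%:M : 'M[R]_1) y.

Lemma slice_point_time s y : slice_point s y 0 (time_dir n) = s.
Proof. by rewrite row_mxEl mxE eqxx. Qed.

Lemma delta_space i : delta_mx 0 (space_dir i) = row_mx 0 (delta_mx 0 i) :> V.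
Proof.
apply/rowP => j; rewrite -[j]splitK; case: (fintype.split j) => k /=.
  by rewrite row_mxEl !mxE eqxx /= eq_lrshift.
by rewrite row_mxEr !mxE eqxx /= (inj_eq (@rshift_inj _ _)).
Qed.

Lemma delta_time : delta_mx 0 (time_dir n) = row_mx 1%:M 0 :> V.
Proof.
apply/rowP => j; rewrite -[j]splitK; case: (fintype.split j) => k /=.
  by rewrite row_mxEl !mxE eqxx /= (inj_eq (@lshift_inj _ _)) (ord1 k).
by rewrite row_mxEr !mxE eqxx /time_dir eq_rlshift.
Qed.

Lemma partial_slice (F : V -> R) i s y :
  partial (space_dir i) F (slice_point s y) = partial i (fun y => F (slice_point s y)) y.
Proof.
have E : (fun h : R => h^-1 *: ((F \o shift (slice_point s y)) (h *: delta_mx 0 (space_dir i)) - F (slice_point s y)))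
  = (fun h : R => h^-1 *: (((fun y0 => F (slice_point s y0)) \o shift y) (h *: delta_mx 0 i) - F (slice_point s y))).
  apply/funext => h /=; rewrite delta_space /slice_point scale_row_mx scaler0.
  by rewrite add_row_mx add0r.
by rewrite /partial /derive E.
Qed.

Lemma derive_time (F : V -> R) s y :
  derivable F (slice_point s y) (delta_mx 0 (time_dir n)) ->
  is_derive s 1 (fun r => F (slice_point r y)) (partial (time_dir n) F (slice_point s y)).
Proof.
move=> dF.
have E : (fun h : R => h^-1 *: (((fun r => F (slice_point r y)) \o shift s) (h *: (1:R)) - F (slice_point s y)))
  = (fun h : R => h^-1 *: ((F \o shift (slice_point s y)) (h *: delta_mx 0 (time_dir n)) - F (slice_point s y))).
  apply/funext => h /=; congr (_ *: (F _ - _)).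
  rewrite delta_time /slice_point scale_row_mx scaler0 add_row_mx add0r [h *: 1]mulr1.
  by rewrite scale_scalar_mx mulr1 raddfD.
by apply: DeriveDef; rewrite ?/derivable ?/partial ?/derive E.
Qed.

Local Opaque partial invmx.
Variable g : V -> 'M[R]_n.

Lemma slice_christoffel_restrict k i j s y :
  slice_christoffel g k i j (slice_point s y) = christoffel (fun y => g (slice_point s y)) k i j y.
Proof.
rewrite /slice_christoffel /christoffel; apply: cgM; apply: eq_bigr => l _; apply: cgM.
by rewrite !partial_slice.
Qed.

Lemma slice_ric_restrict i j s y :
  slice_ric g i j (slice_point s y) = ric (fun y => g (slice_point s y)) y i j.
Proof.
rewrite /slice_ric mxE; apply: cgD; apply: eq_bigr => k _.
  rewrite !partial_slice; apply: cgB; apply: (congr1 (fun F => partial _ F y)); apply/funext => z; exact: slice_christoffel_restrict.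
by apply: eq_bigr => l _; rewrite !slice_christoffel_restrict.
Qed.

Lemma slice_scal_restrict s y :
  slice_scal g (slice_point s y) = scal (fun y => g (slice_point s y)) y.
Proof.
apply: eq_bigr => i _; rewrite mxE; apply: eq_bigr => j _; apply: cgM; exact: slice_ric_restrict.
Qed.

End Slices.

(** * Charts *)

Section Charts.
Variables (R : realType) (T : topologicalType) (m : nat).
Implicit Types (c : chart R T m).

Lemma bwd_dom c x : ran c x -> dom c (bwd c x).
Proof. by move=> [p cp <-]; rewrite fwdK. Qed.

Lemma bwdK c x : ran c x -> fwd c (bwd c x) = x.
Proof. by move=> [p cp <-]; rewrite fwdK. Qed.

Lemma fwd_ran c p : dom c p -> ran c (fwd c p).
Proof. by move=> cp; exists p. Qed.

Lemma bwd_continuous_at c x : ran c x -> {for x, continuous (bwd c)}.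
Proof.
move=> cx; have := @bwd_continuous _ _ _ c.
rewrite (continuous_open_subspace _ (@ran_open _ _ _ c)); apply.
exact: mem_set.
Qed.

Lemma fwd_continuous_at c p : dom c p -> {for p, continuous (fwd c)}.
Proof.
move=> cp; have := @fwd_continuous _ _ _ c.
rewrite (continuous_open_subspace _ (@dom_open _ _ _ c)); apply.
exact: mem_set.
Qed.

Lemma overlapP c c' x : overlap c c' x <-> ran c x /\ dom c' (bwd c x).
Proof.
split=> [[p [cp cp'] <-]|[[p cp <-]]].
  by split; [exists p|rewrite fwdK].
by rewrite fwdK // => cp'; exists p.
Qed.

Lemma overlap_open c c' : open (overlap c c').
Proof.
rewrite openE => x /overlapP[cx cx'].
have n1 : nbhs x (ran c) by apply: open_nbhs_nbhs; split => //; exact: ran_open.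
have n2 : nbhs x (bwd c @^-1` dom c').
  by apply: (bwd_continuous_at cx); apply: open_nbhs_nbhs; split => //; exact: dom_open.
by apply: filterS (filterI n1 n2) => y [y1 y2]; apply/overlapP.
Qed.

End Charts.

Lemma continuous_mx (R : realType) (T : topologicalType) m n (M : T -> 'M[R]_(m, n)) (x : T) :
  (forall i j, {for x, continuous (fun t => M t i j)}) -> {for x, continuous M}.
Proof.
move=> hM; apply/cvgrPdist_le => e e0; near=> y.
rewrite /Num.Def.normr/= mx_normrE (bigmax_le _ (ltW e0))//= => i _.
rewrite !mxE/=.
move: i; near: y; apply: filter_forall => /= i.
by have /cvgrPdist_le := hM i.1 i.2; apply.
Unshelve. all: by end_near. Qed.

(** * Curves along coordinate segments *)

Section Reparametrization.
Variable R : realType.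
Implicit Types r : R.

(** A smooth function with values in [-1, 1] that takes 0 to 0 and 1 to 1;
    composed with a coordinate segment it gives a curve that is defined for
    all real times but never leaves the segment. *)
Definition ramp r : R := 2 * r * (1 + r * r)^-1.
Definition ramp_speed r : R := 2 * (1 - r * r) * ((1 + r * r)^-1 * (1 + r * r)^-1).

Lemma ramp_denom r : 0 < 1 + r * r.
Proof. by rewrite ltr_wpDr // -expr2 sqr_ge0. Qed.

Lemma dramp r : is_derive r 1 ramp (ramp_speed r).
Proof.
have d0 := ramp_denom r.
have n0 : 1 + r * r != 0 by rewrite gt_eqF.
have did : is_derive r 1 (fun x : R => x) 1 by exact: is_derive_id.
have dd : is_derive r 1 (fun x : R => 1 + x * x) (0 + (1 * r + r * 1)).
  exact: (dD (dC 1 r 1) (dM did did)).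
have h := dM (dZ 2 did) (@dV R _ (fun x : R => 1 + x * x) r 1 _ n0 dd).
change (is_derive r 1 (fun r => 2 * r * (1 + r * r)^-1) (ramp_speed r)).
refine (is_derive_eq h _).
by rewrite /ramp_speed; field.
Qed.

Lemma ramp0 : ramp 0 = 0. Proof. by rewrite /ramp mulr0 mul0r. Qed.
Lemma ramp1 : ramp 1 = 1. Proof. by rewrite /ramp !mulr1 mulfV // pnatr_eq0. Qed.

Lemma ramp_le1 r : `|ramp r| <= 1.
Proof.
have d0 := ramp_denom r.
rewrite /ramp ler_norml ler_pdivlMr // ler_pdivrMr //.
by apply/andP; split; have := sqr_ge0 (1 + r); have := sqr_ge0 (1 - r); lra.
Qed.

Lemma ramp_speed_le2 r : `|ramp_speed r| <= 2.
Proof.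
have d0 := ramp_denom r.
rewrite /ramp_speed -invfM normrM normrM (ger0_norm (_ : 0 <= 2)) // -[leRHS]mulr1 -mulrA.
rewrite ler_wpM2l // normrV ?unitfE ?gt_eqF ?mulr_gt0 // (gtr0_norm (mulr_gt0 d0 d0)).
rewrite ler_pdivrMr ?mulr_gt0 // mul1r ler_norml.
have r2 : 0 <= r * r by rewrite -expr2 sqr_ge0.
have r4 : 0 <= (r * r) * (r * r) by rewrite mulr_ge0.
by apply/andP; split; lra.
Qed.

Lemma ramp_speed_continuous : continuous ramp_speed.
Proof.
move=> r; have d0 := ramp_denom r.
have n0 : 1 + r * r != 0 by rewrite gt_eqF.
have did : is_derive r 1 (fun x : R => x) 1 by exact: is_derive_id.
have dd : is_derive r 1 (fun x : R => 1 + x * x) (0 + (1 * r + r * 1)).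
  exact: (dD (dC 1 r 1) (dM did did)).
have de : is_derive r 1 (fun x : R => 1 - x * x) (0 - (1 * r + r * 1)).
  exact: (dB (dC 1 r 1) (dM did did)).
have h := derive_continuous (dM (dZ 2 de) (dM (@dV R _ (fun x : R => 1 + x * x) r 1 _ n0 dd) (@dV R _ (fun x : R => 1 + x * x) r 1 _ n0 dd))).
exact h.
Qed.

End Reparametrization.

Section CoordinateCurve.
Variables (R : realType) (m : nat) (M : manifold R m) (gbar : tensor2 M).
Hypothesis gbar_metric : riemannian_metric gbar.
Variables (c : chart R M m) (x : 'rV[R]_m) (a : 'I_m) (s : R).
Hypothesis ac : atlas M c.
Local Notation e := (delta_mx 0 a : 'rV[R]_m).
Hypothesis segment : forall t : R, `|t| <= `|s| -> ran c (x + t *: e).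

Let point r := x + (ramp r * s) *: e.
Definition coordinate_curve r : M := bwd c (x + (ramp r * s) *: e).

Lemma curve_point_ran r : ran c (point r).
Proof. by apply: segment; rewrite normrM ler_piMl // ramp_le1. Qed.

Lemma curve_point_continuous : continuous point.
Proof.
move=> r; apply: continuous_mx => i j.
rewrite (_ : (fun t => point t i j) = fun t => x i j + ramp t * s * e i j); last first.
  by apply/funext => t; rewrite !mxE.
exact: (derive_continuous (dD (dC (x i j) r 1) (dM (dM (dramp r) (dC s r 1)) (dC (e i j) r 1)))).
Qed.

Lemma curve_continuous : continuous coordinate_curve.
Proof.
move=> r; apply: (@continuous_comp _ _ _ point (bwd c)); first exact: curve_point_continuous.
exact/bwd_continuous_at/curve_point_ran.
Qed.

(** In another chart the curve is a function of a single coordinate of the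
    first chart, so only a partial derivative of the transition map occurs and
    no chain rule in several variables. *)
Lemma curve_derive c' r b : atlas M c' -> dom c' (coordinate_curve r) ->
  is_derive r 1 (fun r => fwd c' (coordinate_curve r) 0 b)
    (ramp_speed r * s * partial a (fun y => transition c c' y 0 b) (point r)).
Proof.
move=> ac' cr.
have ov : overlap c c' (point r) by apply/overlapP; split; [exact: curve_point_ran|].
have [sm _] := atlas_compatible ac ac'.
have [_ dF] := smooth_is_derive a (sm b) ov.
have [dF1 _] := smooth_is_derive a (sm b) ov.
have h1 := line_derive (x := x) (v := e) (s := ramp r * s) dF1.
have h2 : is_derive r 1 (fun r => ramp r * s) (ramp_speed r * s).
  by apply: (is_derive_eq (dM (dramp r) (dC s r 1))); rewrite mulr0 addr0.
have := @is_derive1_comp R _ _ r _ _ h1 h2.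
by rewrite mulrC.
Qed.

Lemma curve_velocity c' r : atlas M c' -> dom c' (coordinate_curve r) ->
  derivable (fun r => fwd c' (coordinate_curve r)) r 1 /\
  derive1 (fun r => fwd c' (coordinate_curve r)) r =
    (ramp_speed r * s) *: row a (jac (transition c c') (point r)).
Proof.
move=> ac' cr.
have d : derivable (fun r => fwd c' (coordinate_curve r)) r 1.
  by apply/derivable_mxP => i j; rewrite (ord1 i); case: (curve_derive j ac' cr).
split=> //; rewrite derive1E derive_mx //.
apply/rowP => b; rewrite !mxE.
by case: (curve_derive b ac' cr).
Qed.

Lemma curve_C1 : C1_curve coordinate_curve.
Proof.
split; first exact: curve_continuous.
move=> c' ac' r cr; split; first by case: (curve_velocity ac' cr).
have near_dom : \forall t \near r, derive1 (fun r => fwd c' (coordinate_curve r)) t =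
    (ramp_speed t * s) *: row a (jac (transition c c') (point t)).
  have n : nbhs r (coordinate_curve @^-1` dom c').
    by apply: curve_continuous; apply: open_nbhs_nbhs; split => //; exact: dom_open.
  by apply: filterS n => t ct; case: (curve_velocity ac' ct).
have ov : overlap c c' (point r) by apply/overlapP; split; [exact: curve_point_ran|].
have [sm _] := atlas_compatible ac ac'.
have cv : {for r, continuous (fun t => (ramp_speed t * s) *: row a (jac (transition c c') (point t)))}.
  apply: continuous_mx => i b.
  rewrite (_ : (fun t => _) = fun t => ramp_speed t * s * partial a (fun y => transition c c' y 0 b) (point t)); last first.
    by apply/funext => t; rewrite !mxE.
  apply: continuousM.
    by apply: continuousM; [exact: ramp_speed_continuous|exact: cst_continuous].
  apply: (@continuous_comp _ _ _ point); first exact: curve_point_continuous.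
  exact: (smooth_continuous (smooth_partial a (sm b)) ov).
rewrite /prop_for /continuous_at (nbhs_singleton near_dom).
apply: cvg_trans cv; apply: near_eq_cvg.
by apply: filterS near_dom => t ->.
Qed.

Definition curve_speed r := Num.sqrt ((ramp_speed r * s) ^+ 2 * gbar c (point r) a a).

Lemma curve_speedP : speed gbar coordinate_curve curve_speed.
Proof.
move=> c' ac' r cr; have [_ ->] := curve_velocity ac' cr.
have ov : overlap c c' (point r) by apply/overlapP; split; [exact: curve_point_ran|].
rewrite /curve_speed (metric_transform gbar_metric ac ac' ov).
rewrite linearZ /= -!scalemxAl -scalemxAr scalerA -expr2; apply: (congr1 Num.sqrt).
rewrite -/(transition c c' (point r)) [RHS]mxE; apply: cgM.
rewrite !mxE; apply: eq_bigr => k _.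
by rewrite -row_mul !mxE.
Qed.

Lemma curve_speed_continuous : continuous curve_speed.
Proof.
move=> r; apply: (@continuous_comp _ _ _ (fun r => (ramp_speed r * s) ^+ 2 * gbar c (point r) a a) Num.sqrt); last exact: sqrt_continuous.
apply: continuousM.
  rewrite (_ : (fun t => _) = fun t => (ramp_speed t * s) * (ramp_speed t * s)); last first.
    by apply/funext => t; rewrite expr2.
  by apply: continuousM; apply: continuousM; (exact: ramp_speed_continuous || exact: cst_continuous).
apply: (@continuous_comp _ _ _ point (fun y => gbar c y a a)); first exact: curve_point_continuous.
exact: (smooth_continuous (metric_smooth gbar_metric ac a a) (curve_point_ran r)).
Qed.

(** The length of the curve along the segment; the factor 2 bounds the
    derivative of the reparametrization. *)
Lemma coordinate_distance (K : R) : 0 <= K ->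
  (forall t : R, `|t| <= `|s| -> gbar c (x + t *: e) a a <= K ^+ 2) ->
  (rdist gbar (bwd c x) (bwd c (x + s *: e)) <= (2 * `|s| * K)%:E)%E.
Proof.
move=> K0 hK; apply: ge_ereal_inf.
exists (\int[lebesgue_measure]_(r in `[0%R, 1%R]) (curve_speed r)%:E)%E.
  exists coordinate_curve, curve_speed; split => //.
  - exact: curve_C1.
  - exact: curve_speedP.
  - by rewrite /coordinate_curve ramp0 mul0r scale0r addr0.
  - by rewrite /coordinate_curve ramp1 mul1r.
have bound r : curve_speed r <= 2 * `|s| * K.
  rewrite /curve_speed sqrtrM ?sqr_ge0 // sqrtr_sqr normrM.
  apply: ler_pM => //; first by rewrite ler_wpM2r // ramp_speed_le2.
  rewrite -[leRHS]ger0_norm // -sqrtr_sqr ler_wsqrtr // hK //.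
  by rewrite normrM ler_piMl // ramp_le1.
have mI : measurable (`[0%R, 1%R] : set R) by exact: measurable_itv.
have E : (\int[lebesgue_measure]_(r in `[0%R, 1%R]) cst (2 * `|s| * K)%:E r = (2 * `|s| * K)%:E)%E.
  rewrite integral_cst //.
  have L : lebesgue_measure (`[0%R, 1%R] : set R) = 1%E.
    by rewrite lebesgue_measure_itv /= lte_fin ltr01 -EFinB subr0.
  rewrite [X in (_ * X)%E](_ : _ = 1%E); first exact: mule1.
  exact: L.
rewrite -E; apply: ge0_le_integral => //.
- by move=> r _; rewrite lee_fin sqrtr_ge0.
- apply/measurable_realfun.measurable_EFinP; apply: measurable_funTS.
  by apply: measurable_realfun.continuous_measurable_fun; exact: curve_speed_continuous.
- by move=> r _; rewrite lee_fin bound.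
Qed.

End CoordinateCurve.

(** * The distance to a set along coordinate lines *)

Section Distance.
Variables (R : realType) (m : nat) (M : manifold R m) (gbar : tensor2 M).
Hypothesis gbar_metric : riemannian_metric gbar.

Lemma rdist_ge0 (p q : M) : (0 <= rdist gbar p q)%E.
Proof.
apply: le_ereal_inf_tmp => l [gam [sp [_ hs _ _ ->]]].
apply: integral_ge0 => r _; have [c ac cr] := atlas_cover (gam r).
by rewrite lee_fin (hs c ac r cr) sqrtr_ge0.
Qed.

Lemma rdist_to_ge0 (N : set M) p : (0 <= rdist_to gbar N p)%E.
Proof. by apply: le_ereal_inf_tmp => _ [q _ <-]; exact: rdist_ge0. Qed.

Lemma rdist_to_le (N : set M) p q : N p -> (rdist_to gbar N q <= rdist gbar p q)%E.
Proof. by move=> Np; apply: ereal_inf_lbound; exists p. Qed.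

Lemma ball_coordinate (x : 'rV[R]_m) (a : 'I_m) (d t : R) : `|t| < d ->
  ball x d (x + t *: delta_mx 0 a).
Proof.
move=> td; rewrite -ball_normE /ball_ /= opprD addrA subrr add0r normrN normrZ.
apply: le_lt_trans td; rewrite -[leRHS]mulr1 ler_wpM2l //.
exact: norm_delta_le1.
Qed.

(** Near p the component of the metric in the direction of the segment is
    bounded. *)
Lemma coordinate_distance_bound c p (a : 'I_m) : atlas M c -> dom c p ->
  exists r K : R, [/\ 0 < r, 0 <= K & forall s : R, `|s| <= r ->
    ran c (fwd c p + s *: delta_mx 0 a) /\
    (rdist gbar p (bwd c (fwd c p + s *: delta_mx 0 a)%R) <= (K * `|s|)%:E)%E].
Proof.
move=> ac cp; set x := fwd c p.
have cx : ran c x by exact: fwd_ran.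
pose B := gbar c x a a + 1.
have n1 : nbhs x (ran c) by apply: open_nbhs_nbhs; split => //; exact: ran_open.
have n2 : \forall y \near x, gbar c y a a <= B.
  have := smooth_continuous (metric_smooth gbar_metric ac a a) cx.
  move=> /cvgrPdist_lt /(_ 1 ltr01); apply: filterS => y.
  by rewrite ltr_distlC /B => /andP[_ /ltW].
have [d /= d0 hd] := (nbhs_ballP _ _).1 (filterI n1 n2).
have hB (t : R) : `|t| < d -> ran c (x + t *: delta_mx 0 a) /\ gbar c (x + t *: delta_mx 0 a) a a <= B.
  by move=> td; exact: hd (ball_coordinate x a td).
exists (d / 2), (2 * Num.sqrt (Num.max B 0)); split; [by rewrite divr_gt0|by rewrite mulr_ge0 ?sqrtr_ge0|].
move=> s hs.
have small (t : R) : `|t| <= `|s| -> `|t| < d by move=> ts; lra.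
split; first by case: (hB s (small s (lexx _))).
have := @coordinate_distance R m M gbar gbar_metric c x a s ac
  (fun t ts => (hB t (small t ts)).1) (Num.sqrt (Num.max B 0)) (sqrtr_ge0 _).
rewrite {1}/x fwdK // [2 * _ * _]mulrAC; apply=> t ts.
rewrite sqr_sqrtr ?le_max ?lexx ?orbT //.
by have [_ ->] := hB t (small t ts).
Qed.

End Distance.

(** * The potential near the special orbit *)

Section SpecialOrbit.
Variables (R : realType) (n k : nat) (M : manifold R n.+1) (P : manifold R n)
  (gbar : tensor2 M) (u : M -> R) (N : set M) (Phi : R -> P -> M)
  (g_ L_ : R -> tensor2 P) (U : R -> R).
Hypothesis gbar_metric : riemannian_metric gbar.
Hypothesis u_smooth : smooth_fun u.
Hypothesis coh : cohomogeneity_one k gbar u N Phi g_ L_ U.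

Definition orbit_distance (q : M) : R := fine (rdist_to gbar N q).
Local Notation o := (time_dir n).

Lemma orbit_distance_Phi (s : R) (x : P) : 0 < s -> orbit_distance (Phi s x) = s.
Proof. by move=> s0; rewrite /orbit_distance (coh1_distance coh) //. Qed.

Lemma Phi_off (s : R) (x : P) : 0 < s -> ~ N (Phi s x).
Proof. by move=> s0; apply/(coh1_Phi_image coh); exists s, x. Qed.

Lemma potential_Phi (s : R) (x : P) : 0 < s -> u (Phi s x) = U s.
Proof. by move=> s0; rewrite (coh1_potential coh) -/(orbit_distance _) orbit_distance_Phi. Qed.

Lemma potential_orbit_distance q : u q = U (orbit_distance q).
Proof. exact: coh1_potential coh q. Qed.

Lemma orbit_distance_orbit p : N p -> rdist_to gbar N p = 0%E.
Proof.
move=> Np; apply/eqP; rewrite eq_le rdist_to_ge0 // andbT.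
have [c ac cp] := atlas_cover p.
have [r [K [r0 K0 h]]] := coordinate_distance_bound gbar_metric (ord0 : 'I_n.+1) ac cp.
have [|_] := h 0; first by rewrite normr0 ltW.
rewrite scale0r addr0 fwdK // normr0 mulr0; apply: le_trans.
exact: rdist_to_le.
Qed.

Lemma potential_orbit p : N p -> u p = 0.
Proof. by move=> Np; rewrite potential_orbit_distance /orbit_distance orbit_distance_orbit //= (coh1_potential0 coh). Qed.

Lemma off_orbit q : ~ N q -> exists s x, 0 < s /\ q = Phi s x.
Proof. by move/(coh1_Phi_image coh). Qed.

Lemma orbit_distance_gt0 q : ~ N q -> 0 < orbit_distance q.
Proof. by move=> /off_orbit[s [x [s0 ->]]]; rewrite orbit_distance_Phi. Qed.

Lemma orbit_distance_le p q (K : R) : N p -> (rdist gbar p q <= K%:E)%E -> orbit_distance q <= K.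
Proof.
move=> Np pq; have h : (rdist_to gbar N q <= K%:E)%E by apply: le_trans pq; exact: rdist_to_le.
have h0 := rdist_to_ge0 gbar N q.
rewrite /orbit_distance -lee_fin fineK //.
by rewrite ge0_fin_numE // (le_lt_trans h) // ltry.
Qed.

Definition product_chart (d : chart R P n) (c : chart R M n.+1) :=
  [/\ atlas M c,
    dom c = [set p | exists s x, [/\ 0 < s, dom d x & p = Phi s x]],
    (forall s x, 0 < s -> dom d x -> fwd c (Phi s x) = slice_point s (fwd d x)) &
    (forall s y, 0 < s -> ran d y -> gbar c (slice_point s y)
       = block_mx (1%:M : 'M[R]_1) 0 0 (g_ s d y))].

Lemma product_chart_exists d : atlas P d -> exists c, product_chart d c.
Proof. exact: (coh1_chart coh). Qed.

Lemma product_chart_ran d c z : product_chart d c ->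
  ran c z <-> exists s y, [/\ 0 < s, ran d y & z = slice_point s y].
Proof.
move=> [ac dc fc _]; split.
  move=> [p + <-]; rewrite dc => -[s [x [s0 dx ->]]].
  by exists s, (fwd d x); rewrite fc //; split => //; exact: fwd_ran.
move=> [s [y [s0 [x dx <-] ->]]]; exists (Phi s x); last by rewrite fc.
by rewrite dc; exists s, x.
Qed.

Lemma product_chart_bwd d c (s : R) (y : 'rV[R]_n) : product_chart d c -> 0 < s -> ran d y ->
  exists2 x, dom d x & bwd c (slice_point s y) = Phi s x /\ fwd d x = y.
Proof.
move=> [ac dc fc _] s0 [x dx <-]; exists x => //; rewrite -fc // fwdK //.
by rewrite dc; exists s, x.
Qed.

Lemma product_chart_distance d c q : product_chart d c -> dom c q -> orbit_distance q = fwd c q 0 o.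
Proof.
move=> [ac dc fc _]; rewrite dc => -[s [x [s0 dx ->]]].
by rewrite orbit_distance_Phi // fc // slice_point_time.
Qed.

Lemma product_chart_off d c q : product_chart d c -> dom c q -> ~ N q.
Proof. by move=> [ac dc fc _]; rewrite dc => -[s [x [s0 dx ->]]]; exact: Phi_off. Qed.

Lemma product_chart_cover q : ~ N q -> exists d c, [/\ atlas P d, product_chart d c & dom c q].
Proof.
move=> /off_orbit[s [x [s0 ->]]]; have [d ad dx] := atlas_cover x.
have [c pc] := product_chart_exists ad; exists d, c; split => //.
by case: pc => _ -> _ _; exists s, x.
Qed.

(** Otherwise M would be the special orbit, hence compact. *)
Lemma P_inhabited : exists x : P, True.
Proof.
apply/not_existsP => h; apply: (coh1_noncompact coh).
rewrite (_ : [set: M] = N); first exact: (coh1_orbit_compact coh).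
apply/seteqP; split => // q _; apply/not_notP => /off_orbit[s [x _]].
exact: (h x I).
Qed.

(** The distance to the empty set is infinite, whereas the points Phi 1 x have
    distance 1. *)
Lemma orbit_inhabited : exists p, N p.
Proof.
apply/not_existsP => h; have [x _] := P_inhabited.
have := coh1_distance coh x ltr01; rewrite /rdist_to.
rewrite (_ : [set rdist gbar q (Phi 1 x) | q in N] = set0) ?ereal_inf0 //.
by apply/seteqP; split => // l [q Nq _]; exact: (h q Nq).
Qed.

Lemma potential_slice d c (s : R) (y : 'rV[R]_n) : product_chart d c -> 0 < s -> ran d y ->
  (u \o bwd c) (slice_point s y) = U s.
Proof.
by move=> pc s0 dy; have [x dx [/= -> _]] := product_chart_bwd pc s0 dy; exact: potential_Phi.
Qed.

Lemma potential_derive d c (s : R) (y : 'rV[R]_n) : product_chart d c -> 0 < s -> ran d y ->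
  is_derive s 1 U (partial o (u \o bwd c) (slice_point s y)).
Proof.
move=> pc s0 dy; have [ac _ _ _] := pc.
have cz : ran c (slice_point s y) by apply/(product_chart_ran _ pc); exists s, y.
have [h _] := smooth_is_derive o (u_smooth ac) cz.
apply: (is_derive_positive s0 _ (derive_time h)) => r r0.
by rewrite (potential_slice pc r0 dy).
Qed.

Lemma potential_derive1 d c (s : R) (y : 'rV[R]_n) : product_chart d c -> 0 < s -> ran d y ->
  derive1 U s = partial o (u \o bwd c) (slice_point s y).
Proof. by move=> pc s0 dy; rewrite derive1E; case: (potential_derive pc s0 dy). Qed.

Lemma potential_derive2 d c (s : R) (y : 'rV[R]_n) : product_chart d c -> 0 < s -> ran d y ->
  is_derive s 1 (derive1 U) (partial o (partial o (u \o bwd c)) (slice_point s y)).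
Proof.
move=> pc s0 dy; have [ac _ _ _] := pc.
have cz : ran c (slice_point s y) by apply/(product_chart_ran _ pc); exists s, y.
have [h _] := smooth_is_derive o (smooth_partial o (u_smooth ac)) cz.
apply: (is_derive_positive s0 _ (derive_time h)) => r r0.
by rewrite (potential_derive1 pc r0 dy).
Qed.

Lemma potential_profile_derive (s : R) : 0 < s -> is_derive s 1 U (derive1 U s).
Proof.
move=> s0; have [x _] := P_inhabited; have [d ad dx] := atlas_cover x.
have [c pc] := product_chart_exists ad.
rewrite (potential_derive1 pc s0 (fwd_ran dx)); exact: (potential_derive pc s0 (fwd_ran dx)).
Qed.

Lemma potential_profile_derive2 (s : R) : 0 < s -> exists d2, is_derive s 1 (derive1 U) d2.
Proof.
move=> s0; have [x _] := P_inhabited; have [d ad dx] := atlas_cover x.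
have [c pc] := product_chart_exists ad.
by eexists; exact: (potential_derive2 pc s0 (fwd_ran dx)).
Qed.

(** The components of du, the covector dual to the gradient. *)
Definition gradient (c : chart R M n.+1) (z : 'rV[R]_n.+1) : 'cV[R]_n.+1 :=
  \col_a partial a (u \o bwd c) z.
Definition gradient_norm2 (c : chart R M n.+1) (z : 'rV[R]_n.+1) : R :=
  ((gradient c z)^T *m invmx (gbar c z) *m gradient c z) 0 0.

Lemma metric_unit c z : atlas M c -> ran c z -> gbar c z \in unitmx.
Proof.
move=> ac cz; apply: posdef_unit; first exact: (metric_sym gbar_metric).
exact: (metric_pos gbar_metric).
Qed.

Lemma gradient_norm2_smooth c : atlas M c -> smooth_on (ran c) (gradient_norm2 c).
Proof.
move=> ac; have oc : open (ran c) by exact: ran_open.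
have su a : smooth_on (ran c) (partial a (u \o bwd c)) by exact/smooth_partial/u_smooth.
have si i j : smooth_on (ran c) (fun z => invmx (gbar c z) i j).
  exact: (smooth_invmx oc (metric_smooth gbar_metric ac) (fun z => metric_unit ac)).
apply: (@smooth_local _ _ _ _ (fun z => \sum_j (\sum_i partial i (u \o bwd c) z * invmx (gbar c z) i j) * partial j (u \o bwd c) z)) => //.
  move=> z _; rewrite /gradient_norm2 mxE; apply: eq_bigr => j _; rewrite !mxE; congr (_ * _).
  by apply: eq_bigr => i _; rewrite !mxE.
apply: smooth_sum => [|j _]; first exact: oc.
apply: (smooth_mul oc); last exact: su.
apply: smooth_sum => [|i _]; first exact: oc.
by apply: (smooth_mul oc).
Qed.

(** Near z the potential is U composed with the time coordinate of the product
    chart. *)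
Lemma gradient_transition c d c' z a : atlas M c -> product_chart d c' -> overlap c c' z ->
  partial a (u \o bwd c) z = derive1 U (transition c c' z 0 o) * jac (transition c c') z a o.
Proof.
move=> ac pc ov; have [ac' _ _ _] := pc.
have tr_dist y : overlap c c' y -> transition c c' y 0 o = orbit_distance (bwd c y).
  by move=> /overlapP[_ dy]; rewrite (product_chart_distance pc dy).
have [sm _] := atlas_compatible ac ac'.
have U0 : 0 < transition c c' z 0 o.
  rewrite tr_dist //; apply: orbit_distance_gt0; apply: (product_chart_off pc).
  by have /overlapP[] := ov.
rewrite (partial_local a (@overlap_open _ _ _ c c') (g := fun y => U (transition c c' y 0 o)) _ ov); last first.
  by move=> y oy; rewrite tr_dist // -potential_orbit_distance.
apply: partial_eq; rewrite mxE.
have [dF _] := smooth_is_derive a (sm o) ov.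
have h1 : is_derive (0 : R) 1 (fun r : R => transition c c' (z + r *: delta_mx 0 a) 0 o)
    (partial a (fun y => transition c c' y 0 o) z).
  have := @line_derive _ _ (fun y => transition c c' y 0 o) z (delta_mx 0 a) 0.
  by rewrite scale0r addr0; apply.
have h2 : is_derive (transition c c' (z + 0 *: delta_mx 0 a) 0 o) 1 U (derive1 U (transition c c' z 0 o)).
  by rewrite scale0r addr0; exact: potential_profile_derive.
have [h3 h4] := @is_derive1_comp R U (fun r : R => transition c c' (z + r *: delta_mx 0 a) 0 o) 0 _ _ h2 h1.
have E : (fun h : R => h^-1 *: (((fun y => U (transition c c' y 0 o)) \o shift z) (h *: delta_mx 0 a) - U (transition c c' z 0 o)))
   = (fun h : R => h^-1 *: (((U \o fun r : R => transition c c' (z + r *: delta_mx 0 a) 0 o) \o shift 0) (h *: (1:R)) - (U \o fun r : R => transition c c' (z + r *: delta_mx 0 a) 0 o) 0)).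
  apply/funext => h /=; rewrite scale0r !addr0 [h *: 1]mulr1.
  by rewrite [z + _]addrC.
apply: DeriveDef; rewrite ?/derivable ?/derive E.
  exact: h3.
exact: h4.
Qed.

(** In a product chart du = U' dt and dt has norm 1; the norm does not depend
    on the chart. *)
Lemma gradient_norm2_off c z : atlas M c -> ran c z -> ~ N (bwd c z) ->
  gradient_norm2 c z = derive1 U (orbit_distance (bwd c z)) ^+ 2.
Proof.
move=> ac cz nz; have [d [c' [ad pc cq]]] := product_chart_cover nz.
have [ac' _ _ gc'] := pc.
have ov : overlap c c' z by apply/overlapP.
pose J := jac (transition c c') z; pose z' := transition c c' z.
have cz' : ran c' z' by exact: fwd_ran.
have [s [y [s0 dy ez']]] := (product_chart_ran z' pc).1 cz'.
have ts : orbit_distance (bwd c z) = s by rewrite (product_chart_distance pc cq) -/(transition c c' z) -/z' ez' slice_point_time.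
pose y1 := derive1 U s.
have Eg : gradient c z = y1 *: col o J.
  apply/colP => a; rewrite !mxE (gradient_transition a ac pc ov) -/z' ez' slice_point_time.
  by rewrite mxE.
have EG : gbar c z = J *m gbar c' z' *m J^T by exact: (metric_transform gbar_metric).
have uG := metric_unit ac cz.
have uG' := metric_unit ac' cz'.
have uJ : J \in unitmx.
  move: uG; rewrite EG unitmxE !det_mulmx unitrM => /andP[+ _]; rewrite unitrM => /andP[+ _].
  by rewrite -unitmxE.
have uJt : J^T \in unitmx by rewrite unitmx_tr.
have tE : (y1 *: col o J)^T = y1 *: (col o J)^T by rewrite linearZ.
rewrite /gradient_norm2 ts Eg tE -!scalemxAl -scalemxAr scalerA mxE -expr2.
rewrite -[RHS]mulr1; congr (_ * _).
have -> : (col o J)^T = row o J^T by rewrite tr_col.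
have iG : invmx (gbar c z) = invmx J^T *m invmx (gbar c' z') *m invmx J.
  apply: (can_inj (mulKmx uG)); rewrite mulmxV // EG -!mulmxA.
  by rewrite (mulKVmx uJt) (mulKVmx uG') mulmxV.
rewrite iG rowE colE -!mulmxA (mulKVmx uJt) (mulKmx uJ).
rewrite ez' gc' //.
have hP : product_metric (fun z => g_ s d y) z' = block_mx (1%:M : 'M[R]_1) 0 0 (g_ s d y) by [].
have hu : g_ s d y \in unitmx.
  move: uG'; rewrite ez' gc' // unitmxE (@det_lblock R 1 n) det1 mul1r.
  by rewrite -unitmxE.
rewrite -hP (@invmx_product R n [set z'] (fun z => g_ s d y)) //.
have -> : o = lshift n ord0 by [].
rewrite mulmxA -rowE -colE mxE; rewrite mxE; rewrite (@block_mxEul R 1 n 1 n) mxE eqxx.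
by [].
Qed.

Lemma orbit_distance_continuous q : ~ N q -> {for q, continuous orbit_distance}.
Proof.
move=> nq; have [d [c [ad pc cq]]] := product_chart_cover nq.
have cc : {for q, continuous (fun q => fwd c q 0 o)}.
  apply: (@continuous_comp _ _ _ (fwd c) (fun x : 'rV[R]_n.+1 => x 0 o)).
    exact: fwd_continuous_at.
  exact: coord_continuous.
rewrite /prop_for /continuous_at (product_chart_distance pc cq).
have n1 : nbhs q (dom c) by apply: open_nbhs_nbhs; split => //; exact: dom_open.
apply: cvg_trans cc; apply: near_eq_cvg.
by apply: filterS n1 => r cr; rewrite (product_chart_distance pc cr).
Qed.

(** A slice chart at a point of the orbit: moving in the first normal
    coordinate leaves the orbit. *)
Lemma slice_chart : exists c x, [/\ atlas M c, ran c x, N (bwd c x) &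
  forall s : R, s != 0 -> ran c (x + s *: delta_mx 0 ord0) ->
    ~ N (bwd c (x + s *: delta_mx 0 ord0))].
Proof.
have [p Np] := orbit_inhabited.
have [c [ac cp hc]] := coh1_orbit_submanifold coh Np.
exists c, (fwd c p); split => //; [exact: fwd_ran|by rewrite fwdK|].
move=> s s0 cs; rewrite (hc _ (bwd_dom cs)) => /(_ ord0 (ltn0Sn _)).
rewrite bwdK // !mxE ((hc p cp).1 Np ord0 (ltn0Sn _)) !eqxx mulr1 add0r.
by move/eqP; exact/negP.
Qed.

(** The point of the orbit is bwd c x, and the ray is the coordinate segment
    through it in a direction normal to the orbit. *)
Section OrbitPoint.
Variables (c : chart R M n.+1) (x : 'rV[R]_n.+1).
Hypotheses (ac : atlas M c) (cx : ran c x) (Nx : N (bwd c x)).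
Hypothesis leaves : forall s : R, s != 0 -> ran c (x + s *: delta_mx 0 ord0) ->
    ~ N (bwd c (x + s *: delta_mx 0 ord0)).

Local Notation point a s := (x + s *: delta_mx 0 a).
Local Notation ray s := (x + s *: delta_mx 0 ord0).

(** The point at parameter s has distance at most a constant times |s| from
    the orbit. *)
Lemma axis_near_orbit (a : 'I_n.+1) (e : R) : 0 < e -> exists2 r, 0 < r &
  forall s : R, `|s| < r -> ran c (point a s) /\ orbit_distance (bwd c (point a s)) < e.
Proof.
move=> e0; have [r [K [r0 K0 h]]] := coordinate_distance_bound gbar_metric a ac (bwd_dom cx).
have K1 : 0 < K + 1 by rewrite ltr_wpDl.
(* K may vanish, whence K + 1. *)
exists (Num.min r (e / (K + 1))); first by rewrite lt_min r0 divr_gt0.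
move=> s; rewrite lt_min ltr_pdivlMr // => /andP[/ltW sr se].
have [] := h s sr; rewrite bwdK // => cs ds; split => //.
apply: le_lt_trans (orbit_distance_le Nx ds) _.
by have := normr_ge0 s; lra.
Qed.

Lemma ray_continuous : continuous (fun s : R => ray s).
Proof.
move=> s; apply: continuous_mx => i j.
rewrite (_ : (fun t : R => ray t i j) = fun t => x i j + t * (delta_mx 0 ord0 : 'rV[R]_n.+1) i j); last first.
  by apply/funext => t; rewrite !mxE.
apply: (derive_continuous (dD (dC (x i j) s 1) (dM _ (dC _ s 1)))).
Qed.

Lemma ray_ran : exists2 r, 0 < r & forall s : R, `|s| < r -> ran c (ray s).
Proof. by have [r r0 h] := axis_near_orbit ord0 ltr01; exists r => // s /h[]. Qed.

(** Along the ray the distance to the orbit is continuous and tends to 0. *)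
Lemma ray_reaches (s1 : R) : 0 < s1 -> (forall s : R, `|s| <= s1 -> ran c (ray s)) ->
  forall t, 0 < t -> t < orbit_distance (bwd c (ray s1)) ->
  exists s, [/\ 0 < s, s <= s1 & orbit_distance (bwd c (ray s)) = t].
Proof.
move=> s10 h t t0 ts1; have [r r0 hr] := axis_near_orbit ord0 t0.
(* A parameter at which the distance is below t. *)
pose s0 := Num.min s1 (r / 2).
have s00 : 0 < s0 by rewrite lt_min s10 divr_gt0.
have s01 : s0 <= s1 by rewrite ge_min lexx.
have s0r : s0 < r by rewrite gt_min; apply/orP; right; lra.
have [_ fs0] : ran c (ray s0) /\ orbit_distance (bwd c (ray s0)) < t by apply: hr; rewrite gtr0_norm.
have ct : {within `[s0, s1], continuous (fun s : R => orbit_distance (bwd c (ray s)))}.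
  apply: continuous_in_subspaceT => s; rewrite inE /= in_itv /= => /andP[h1 h2].
  have sp : 0 < s by exact: lt_le_trans h1.
  have cs : ran c (ray s) by apply: h; rewrite gtr0_norm.
  apply: (@continuous_comp _ _ _ (fun s : R => bwd c (ray s)) orbit_distance).
    by apply: (@continuous_comp _ _ _ (fun s : R => ray s) (bwd c)); [exact: ray_continuous|exact: bwd_continuous_at].
  by apply: orbit_distance_continuous; apply: leaves => //; rewrite gt_eqF.
have [|s + e] := IVT s01 ct (v := t).
  by rewrite ge_min le_max (ltW fs0) (ltW ts1) orbT.
by rewrite in_itv /= => /andP[h1 h2]; exists s; split => //; exact: lt_le_trans h1.
Qed.

Lemma ray_small (P0 : R -> Prop) : (\forall s \near (0:R), P0 s) ->
  exists r, [/\ 0 < r, forall s : R, `|s| <= r -> ran c (ray s) & forall s : R, `|s| <= r -> P0 s].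
Proof.
move=> /nbhs_ballP[e /= e0 he]; have [r r0 hr] := ray_ran.
exists (Num.min (e / 2) (r / 2)); split; first by rewrite lt_min !divr_gt0.
  by move=> s; rewrite le_min => /andP[_ h]; apply: hr; lra.
move=> s; rewrite le_min => /andP[h _]; apply: he.
by rewrite /ball /= sub0r normrN; lra.
Qed.

Lemma ray_limit (f : 'rV[R]_n.+1 -> R) (e : R) : smooth_on (ran c) f -> 0 < e ->
  \forall s \near (0:R), `|f (ray s) - f x| < e.
Proof.
move=> sf e0.
have cf : {for (0 : R), continuous (fun s : R => f (ray s))}.
  apply: (@continuous_comp _ _ _ (fun s : R => ray s) f); first exact: ray_continuous.
  by rewrite scale0r addr0; exact: smooth_continuous sf cx.
move: cf; rewrite /prop_for /continuous_at scale0r addr0 => /cvgrPdist_lt /(_ e e0).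
by apply: filterS => s; rewrite distrC.
Qed.

Lemma potential_at_orbit : (u \o bwd c) x = 0.
Proof. exact: potential_orbit. Qed.

Lemma ray_gradient (s : R) : 0 < s -> ran c (ray s) ->
  derive1 U (orbit_distance (bwd c (ray s))) ^+ 2 = gradient_norm2 c (ray s).
Proof.
by move=> s0 cs; rewrite (gradient_norm2_off ac cs) //; apply: leaves => //; rewrite gt_eqF.
Qed.

Lemma ray_distance_gt0 (s : R) : 0 < s -> ran c (ray s) -> 0 < orbit_distance (bwd c (ray s)).
Proof. by move=> s0 cs; apply: orbit_distance_gt0; apply: leaves => //; rewrite gt_eqF. Qed.

Lemma small_times (e : R) : 0 < e -> exists t, [/\ 0 < t, t < e, `|U t| < e &
   `|derive1 U t ^+ 2 - gradient_norm2 c x| < e].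
Proof.
move=> e0; have [r r0 hr] := axis_near_orbit ord0 e0.
have n1 : \forall s \near (0:R), `|s| < r.
  by apply/nbhs_ballP; exists r => //= s; rewrite /ball /= sub0r normrN.
have [s1 [s10 hs1 hP]] := ray_small (filterI n1 (filterI (ray_limit (u_smooth ac) e0)
   (ray_limit (gradient_norm2_smooth ac) e0))).
have [] := hP s1; first by rewrite gtr0_norm.
move=> /hr[cs ts] [h1 h2]; exists (orbit_distance (bwd c (ray s1))); split => //.
- exact: ray_distance_gt0.
- by rewrite -potential_orbit_distance; move: h1; rewrite potential_at_orbit subr0.
- by rewrite ray_gradient.
Qed.

(** If U' has a sign near 0 then so does U, by integration from 0, and u has a
    local extremum at the point of the orbit. Hence u has vanishing partial
    derivatives there. *)
Lemma potential_monotone_flat (sg e : R) : 0 < e ->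
  (forall t, 0 < t -> t < e -> 0 <= sg * derive1 U t) -> sg != 0 -> gradient c x = 0.
Proof.
move=> e0 hU sg0.
have nonneg t : 0 < t -> t < e -> 0 <= sg * U t.
  move=> t0 te; rewrite leNgt; apply/negP => neg.
  have sgp : 0 < `|sg| by rewrite normr_gt0.
  (* At a time t' below this bound, |sg U t'| < - sg U t, whereas sg U
     increases from t' to t. *)
  pose e' := Num.min t (- (sg * U t) / `|sg|).
  have e'0 : 0 < e' by rewrite lt_min t0 divr_gt0 // oppr_gt0.
  have [t' [t'0 t'e Ut' _]] := small_times e'0.
  have t't : t' <= t by apply: ltW; apply: lt_le_trans t'e _; rewrite ge_min lexx.
  have : sg * U t' <= sg * U t.
    apply: (@derive_nondecreasing R (fun t => sg * U t) (fun t => sg * derive1 U t) t' t t't).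
      by move=> r /andP[h1 h2]; apply: dZ; apply: potential_profile_derive; exact: lt_le_trans h1.
    by move=> r /andP[h1 h2]; apply: hU; lra.
  have : `|U t'| < - (sg * U t) / `|sg| by apply: lt_le_trans Ut' _; rewrite ge_min lexx orbT.
  rewrite ltr_pdivlMr // -normrM [U t' * _]mulrC ltr_norml => /andP[h1 h2] h3; lra.
apply/colP => a; rewrite !mxE; have [r r0 hr] := axis_near_orbit a e0.
pose f s := (u \o bwd c) (point a s).
have df (s : R) : `|s| < r -> is_derive s 1 (fun s => sg * f s) (sg * partial a (u \o bwd c) (point a s)).
  move=> sr; apply: dZ; have [cs _] := hr s sr.
  have [h _] := smooth_is_derive a (u_smooth ac) cs.
  exact: (line_derive h).
have m : is_derive (0:R) 1 (fun s => sg * f s) 0.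
  apply: (@derive1_at_min R (fun s => sg * f s) (- r) r 0).
  - by lra.
  - move=> s; rewrite in_itv /= => sr; have [] := df s; last by [].
    by rewrite ltr_norml.
  - by rewrite in_itv /= r0 oppr_lt0 r0.
  - move=> s; rewrite in_itv /= -ltr_norml => /hr[cs ts].
    rewrite {1}/f scale0r addr0 potential_at_orbit mulr0 /f /= potential_orbit_distance.
    have [Ns|ns] := pselect (N (bwd c (point a s))).
      by rewrite -potential_orbit_distance potential_orbit // mulr0.
    by apply: nonneg => //; exact: orbit_distance_gt0.
have [_ e1] := m; have [] := df (0:R); first by rewrite normr0.
move=> _; rewrite e1 scale0r addr0 => /esym/eqP; rewrite mulf_eq0 (negbTE sg0) /=.
by move/eqP.
Qed.

(** If it did not vanish, U'^2 would be nonzero at all times reached by a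
    short ray, hence at all small times, and U' would have a constant sign. *)
Lemma gradient_norm2_orbit : gradient_norm2 c x = 0.
Proof.
have [//|g0] := eqVneq (gradient_norm2 c x) 0; exfalso.
have gp : 0 < `|gradient_norm2 c x| by rewrite normr_gt0.
have [s1 [s10 hs1 hP]] := ray_small (ray_limit (gradient_norm2_smooth ac) gp).
pose e := orbit_distance (bwd c (ray s1)).
have e0 : 0 < e by apply: ray_distance_gt0 => //; apply: hs1; rewrite gtr0_norm.
have U0 t : 0 < t -> t < e -> derive1 U t != 0.
  move=> t0 te; have [s [s0 ss1 <-]] := ray_reaches s10 hs1 t0 te.
  have sn : `|s| <= s1 by rewrite gtr0_norm.
  rewrite -sqrf_eq0 ray_gradient //; last exact: hs1.
  apply/eqP => z; have := hP s sn; rewrite z sub0r normrN.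
  by rewrite ltxx.
pose t1 := e / 2.
have t10 : 0 < t1 by rewrite divr_gt0.
have t1e : t1 < e by rewrite /t1; lra.
pose sg := derive1 U t1.
have sg0 : sg != 0 by exact: U0.
have keep (w : R) a b : w != 0 -> 0 < a -> b < e -> a <= b -> 0 < w * derive1 U a -> 0 < w * derive1 U b.
  move=> w0 a0 be ab; apply: (@stays_positive R (fun t => w * derive1 U t)
     (* U' is known to be differentiable at positive times only, so its
        derivative is chosen there. *)
     (fun t => w * (if pselect (0 < t) is left h then projT1 (cid (potential_profile_derive2 h)) else 0)) a b ab).
    move=> r /andP[h1 h2]; apply: dZ; case: pselect => h.
      by case: cid.
    by exfalso; apply: h; lra.
  by move=> r /andP[h1 h2]; rewrite mulf_neq0 // U0 //; lra.
have pos t : 0 < t -> t < e -> 0 <= sg * derive1 U t.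
  move=> t0 te; have [tt|/ltW tt] := leP t1 t.
    by apply/ltW/(keep sg t1 t) => //; rewrite /sg -expr2 exprn_even_gt0.
  rewrite leNgt; apply/negP => neg.
  have : 0 < (- sg) * derive1 U t1.
    by apply: (keep (- sg) t t1) => //; [rewrite oppr_eq0|rewrite mulNr oppr_gt0].
  by rewrite mulNr oppr_gt0 ltNge -expr2 sqr_ge0.
move: g0; rewrite /gradient_norm2 (potential_monotone_flat e0 pos sg0) mulmx0 mxE.
by rewrite eqxx.
Qed.

Lemma potential_start_at (e : R) : 0 < e ->
  exists t, [/\ 0 < t, t < e, `|U t| < e & `|derive1 U t| < e].
Proof.
(* The square of U' is what tends to 0. *)
move=> e0; pose e' := Num.min e (e ^+ 2).
have e'0 : 0 < e' by rewrite lt_min e0 exprn_gt0.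
have e'e : e' <= e by rewrite ge_min lexx.
have [t [t0 te h1 h2]] := small_times e'0.
exists t; split => //; [exact: lt_le_trans te e'e|exact: lt_le_trans h1 e'e|].
move: h2; rewrite gradient_norm2_orbit subr0 => h2.
have : `|derive1 U t| ^+ 2 < e ^+ 2.
  by rewrite -normrX; apply: lt_le_trans h2 _; rewrite ge_min lexx orbT.
by rewrite ltr_pXn2r // nnegrE // ltW.
Qed.

End OrbitPoint.

Lemma potential_start (e : R) : 0 < e ->
  exists t, [/\ 0 < t, t < e, `|U t| < e & `|derive1 U t| < e].
Proof.
have [c [x [ac cx Nx leaves]]] := slice_chart.
exact: (potential_start_at ac cx Nx leaves).
Qed.

(** If U vanishes then so does u, and the soliton equation is the Einstein
    equation. *)
Lemma potential_neq0 (eps : R) : gradient_soliton eps gbar u -> ~ einstein gbar ->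
  exists2 t, 0 < t & U t != 0.
Proof.
move=> [_ _ sol] nE; apply/not_exists2P => /= U0; apply: nE; exists (- (eps / 2)) => c ac x cx.
have u0 q : u q = 0.
  have [/potential_orbit//|nq] := pselect (N q).
  have [//|/negP un] := eqVneq (u q) 0.
  by have [/(_ (orbit_distance_gt0 nq))|/negP/negPn/eqP] := U0 (orbit_distance q); rewrite -?potential_orbit_distance.
have h0 : hess (gbar c) (u \o bwd c) x = 0.
  have -> : u \o bwd c = (fun=> 0) by apply/funext => y; exact: u0.
  apply/matrixP => i j; rewrite !mxE.
  have -> : partial j (fun=> 0 : R) = (fun=> 0) :> ('rV[R]_n.+1 -> R).
    by apply/funext => y; exact: partial_cst.
  rewrite partial_cst big1 ?subr0 // => l _.
  by rewrite partial_cst mulr0.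
by move/eqP: (sol c ac x cx); rewrite h0 addr0 addr_eq0 => /eqP ->; rewrite scaleNr.
Qed.

(** * The soliton equations in a product chart *)

Section ProductChart.
Local Opaque partial invmx smooth_on.
Variable eps : R.
Hypothesis soliton : gradient_soliton eps gbar u.
Variables (d : chart R P n) (c : chart R M n.+1).
Hypotheses (ad : atlas P d) (pc : product_chart d c).

Definition slice_metric (z : 'rV[R]_(1 + n)) : 'M[R]_n := drsubmx (gbar c z : 'M[R]_(1 + n)).
Local Notation g := slice_metric.
Local Notation f := (u \o bwd c).

Lemma product_chart_atlas : atlas M c. Proof. by case: pc. Qed.

Lemma slice_point_ran (s : R) y : 0 < s -> ran d y -> ran c (slice_point s y).
Proof. by move=> s0 dy; apply/(product_chart_ran _ pc); exists s, y. Qed.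

Lemma slice_metricE (s : R) y : 0 < s -> ran d y -> g (slice_point s y) = g_ s d y.
Proof. by move=> s0 dy; case: pc => _ _ _ h; rewrite /g h // block_mxKdr. Qed.

Lemma product_metricE z : ran c z -> gbar c z = product_metric g z.
Proof.
move=> /(product_chart_ran _ pc)[s [y [s0 dy ->]]]; rewrite /product_metric slice_metricE //.
by case: pc => _ _ _ ->.
Qed.

Lemma slice_metric_smooth i j : smooth_on (ran c) (fun z => g z i j).
Proof.
have := metric_smooth gbar_metric product_chart_atlas (rshift 1 i) (rshift 1 j).
by congr smooth_on; apply/funext => z; rewrite !mxE.
Qed.

Lemma slice_metric_sym z : ran c z -> (g z)^T = g z.
Proof.
move=> /(product_chart_ran _ pc)[s [y [s0 dy ->]]]; rewrite slice_metricE //.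
exact: (metric_sym (coh1_metric coh s0) ad dy).
Qed.

Lemma slice_metric_posdef (s : R) y : 0 < s -> ran d y -> posdef (g_ s d y).
Proof. by move=> s0 dy; exact: (metric_pos (coh1_metric coh s0) ad dy). Qed.

Lemma slice_metric_unit z : ran c z -> g z \in unitmx.
Proof.
move=> cz; apply: posdef_unit; first exact: slice_metric_sym.
have /(product_chart_ran _ pc)[s [y [s0 dy ->]]] := cz; rewrite slice_metricE //.
exact: slice_metric_posdef.
Qed.

Lemma potential_space i z : ran c z -> partial (space_dir i) f z = 0.
Proof.
move=> /(product_chart_ran _ pc)[s [y [s0 dy ->]]]; rewrite partial_slice.
rewrite (partial_local i (@ran_open _ _ _ d) (g := fun=> U s) _ dy) ?partial_cst //.
by move=> y' dy'; exact: (potential_slice pc s0 dy').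
Qed.

Lemma time_derivativeE i j (s : R) y : 0 < s -> ran d y ->
  time_derivative g i j (slice_point s y) = derive1 (fun s => g_ s d y i j) s.
Proof.
move=> s0 dy; have [h _] := smooth_is_derive (time_dir n) (slice_metric_smooth i j) (slice_point_ran s0 dy).
rewrite derive1E; apply/esym; have [] // := is_derive_positive s0 (f := fun s => g_ s d y i j) _ (derive_time h).
by move=> r r0; rewrite slice_metricE.
Qed.

Lemma time_metric_slice (s : R) y : 0 < s -> ran d y ->
  time_metric g (slice_point s y) = 2 *: (g_ s d y *m L_ s d y).
Proof.
move=> s0 dy; have [_ <-] := coh1_shape coh s0 ad dy.
by apply/matrixP => i j; rewrite mxE mxE time_derivativeE.
Qed.

(** 2 g L is the time derivative of a family of symmetric matrices. *)
Lemma shape_selfadjoint (s : R) y : 0 < s -> ran d y ->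
  (g_ s d y *m L_ s d y)^T = g_ s d y *m L_ s d y.
Proof.
move=> s0 dy; have two : (2 : R) != 0 by rewrite pnatr_eq0.
apply: (can_inj (scalerK two)); rewrite -linearZ /= -time_metric_slice //.
exact: (time_metric_sym (@ran_open _ _ _ c) slice_metric_sym (slice_point_ran s0 dy)).
Qed.

Lemma shape_matrix_slice (s : R) y : 0 < s -> ran d y -> shape_matrix g (slice_point s y) = L_ s d y.
Proof.
move=> s0 dy.
have -> : shape_matrix g (slice_point s y) = 2^-1 *: (invmx (g (slice_point s y)) *m time_metric g (slice_point s y)).
  exact: shape_matrixE.
rewrite time_metric_slice // -scalemxAr scalerA mulVf ?pnatr_eq0 // scale1r -slice_metricE // mulKmx //.
exact/slice_metric_unit/slice_point_ran.
Qed.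

Lemma slice_meanE (s : R) y : 0 < s -> ran d y -> slice_mean g (slice_point s y) = \tr (L_ s d y).
Proof. by move=> s0 dy; rewrite mean_trace shape_matrix_slice. Qed.

Lemma shape_square_slice (s : R) y : 0 < s -> ran d y ->
  shape_square g (slice_point s y) = \tr (L_ s d y *m L_ s d y).
Proof. by move=> s0 dy; rewrite shape_squareE shape_matrix_slice. Qed.

Lemma mean_space i z : ran c z -> partial (space_dir i) (slice_mean g) z = 0.
Proof.
move=> /(product_chart_ran _ pc)[s [y [s0 dy ->]]]; rewrite partial_slice.
have [H0 hH] := coh1_mean_curvature coh s0.
rewrite (partial_local i (@ran_open _ _ _ d) (g := fun=> H0) _ dy) ?partial_cst //.
by move=> y' dy'; rewrite slice_meanE // hH.
Qed.

Lemma soliton_product z : ran c z ->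
  ric (product_metric g) z + hess (product_metric g) f z + (eps / 2) *: product_metric g z = 0.
Proof.
move=> cz; have [_ _ h] := soliton; have := h c product_chart_atlas z cz.
have E := product_metricE; have oc := @ran_open _ _ _ c.
by rewrite (ric_local oc E cz) (hess_local oc E (fun _ _ => erefl) cz) E.
Qed.

Lemma slice_scal_slice (s : R) y : 0 < s -> ran d y ->
  slice_scal g (slice_point s y) = scal (g_ s d) y.
Proof.
move=> s0 dy; rewrite slice_scal_restrict /scal slice_metricE //.
by rewrite (ric_local (@ran_open _ _ _ d) (fun y' dy' => slice_metricE s0 dy') dy).
Qed.

Lemma potential_time (s : R) y : 0 < s -> ran d y ->
  partial (time_dir n) f (slice_point s y) = derive1 U s.
Proof. by move=> s0 dy; rewrite (potential_derive1 pc s0 dy). Qed.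

Let oc := @ran_open _ _ _ c.

Lemma mean_derive (s : R) y : 0 < s -> ran d y ->
  is_derive s 1 (fun s => \tr (L_ s d y)) (partial (time_dir n) (slice_mean g) (slice_point s y)).
Proof.
move=> s0 dy; have cz := slice_point_ran s0 dy.
have [h _] := smooth_is_derive (time_dir n) (slice_mean_smooth oc slice_metric_smooth slice_metric_unit) cz.
by apply: (is_derive_positive s0 _ (derive_time h)) => r r0; rewrite slice_meanE.
Qed.

Lemma scal_shape_derive (s : R) y : 0 < s -> ran d y ->
  is_derive s 1 (fun s => scal (g_ s d) y + \tr (L_ s d y *m L_ s d y))
    (partial (time_dir n) (fun z => slice_scal g z + shape_square g z) (slice_point s y)).
Proof.
move=> s0 dy; have cz := slice_point_ran s0 dy.
have sm : smooth_on (ran c) (fun z => slice_scal g z + shape_square g z).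
  apply: (smooth_add oc).
    exact: (slice_scal_smooth oc slice_metric_smooth slice_metric_unit).
  exact: (shape_square_smooth oc slice_metric_smooth slice_metric_unit).
have [h _] := smooth_is_derive (time_dir n) sm cz.
apply: (is_derive_positive s0 _ (derive_time h)) => r r0.
by rewrite slice_scal_slice // shape_square_slice.
Qed.

Lemma mean_ode (s : R) y : 0 < s -> ran d y ->
  partial (time_dir n) (slice_mean g) (slice_point s y) =
  partial (time_dir n) (partial (time_dir n) f) (slice_point s y) + eps / 2 - \tr (L_ s d y *m L_ s d y).
Proof.
move=> s0 dy; rewrite -shape_square_slice //.
exact: (mean_evolution oc slice_metric_smooth slice_metric_sym slice_metric_unit soliton_product (slice_point_ran s0 dy)).
Qed.

Lemma scal_ode (s : R) y : 0 < s -> ran d y ->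
  scal (g_ s d) y = partial (time_dir n) (slice_mean g) (slice_point s y)
    + (\tr (L_ s d y) - derive1 U s) * \tr (L_ s d y) - n%:R * (eps / 2).
Proof.
move=> s0 dy; rewrite -slice_scal_slice // -slice_meanE // -(potential_time s0 dy).
exact: (scal_equation oc slice_metric_smooth slice_metric_sym slice_metric_unit potential_space soliton_product (slice_point_ran s0 dy)).
Qed.

Lemma scal_shape_ode (s : R) y : 0 < s -> ran d y ->
  partial (time_dir n) (fun z => slice_scal g z + shape_square g z) (slice_point s y) =
  - 2 * (\tr (L_ s d y) - derive1 U s) * \tr (L_ s d y *m L_ s d y) + eps * \tr (L_ s d y).
Proof.
move=> s0 dy; rewrite -shape_square_slice // -slice_meanE // -(potential_time s0 dy).
exact: (scal_shape_evolution oc slice_metric_smooth slice_metric_sym slice_metric_unit potential_space mean_space soliton_product (slice_point_ran s0 dy)).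
Qed.

Lemma mean_ode_scal (s : R) y : 0 < s -> ran d y ->
  partial (time_dir n) (slice_mean g) (slice_point s y) =
  scal (g_ s d) y + \tr (L_ s d y *m L_ s d y) - \tr (L_ s d y *m L_ s d y)
  - \tr (L_ s d y) * (\tr (L_ s d y) - derive1 U s) + n%:R * (eps / 2).
Proof. move=> s0 dy; exact: (solve_mean_rate _ (scal_ode s0 dy)). Qed.

Lemma potential_ode (s : R) y : 0 < s -> ran d y ->
  partial (time_dir n) (partial (time_dir n) f) (slice_point s y) =
  scal (g_ s d) y + \tr (L_ s d y *m L_ s d y)
  - \tr (L_ s d y) * (\tr (L_ s d y) - derive1 U s) + (n%:R - 1) * (eps / 2).
Proof. move=> s0 dy; exact: (solve_potential_rate (mean_ode s0 dy) (scal_ode s0 dy)). Qed.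

(** Jacobi's formula and g' = 2 g L. *)
Lemma density_derive (Q : tensor2 P) (s : R) y : 0 < s -> ran d y ->
  is_derive s 1 (fun s => volume_density Q (g_ s) d y)
    (\tr (L_ s d y) * volume_density Q (g_ s) d y).
Proof.
move=> s0 dy; have p0 : 0 < \det (g_ s d y).
  by apply: posdef_det; [exact: (metric_sym (coh1_metric coh s0) ad dy)|exact: slice_metric_posdef].
have hK i j : is_derive s 1 (fun s => g_ s d y i j) ((2 *: (g_ s d y *m L_ s d y)) i j).
  have [hd <-] := coh1_shape coh s0 ad dy; rewrite mxE derive1E.
  exact/derivableP/hd.
have uG : g_ s d y \in unitmx by rewrite -slice_metricE //; exact/slice_metric_unit/slice_point_ran.
have h := @is_derive1_comp R Num.sqrt (fun s => \det (g_ s d y)) s _ _ (is_derive1_sqrt p0) (ddet_unit uG hK).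
apply: (is_derive_eq (dM h (dC (Num.sqrt (\det (Q d y)))^-1 s 1))).
have q0 : Num.sqrt (\det (g_ s d y)) != 0 by rewrite gt_eqF // sqrtr_gt0.
rewrite mulr0 addr0 -scalemxAr mulKmx // mxtraceZ -{2}[\det (g_ s d y)]sqr_sqrtr; last exact: ltW.
exact: sqrt_rate.
Qed.

End ProductChart.

(** * The function F_0 along the trajectory *)

Section Trajectory.
Variables (eps : R) (Q : tensor2 P) (v : R -> R).
Hypothesis soliton : gradient_soliton eps gbar u.
Hypothesis Qv : relative_volume Q g_ v.
Hypothesis Q_metric : riemannian_metric Q.

(** By the Riccati equation tau = U'' + eps/2 - H', and neither U nor H
    depends on the point of the hypersurface. *)
Lemma shape_square_constant (s : R) d d' y y' : 0 < s -> atlas P d -> atlas P d' ->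
  ran d y -> ran d' y' -> \tr (L_ s d y *m L_ s d y) = \tr (L_ s d' y' *m L_ s d' y').
Proof.
move=> s0 ad ad' dy dy'.
have [c pc] := product_chart_exists ad; have [c' pc'] := product_chart_exists ad'.
have e1 := mean_ode soliton ad pc s0 dy; have e2 := mean_ode soliton ad' pc' s0 dy'.
have := potential_derive2 pc s0 dy; have := potential_derive2 pc' s0 dy' => - [_ +] [_ +].
move=> -> E.
have [_ m1] := mean_derive ad pc s0 dy.
have [_ m2] : is_derive s 1 (fun s => \tr (L_ s d y)) (partial (time_dir n) (slice_mean (slice_metric c')) (slice_point s y')).
  apply: (is_derive_positive s0 _ (mean_derive ad' pc' s0 dy')) => r r0.
  by have [H0 hH] := coh1_mean_curvature coh r0; rewrite !hH.
by move: e1; rewrite -m1 m2 e2 E => /addrI /oppr_inj.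
Qed.

Lemma F0_trajectory (s : R) d y : (0 < n)%N -> 0 < s -> atlas P d -> ran d y ->
  F0 Q (trajectory g_ L_ U s) d y = v s `^ (2 / n%:R) *
    (scal (g_ s d) y + \tr (L_ s d y *m L_ s d y) - \tr (L_ s d y) ^+ 2 / n%:R).
Proof. by move=> n0 s0 ad dy; rewrite /F0 /= Qv // tracefree_square // addrA. Qed.

Lemma F0_nonincreasing : (0 < n)%N -> 0 < eps -> ~ einstein gbar ->
  exists F : R -> R,
    (forall t, 0 < t -> forall d, atlas P d -> forall x, ran d x ->
       F0 Q (trajectory g_ L_ U t) d x = F t) /\
    exists2 T : R, 0 < T & forall s t, T <= s -> s <= t -> F t <= F s.
Proof.
move=> n0 eps0 nE; have [p _] := P_inhabited; have [d ad dp] := atlas_cover p.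
have [c pc] := product_chart_exists ad; have dy := fwd_ran dp; set y := fwd d p in dy.
pose H t := \tr (L_ t d y); pose q t := \tr (L_ t d y *m L_ t d y).
pose S t := scal (g_ t d) y + q t.
exists (fun t => v t `^ (2 / n%:R) * (S t - H t ^+ 2 / n%:R)); split.
  move=> t t0 d' ad' x dx; rewrite F0_trajectory //.
  have [S0 hS] := coh1_scal coh t0; have [H0 hH] := coh1_mean_curvature coh t0.
  by rewrite /S /q /H (shape_square_constant t0 ad' ad dx dy) !hS // !hH.
apply: (@F0_eventually_nonincreasing R n eps U (derive1 U) H S q v n0 eps0).
- exact: potential_profile_derive.
- by move=> t t0; rewrite -(potential_ode soliton ad pc t0 dy); exact: (potential_derive2 pc t0 dy).
- by move=> t t0; rewrite -(mean_ode_scal soliton ad pc t0 dy); exact: (mean_derive ad pc t0 dy).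
- by move=> t t0; rewrite -(scal_shape_ode soliton ad pc t0 dy); exact: (scal_shape_derive ad pc t0 dy).
- move=> t t0; have h := density_derive ad pc Q t0 dy; rewrite (Qv t0 ad dy) in h.
  by apply: (is_derive_positive t0 (g := fun s => volume_density Q (g_ s) d y) _ h) => r r0; rewrite Qv.
- move=> t t0; rewrite -(Qv t0 ad dy) /volume_density divr_gt0 // sqrtr_gt0; apply: posdef_det.
  + exact: (metric_sym (coh1_metric coh t0) ad dy).
  + exact: (metric_pos (coh1_metric coh t0) ad dy).
  + exact: (metric_sym Q_metric ad dy).
  + exact: (metric_pos Q_metric ad dy).
- move=> t t0; apply: (trace_square_ge n0 _ _ (shape_selfadjoint ad pc t0 dy)).
  + exact: (metric_sym (coh1_metric coh t0) ad dy).
  + exact: (metric_pos (coh1_metric coh t0) ad dy).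
- exact: potential_start.
- exact: (potential_neq0 soliton nE).
Qed.

End Trajectory.

End SpecialOrbit.

Theorem proposition1p17 (R : realType) (n k : nat) (eps : R)
    (M : manifold R n.+1) (P : manifold R n)
    (gbar : tensor2 M) (u : M -> R)
    (N : set M) (Phi : R -> P -> M)
    (g_ L_ : R -> tensor2 P) (U : R -> R)
    (Q : tensor2 P) (v : R -> R)
    (hk : (1 <= k <= n)%N)
    (heps : 0 < eps)
    (hsoliton : gradient_soliton eps gbar u)
    (hcomplete : complete_metric gbar)
    (hnonEinstein : ~ einstein gbar)
    (hcoh1 : cohomogeneity_one k gbar u N Phi g_ L_ U)
    (hQ : riemannian_metric Q)
    (hv : relative_volume Q g_ v) :
  exists F : R -> R,
    (forall t, 0 < t -> forall d, atlas P d -> forall x, ran d x ->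
       F0 Q (trajectory g_ L_ U t) d x = F t) /\
    exists2 T : R, 0 < T & forall s t, T <= s -> s <= t -> F t <= F s.
Proof.
have [k1 kn] := andP hk; have n0 : (0 < n)%N by exact: leq_trans kn.
have [gbar_metric u_smooth _] := hsoliton.
exact: (F0_nonincreasing gbar_metric u_smooth hcoh1 hsoliton hv hQ n0 heps hnonEinstein).
Qed.
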